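(* Let $L>0$, $g>0$, $\mu>0$, $\Omega=(2\pi L\mathbb{T})^2\times\mathbb{R}$, let $\bar\rho=\bar\rho(x_3)\in L^\infty(\mathbb{R})$ satisfy $\bar\rho'\in C_0^\infty(\mathbb{R})$, $\inf_{\mathbb{R}}\bar\rho>0$ and $\bar\rho'(x_3^0)>0$ for some $x_3^0$, and let $\bar{\mathbf M}$ be either $M\mathbf e_1$ with $M\neq0$ constant, or $M\mathbf e_3$ with $M$ constant, $|M|\in(0,M_{\mathrm c})$. Let $\mathbb{A}^{\mathrm g}$ and $\lambda(\xi)$ be as in the context and set $$\Lambda:=\sup_{\xi\in\mathbb{A}^{\mathrm g}\cap(L^{-1}\mathbb{Z})^2}\lambda(\xi).$$ Then there exist a constant $\Lambda^*\in(2\Lambda/3,\Lambda]$ and a real-valued, horizontally periodic solution $(\varrho,\mathbf u,\mathbf N,q)$ on $\Omega$ of the linearized problem $$\varrho_t+\bar\rho'u_3=0,\quad \bar\rho\mathbf u_t+\nabla q+g\varrho\mathbf e_3=\mu\Delta\mathbf u+(\nabla\times\mathbf N)\times\bar{\mathbf M},\quad \mathbf N_t=\nabla\times(\mathbf u\times\bar{\mathbf M}),\quad\operatorname{div}\mathbf u=\operatorname{div}\mathbf N=0,$$ with $\lim_{|x_3|\to\infty}(\varrho,\mathbf u,\mathbf N)(t,\mathbf x',x_3)=\mathbf 0$ for all $t>0$, such that: (1) $\|(\varrho,\mathbf u,\mathbf N,q)(0)\|_{H^k(\Omega)}<\infty$ for every $k\in\mathbb{N}$; (2) for every $t>0$ and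 $k\in\mathbb{N}$, $(\varrho,\mathbf u,\mathbf N,q)(t)\in H^k(\Omega)$, $\|(\varrho,\mathbf N,q)(t)\|_{H^k}=e^{\Lambda^*t}\|(\varrho,\mathbf N,q)(0)\|_{H^k}$ and $\|u_i(t)\|_{H^k}=e^{\Lambda^*t}\|u_i(0)\|_{H^k}$ for $i=1,2,3$; (3) $\operatorname{div}\mathbf u(0)=\operatorname{div}\mathbf N(0)=0$ and $\|(u_1,u_2)(0)\|_{L^2}\,\|u_3(0)\|_{L^2}>0$; (4) if $\bar{\mathbf M}=M\mathbf e_3$, then $\|N_3(0)\|_{L^2}>0$.
   Context: Functions on $\Omega$ are $2\pi L$-periodic in $x_1,x_2$; $\mathbf x=(\mathbf x',x_3)$; $'=d/dx_3$; $\mathbf e_1=(1,0,0)$, $\mathbf e_3=(0,0,1)$. Functions $\psi$ below are real-valued functions of $x_3$, and $\xi=(\xi_1,\xi_2)\in\mathbb{R}^2$. $M_{\mathrm c}:=\sqrt{\sup_{\psi\in H^1(\mathbb{R}),\psi\not\equiv0}\int g\bar\rho'\psi^2dx_3/\int|\psi'|^2dx_3}\in(0,\infty]$. Horizontal case ($\bar{\mathbf M}=M\mathbf e_1$): for $0<|M\xi_1|/|\xi|<M_{\mathrm c}$, $S(\xi):=\sqrt{\sup_{\psi\in H^1,\psi\not\equiv0}(g|\xi|^2\int\bar\rho'\psi^2/(M\xi_1)^2-\int|\psi'|^2)/\int|\psi|^2}$; $\mathbb{A}^{\mathrm g}:=(\{\xi:|\xi_1M|/|\xi|\in(0,M_{\mathrm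 c}),|\xi|<S(\xi)\}\cup\{\xi_1=0\})\setminus\{\mathbf 0\}$; $E_0(\psi):=\int[M^2\xi_1^2(\psi^2+|\psi'|^2/|\xi|^2)-g\bar\rho'\psi^2]dx_3$. Vertical case ($\bar{\mathbf M}=M\mathbf e_3$): $\mathcal M_{\mathrm{vc}}:=\{\psi\in H^2:\int(g\bar\rho'\psi^2-M^2|\psi'|^2)>0\}$; $|\xi|^M_{\mathrm{vc}}:=\sqrt{\inf_{\psi\in\mathcal M_{\mathrm{vc}}}M^2\int|\psi''|^2/\int(g\bar\rho'\psi^2-M^2|\psi'|^2)}$; $\mathbb{A}^{\mathrm g}:=\{\xi:|\xi|>|\xi|^M_{\mathrm{vc}}\}$; $E_0(\psi):=\int[M^2(|\psi'|^2+|\psi''|^2/|\xi|^2)-g\bar\rho'\psi^2]dx_3$. In both cases, for $\xi\ne0$: $\mathcal A:=\{\psi\in H^2(\mathbb{R}):\int\bar\rho(|\xi|^2\psi^2+|\psi'|^2)dx_3=1\}$, $E_1(\psi):=\mu\int(4|\xi|^2|\psi'|^2+||\xi|^2\psi+\psi''|^2)dx_3$, $E(\psi,s):=|\xi|^2E_0(\psi)+sE_1(\psi)$, $\alpha(\xi,s):=\inf_{\psi\in\mathcal A}E(\psi,s)$, $\mathfrak S_\xi:=\sup\{s>0:\alpha(\xi,\tau)<0\ \forall\tau\in(0,s)\}>0$; for $\xi\in\mathbb{A}^{\mathrm g}$, $\lambda(\xi)$ denotes the unique $s\in(0,\mathfrak S_\xi)$ with $s=\sqrt{-\alpha(\xi,s)}$.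 It is known that $\mathbb{A}^{\mathrm g}\cap(L^{-1}\mathbb{Z})^2$ is nonempty and $0<\Lambda<\infty$. *)

(* Defs.v *)
From HB Require Import structures.
From mathcomp Require Import all_boot all_order all_algebra.
From mathcomp Require Import all_classical all_reals all_analysis.
Set Implicit Arguments. Unset Strict Implicit. Unset Printing Implicit Defensive.
Import Order.TTheory GRing.Theory Num.Theory.
Import numFieldNormedType.Exports.
Local Open Scope classical_set_scope.
Local Open Scope ring_scope.

Section Defs.
Variable R : realType.

Definition esqrt (x : \bar R) : \bar R :=
  match x with EFin r => (Num.sqrt r)%:E | +oo%E => +oo%E | -oo%E => 0%E end.

(* Lebesgue integral over R, and its real value (used on integrable functions) *)
Definition IntR (f : R -> R) : \bar R := (\int[@lebesgue_measure R]_x (f x)%:E)%E.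
Definition iR (f : R -> R) : R := fine (IntR f).

Definition L2R (f : R -> R) : Prop :=
  measurable_fun setT f /\ (IntR (fun x => (f x ^+ 2)%R) < +oo)%E.

Definition smooth1 (f : R -> R) : Prop := forall (n : nat) (x : R), derivable (derive1n n f) x 1.
Definition test_fn (f : R -> R) : Prop :=
  smooth1 f /\ exists r : R, forall x, r < `|x| -> f x = 0.

Definition weak_deriv (f f1 : R -> R) : Prop :=
  forall chi, test_fn chi ->
    IntR (fun x => (f x * derive1 chi x)%R) = (- IntR (fun x => (f1 x * chi x)%R))%E.

Definition H1 (f f1 : R -> R) : Prop := L2R f /\ L2R f1 /\ weak_deriv f f1.
Definition H2 (f f1 f2 : R -> R) : Prop :=
  L2R f /\ L2R f1 /\ L2R f2 /\ weak_deriv f f1 /\ weak_deriv f1 f2.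

(* "psi not identically zero" as an element of L^2 *)
Definition nz (f : R -> R) : Prop := (0 < IntR (fun x => (f x ^+ 2)%R))%E.

Variables (g mu : R) (rhob : R -> R).
Definition drhob : R -> R := derive1 rhob.

Definition Mc : \bar R :=
  esqrt (ereal_sup [set e | exists f f1, H1 f f1 /\ nz f /\
     e = (iR (fun x => g * drhob x * f x ^+ 2) / iR (fun x => f1 x ^+ 2))%:E]).

Inductive Mcase := Horizontal | Vertical.

Definition Mvec (c : Mcase) (M : R) : nat -> R :=
  match c with
  | Horizontal => fun i => if i == 0%N then M else 0
  | Vertical => fun i => if i == 2%N then M else 0
  end.

Definition xnorm (xi : R * R) : R := Num.sqrt (xi.1 ^+ 2 + xi.2 ^+ 2).

Definition Sxi (M : R) (xi : R * R) : \bar R :=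
  esqrt (ereal_sup [set e | exists f f1, H1 f f1 /\ nz f /\
     e = ((g * xnorm xi ^+ 2 * iR (fun x => drhob x * f x ^+ 2) / (M * xi.1) ^+ 2
           - iR (fun x => f1 x ^+ 2)) / iR (fun x => f x ^+ 2))%:E]).

Definition xi_vc (M : R) : \bar R :=
  esqrt (ereal_inf [set e | exists f f1 f2, H2 f f1 f2 /\
     0 < iR (fun x => g * drhob x * f x ^+ 2 - M ^+ 2 * f1 x ^+ 2) /\
     e = (M ^+ 2 * iR (fun x => f2 x ^+ 2)
          / iR (fun x => g * drhob x * f x ^+ 2 - M ^+ 2 * f1 x ^+ 2))%:E]).

Definition Ag (c : Mcase) (M : R) (xi : R * R) : Prop :=
  match c with
  | Horizontal =>
      xi != (0, 0) /\
      ((0 < `|M * xi.1| / xnorm xi /\ ((`|M * xi.1| / xnorm xi)%:E < Mc)%E /\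
        ((xnorm xi)%:E < Sxi M xi)%E) \/ xi.1 = 0)
  | Vertical => (xi_vc M < (xnorm xi)%:E)%E
  end.

Definition E0 (c : Mcase) (M : R) (xi : R * R) (f f1 f2 : R -> R) : R :=
  match c with
  | Horizontal => iR (fun x => M ^+ 2 * xi.1 ^+ 2 * (f x ^+ 2 + f1 x ^+ 2 / xnorm xi ^+ 2)
                              - g * drhob x * f x ^+ 2)
  | Vertical => iR (fun x => M ^+ 2 * (f1 x ^+ 2 + f2 x ^+ 2 / xnorm xi ^+ 2)
                              - g * drhob x * f x ^+ 2)
  end.

Definition E1 (xi : R * R) (f f1 f2 : R -> R) : R :=
  mu * iR (fun x => 4 * xnorm xi ^+ 2 * f1 x ^+ 2 + (xnorm xi ^+ 2 * f x + f2 x) ^+ 2).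

Definition Adm (xi : R * R) (f f1 f2 : R -> R) : Prop :=
  H2 f f1 f2 /\ iR (fun x => rhob x * (xnorm xi ^+ 2 * f x ^+ 2 + f1 x ^+ 2)) = 1.

Definition alpha (c : Mcase) (M : R) (xi : R * R) (s : R) : \bar R :=
  ereal_inf [set e | exists f f1 f2, Adm xi f f1 f2 /\
     e = (xnorm xi ^+ 2 * E0 c M xi f f1 f2 + s * E1 xi f f1 f2)%:E].

Definition Sfrak (c : Mcase) (M : R) (xi : R * R) : \bar R :=
  ereal_sup [set e | exists s, 0 < s /\
     (forall tau, 0 < tau < s -> (alpha c M xi tau < 0)%E) /\ e = s%:E].

Definition lam_spec (c : Mcase) (M : R) (xi : R * R) (s : R) : Prop :=
  0 < s /\ (s%:E < Sfrak c M xi)%E /\ s%:E = esqrt (- alpha c M xi s)%E.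

(* lambda(xi): the unique s with the property above *)
Definition lam (c : Mcase) (M : R) (xi : R * R) : R := xget 0 [set s | lam_spec c M xi s].

Definition lattice (L : R) (xi : R * R) : Prop :=
  exists k1 k2 : int, xi = (k1%:~R / L, k2%:~R / L).

Definition Lam (c : Mcase) (M L : R) : \bar R :=
  ereal_sup [set e | exists xi, Ag c M xi /\ lattice L xi /\ e = (lam c M xi)%:E].

Definition Mhyp (c : Mcase) (M : R) : Prop :=
  match c with
  | Horizontal => M != 0
  | Vertical => 0 < `|M| /\ ((`|M|)%:E < Mc)%E
  end.

Definition fld := R -> R -> R -> R -> R.   (* (t, x1, x2, x3) *)

Definition pd (i : nat) (f : fld) : fld := fun t x1 x2 x3 =>
  match i with
  | 0 => derive1 (fun s => f s x1 x2 x3) t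
  | 1 => derive1 (fun s => f t s x2 x3) x1
  | 2 => derive1 (fun s => f t x1 s x3) x2
  | _ => derive1 (fun s => f t x1 x2 s) x3
  end.
Definition pdable (i : nat) (f : fld) (t x1 x2 x3 : R) : Prop :=
  match i with
  | 0 => derivable (fun s => f s x1 x2 x3) t 1
  | 1 => derivable (fun s => f t s x2 x3) x1 1
  | 2 => derivable (fun s => f t x1 s x3) x2 1
  | _ => derivable (fun s => f t x1 x2 s) x3 1
  end.
Definition smoothF (f : fld) : Prop :=
  forall (l : seq nat) (i : nat) t x1 x2 x3, pdable i (foldr pd f l) t x1 x2 x3.

Definition hperiodic (L : R) (f : fld) : Prop :=
  forall t x1 x2 x3, f t (x1 + 2 * pi * L) x2 x3 = f t x1 x2 x3 /\
                     f t x1 (x2 + 2 * pi * L) x3 = f t x1 x2 x3.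

Definition vanish_at_infty (f : fld) : Prop :=
  forall t x1 x2, 0 < t ->
    (f t x1 x2 x3 @[x3 --> +oo] --> 0) /\ (f t x1 x2 x3 @[x3 --> -oo] --> 0).

(* vector fields: components 0,1,2 *)
Definition vfld := nat -> fld.
Definition divF (v : vfld) : fld := fun t x1 x2 x3 =>
  pd 1 (v 0%N) t x1 x2 x3 + pd 2 (v 1%N) t x1 x2 x3 + pd 3 (v 2%N) t x1 x2 x3.
Definition curlF (v : vfld) : vfld := fun i t x1 x2 x3 =>
  match i with
  | 0 => pd 2 (v 2%N) t x1 x2 x3 - pd 3 (v 1%N) t x1 x2 x3
  | 1 => pd 3 (v 0%N) t x1 x2 x3 - pd 1 (v 2%N) t x1 x2 x3
  | _ => pd 1 (v 1%N) t x1 x2 x3 - pd 2 (v 0%N) t x1 x2 x3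
  end.
Definition crossC (v : vfld) (m : nat -> R) : vfld := fun i t x1 x2 x3 =>
  match i with
  | 0 => v 1%N t x1 x2 x3 * m 2%N - v 2%N t x1 x2 x3 * m 1%N
  | 1 => v 2%N t x1 x2 x3 * m 0%N - v 0%N t x1 x2 x3 * m 2%N
  | _ => v 0%N t x1 x2 x3 * m 1%N - v 1%N t x1 x2 x3 * m 0%N
  end.
Definition lapF (f : fld) : fld := fun t x1 x2 x3 =>
  pd 1 (pd 1 f) t x1 x2 x3 + pd 2 (pd 2 f) t x1 x2 x3 + pd 3 (pd 3 f) t x1 x2 x3.

Definition lin_sol (m : nat -> R) (rho : fld) (u N : vfld) (q : fld) : Prop :=
  forall t x1 x2 x3, 0 < t ->
  [/\ pd 0 rho t x1 x2 x3 + drhob x3 * u 2%N t x1 x2 x3 = 0,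
      forall i : nat, (i < 3)%N ->
        rhob x3 * pd 0 (u i) t x1 x2 x3 + pd i.+1 q t x1 x2 x3
          + (if i == 2%N then g * rho t x1 x2 x3 else 0)
        = mu * lapF (u i) t x1 x2 x3 + crossC (curlF N) m i t x1 x2 x3,
      forall i : nat, (i < 3)%N ->
        pd 0 (N i) t x1 x2 x3 = curlF (crossC u m) i t x1 x2 x3,
      divF u t x1 x2 x3 = 0 & divF N t x1 x2 x3 = 0].

Definition cellL2 (L : R) (h : R -> R -> R -> R) : \bar R :=
  (\int[@lebesgue_measure R]_x3
     \int[@lebesgue_measure R]_(x2 in `[0%R, (2 * pi * L)%R])
       \int[@lebesgue_measure R]_(x1 in `[0%R, (2 * pi * L)%R]) ((h x1 x2 x3) ^+ 2)%R%:E)%E.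

Definition dmi (a1 a2 a3 : nat) (f : fld) : fld :=
  iter a1 (pd 1) (iter a2 (pd 2) (iter a3 (pd 3) f)).

Definition Hk2 (L : R) (k : nat) (f : fld) (t : R) : \bar R :=
  (\sum_(a1 < k.+1) \sum_(a2 < k.+1) \sum_(a3 < k.+1 | (a1 + a2 + a3 <= k)%N)
     cellL2 L (dmi a1 a2 a3 f t))%E.

Definition Hk (L : R) (k : nat) (f : fld) (t : R) : \bar R := esqrt (Hk2 L k f t).

End Defs.

(* Main.v *)
Require Import Defs.
From HB Require Import structures.
From mathcomp Require Import all_boot all_order all_algebra.
From mathcomp Require Import all_classical all_reals all_analysis.
From mathcomp Require Import measurable_realfun ring lra.
Import Order.TTheory GRing.Theory Num.Theory.
Import numFieldNormedType.Exports.
Local Open Scope classical_set_scope.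
Local Open Scope ring_scope.
Set Implicit Arguments. Unset Strict Implicit. Unset Printing Implicit Defensive.

(* A normal mode e^{st} (cos|sin)(xi.x') w(x_3) solves the linearized problem as
   soon as the vertical profile psi of u_3 solves a fourth-order linear ODE, the
   Euler-Lagrange equation of E(., s) + s^2 J, J being the constraint functional of A,
   where s = lambda(xi).  The other fields are explicit in psi, and since everything
   grows like e^{st}, the theorem follows for Lambda* = lambda(xi) with xi chosen
   almost optimal in the supremum Lambda.

   Existence of psi does not need compactness of minimizing sequences.  Outside the
   support of rho' the ODE has constant coefficients, so decay at infinity amounts to
   four linear conditions on a four-dimensional solution space.  If the determinant of
   these conditions vanishes there is a decaying solution.  Otherwise the inhomogeneous
   ODE is solvable with a uniform bound for bump data, which yields pointwise bounds on
   f^2 by the quadratic form Q = E + s^2 J; hence Q controls the negative gravity term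
   and s^2 J <= C Q, contradicting alpha(xi, s) = - s^2. *)

(** * Smooth functions and decay classes *)

(** Since [alpha(xi, s) = - s^2], the form Q is nonnegative and its infimum on unit mass is 0.
    Nonnegativity gives Cauchy-Schwarz for Q, which turns solvability for bumps into pointwise
    bounds. They are needed only on a bounded interval carrying rho', where the one negative term
    lives. The bumps have unbounded height, yet the bounds are uniform because the forcing enters
    the ODE estimate through its primitive, which the mass controls. An almost optimal xi exists
    once Lambda is finite and positive, so one unstable lattice frequency must be exhibited. For the
    horizontal field, xi_1 = 0 switches the magnetic energy off. For the vertical field, |M| < M_c
    speaks of H^1 functions while frequencies and energies are defined over H^2. An H^1 competitor
    therefore has to be regularised without increasing its Dirichlet integral, and Steklov averages
    do that. The factor 2/3 enters only as a number in [0, 1). *)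

Section Calculus.
Variable R : realType.
Implicit Types (f g : R -> R) (x y a : R).

Definition isd f g := forall x, is_derive x 1 f (g x).

Lemma isdE f g : isd f g -> derive1 f = g.
Proof. by move=> H; apply/funext => x; rewrite derive1E; apply: derive_val. Qed.

Lemma isd_derivable f g x : isd f g -> derivable f x 1.
Proof. by move=> /(_ x) []. Qed.

Lemma isdP f : (forall x, derivable f x 1) -> isd f (derive1 f).
Proof. by move=> H x; rewrite derive1E; apply: derivableP. Qed.

Lemma isd_cont f g : isd f g -> continuous f.
Proof.
by move=> H x; apply/differentiable_continuous/derivable1_diffP; apply: isd_derivable H.
Qed.

Lemma isd_ext f f' g g' : isd f g -> f =1 f' -> g =1 g' -> isd f' g'.
Proof. by move=> H /funext <- /funext <-. Qed.

Lemma isdD f f' g g' : isd f f' -> isd g g' -> isd (fun x => f x + g x) (fun x => f' x + g' x).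
Proof. by move=> H H' x; exact: is_deriveD. Qed.

Lemma isdN f f' : isd f f' -> isd (fun x => - f x) (fun x => - f' x).
Proof. by move=> H x; exact: is_deriveN. Qed.

Lemma isdB f f' g g' : isd f f' -> isd g g' -> isd (fun x => f x - g x) (fun x => f' x - g' x).
Proof. by move=> H H' x; exact: is_deriveB. Qed.

Lemma isdM f f' g g' : isd f f' -> isd g g' ->
  isd (fun x => f x * g x) (fun x => f' x * g x + f x * g' x).
Proof.
move=> H H' x; apply: is_derive_eq; first exact: is_deriveM.
by rewrite /GRing.scale /=; ring.
Qed.

Lemma isdC a : isd (fun=> a) (fun=> 0).
Proof. by move=> x; exact: is_derive_cst. Qed.

Lemma isdX : isd (fun x => x) (fun=> 1).
Proof. by move=> x; exact: is_derive_id. Qed.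

Lemma isdZ a f f' : isd f f' -> isd (fun x => a * f x) (fun x => a * f' x).
Proof. by move=> H x; exact: (@is_deriveZ _ _ _ f a x 1 (f' x) (H x)). Qed.

Lemma isd_comp f f' g g' : isd f f' -> isd g g' ->
  isd (fun x => f (g x)) (fun x => f' (g x) * g' x).
Proof. by move=> H H' x; exact: (@is_derive1_comp _ f g). Qed.

Lemma isd_expR : isd (@expR R) (@expR R).
Proof. by move=> x; exact: is_derive_expR. Qed.

Lemma isd_affine a b : isd (fun x => a * x + b) (fun=> a).
Proof.
apply: isd_ext (isdD (isdZ a isdX) (isdC b)) _ _ => // x; ring.
Qed.

Lemma isd_expRZ a : isd (fun x => expR (a * x)) (fun x => a * expR (a * x)).
Proof.
apply: isd_ext (isd_comp isd_expR (isdZ a isdX)) _ _ => // x; ring.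
Qed.

Lemma isd_le f g (a b : R) : isd f g -> a <= b ->
  (forall x, a <= x <= b -> 0 <= g x) -> f a <= f b.
Proof.
move=> H ab Hg.
have [c /[!in_itv] /= /Hg gc E] := @MVT_segment R f g a b ab (fun x _ => H x)
  (continuous_subspaceT (isd_cont H)).
by rewrite -subr_ge0 E mulr_ge0// subr_ge0.
Qed.

Lemma isd_le2 f g f' g' (a b : R) : isd f f' -> isd g g' -> a <= b ->
  (forall x, a <= x <= b -> f' x <= g' x) -> f b - f a <= g b - g a.
Proof.
move=> H H' ab Hg.
have := @isd_le _ _ a b (isdB H' H) ab; rewrite -subr_ge0.
have Hx : forall x, a <= x <= b -> 0 <= g' x - f' x by move=> x /Hg; lra.
by move=> /(_ Hx); lra.
Qed.

Lemma isd_cst f g (a b : R) : isd f g -> a <= b ->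
  (forall x, a <= x <= b -> g x = 0) -> f a = f b.
Proof.
move=> H ab Hg; apply/eqP; rewrite eq_le; apply/andP; split.
  by apply: isd_le H ab _ => x /Hg ->.
have := isd_le (isdN H) ab; rewrite lerN2; apply => x /Hg ->; lra.
Qed.

(** Smoothness with all derivatives in a class [P]. One calculus then serves bounded coefficients,
    compactly supported tests and exponentially decaying profiles. *)
Definition sm (P : (R -> R) -> Prop) f :=
  smooth1 f /\ forall n, P (derive1n n f).

(** Coinduction: a family inside [P] that is closed under differentiation consists of members of
    [sm P], as every iterated derivative stays in the family. *)
Lemma sm_coind (P F : (R -> R) -> Prop) :
  (forall f, F f -> P f /\ exists g, isd f g /\ F g) -> forall f, F f -> sm P f.
Proof.
move=> HF f Ff.
have Hn : forall n, F (derive1n n f).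
  elim=> [//|n IH]; rewrite derive1nS.
  by have [_ [g [/isdE -> ]]] := HF _ IH.
split => n; last by have [] := HF _ (Hn n).
by move=> x; have [_ [g [H _]]] := HF _ (Hn n); apply: isd_derivable H.
Qed.

Lemma sm_isd P f : sm P f -> isd f (derive1 f).
Proof. by case=> H _; apply: isdP => x; exact: (H 0%N). Qed.

Lemma sm_P P f : sm P f -> P f.
Proof. by case=> _ /(_ 0%N). Qed.

Lemma sm_der P f : sm P f -> sm P (derive1 f).
Proof.
case=> H1 H2; split=> n; first by move=> x; rewrite -derive1Sn; exact: (H1 n.+1).
by rewrite -derive1Sn; exact: (H2 n.+1).
Qed.

Lemma sm_cont P f : sm P f -> continuous f.
Proof. by move/sm_isd/isd_cont. Qed.

Lemma sm_impl (P P' : (R -> R) -> Prop) f :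
  (forall h, continuous h -> P h -> P' h) -> sm P f -> sm P' f.
Proof.
move=> HP; apply: (@sm_coind _ (sm P)) => {}f Hf; split.
  by apply: HP (sm_cont Hf) (sm_P Hf).
by exists (derive1 f); split; [exact: sm_isd Hf|exact: sm_der].
Qed.

Lemma smD (P : (R -> R) -> Prop) f g :
  (forall f g, P f -> P g -> P (fun x => f x + g x)) ->
  sm P f -> sm P g -> sm P (fun x => f x + g x).
Proof.
move=> HP Hf Hg.
apply: (@sm_coind P (fun h => exists u v, sm P u /\ sm P v /\ h = fun x => u x + v x));
  last by exists f, g.
move=> _ [u [v [Hu [Hv ->]]]]; split; first by apply: HP; exact: sm_P.
exists (fun x => derive1 u x + derive1 v x); split.
  by apply: isdD; apply: (@sm_isd P).
exists (derive1 u), (derive1 v); split; first exact: sm_der.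
by split; first exact: sm_der.
Qed.

(** Differentiating a product leaves the family of products but not its sums; closing under sums
    replaces the binomial form of the Leibniz rule. *)
Inductive lincomb (F : (R -> R) -> Prop) : (R -> R) -> Prop :=
| lc_in f : F f -> lincomb F f
| lc_add f g : lincomb F f -> lincomb F g -> lincomb F (fun x => f x + g x).

Lemma sm_lincomb (P F : (R -> R) -> Prop) f :
  (forall f g, P f -> P g -> P (fun x => f x + g x)) ->
  (forall f, F f -> P f /\ exists g, isd f g /\ lincomb F g) ->
  F f -> sm P f.
Proof.
move=> HP HF Ff; apply: (@sm_coind _ (lincomb F)); last exact: lc_in.
move=> {Ff} {}f; elim=> [h /HF //|u v _ [Pu [u' [du Fu]]] _ [Pv [v' [dv Fv]]]].
split; first exact: HP.
by exists (fun x => u' x + v' x); split; [exact: isdD|exact: lc_add].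
Qed.

Lemma smM (P P1 P2 : (R -> R) -> Prop) f g :
  (forall f g, P f -> P g -> P (fun x => f x + g x)) ->
  (forall f g, P1 f -> P2 g -> P (fun x => f x * g x)) ->
  sm P1 f -> sm P2 g -> sm P (fun x => f x * g x).
Proof.
move=> HPD HPM Hf Hg.
apply: (@sm_lincomb _ (fun h => exists u v, sm P1 u /\ sm P2 v /\ h = fun x => u x * v x)) => //;
  last by exists f, g.
move=> _ [u [v [Hu [Hv ->]]]]; split.
  by apply: HPM; [exact: sm_P Hu|exact: sm_P Hv].
exists (fun x => derive1 u x * v x + u x * derive1 v x); split.
  by apply: isdM; [apply: (@sm_isd P1)|apply: (@sm_isd P2)].
have [Du Dv] := (sm_der Hu, sm_der Hv).
by apply: lc_add; apply: lc_in; [exists (derive1 u), v|exists u, (derive1 v)].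
Qed.

Lemma sm_prim P f g : P f -> isd f g -> sm P g -> sm P f.
Proof.
move=> Pf dfg Hg; apply: (@sm_coind _ (fun h => h = f \/ sm P h)); last by left.
move=> h [->|Hh]; first by split=> //; exists g; split=> //; right.
by split; [exact: sm_P|exists (derive1 h); split; [exact: sm_isd Hh|right; exact: sm_der]].
Qed.

Definition bdd f := exists C : R, forall x, `|f x| <= C.
Definition edec a f := exists C : R, forall x, `|f x| <= C * expR (- a * `|x|).
Definition csupp f := exists r : R, forall x, r < `|x| -> f x = 0.
(** With this class, [sm] is plain smoothness. *)
Definition anyf f := True.

Lemma bddD f g : bdd f -> bdd g -> bdd (fun x => f x + g x).
Proof.
move=> [C Hf] [D Hg]; exists (C + D) => x.
by apply: le_trans (ler_normD _ _) _; apply: lerD.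
Qed.

Lemma bddM f g : bdd f -> bdd g -> bdd (fun x => f x * g x).
Proof.
by move=> [C Hf] [D Hg]; exists (C * D) => x; rewrite normrM; apply: ler_pM.
Qed.

Lemma bddC a : bdd (fun=> a).
Proof. by exists `|a|. Qed.

Lemma edecD a f g : edec a f -> edec a g -> edec a (fun x => f x + g x).
Proof.
move=> [C Hf] [D Hg]; exists (C + D) => x.
by apply: le_trans (ler_normD _ _) _; rewrite mulrDl; apply: lerD.
Qed.

Lemma edecM a f g : bdd f -> edec a g -> edec a (fun x => f x * g x).
Proof.
by move=> [C Hf] [D Hg]; exists (C * D) => x; rewrite normrM -mulrA; apply: ler_pM.
Qed.

Lemma edecZ a c f : edec a f -> edec a (fun x => c * f x).
Proof. by apply: edecM; exact: bddC. Qed.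

Lemma edec_bdd a f : 0 <= a -> edec a f -> bdd f.
Proof.
move=> a0 [C H]; exists C => x; apply: le_trans (H x) _.
have C0 : 0 <= C.
  by have := le_trans (normr_ge0 _) (H 0); rewrite pmulr_lge0 ?expR_gt0.
rewrite -[leRHS]mulr1 ler_wpM2l// -expR0 ler_expR.
by rewrite mulNr oppr_le0 mulr_ge0.
Qed.

Lemma csuppD f g : csupp f -> csupp g -> csupp (fun x => f x + g x).
Proof.
move=> [r Hf] [s Hg]; exists (Num.max r s) => x; rewrite gt_max => /andP[/Hf -> /Hg ->].
by rewrite addr0.
Qed.

Lemma anyfD f g : anyf f -> anyf g -> anyf (fun x => f x + g x). Proof. by []. Qed.
Lemma anyfM f g : anyf f -> anyf g -> anyf (fun x => f x * g x). Proof. by []. Qed.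

Lemma continuous_bdd_itv f a b : continuous f ->
  exists C : R, 0 <= C /\ forall x, a <= x <= b -> `|f x| <= C.
Proof.
move=> cf; have [ab|ab] := leP a b; last first.
  by exists 0; split=> // x /andP[h1 h2]; move: (le_trans h1 h2); lra.
have cn : {within `[a, b], continuous (fun x => `|f x|)}.
  apply: continuous_subspaceT => x.
  by apply: (@continuous_comp _ _ _ f (fun y => `|y|)); [exact: cf|exact: norm_continuous].
have [c _ Hc] := EVT_max ab cn.
exists `|f c|; split; first exact: normr_ge0.
by move=> x xab; apply: Hc; rewrite in_itv.
Qed.

Lemma csupp_bdd f : continuous f -> csupp f -> bdd f.
Proof.
move=> cf [r H]; have [C [C0 HC]] := @continuous_bdd_itv f (- r) r cf.
exists C => x; have [xr|xr] := leP `|x| r; first by apply: HC; rewrite -ler_norml.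
by rewrite H// normr0.
Qed.

Lemma csupp_edec a f : 0 <= a -> continuous f -> csupp f -> edec a f.
Proof.
move=> a0 cf sf; have [C HC] := csupp_bdd cf sf; have [r H] := sf.
exists (C * expR (a * `|r|)) => x; rewrite -mulrA -expRD.
have C0 : 0 <= C by apply: le_trans (HC 0).
have [xr|xr] := leP `|x| r; last by rewrite H// normr0 mulr_ge0// expR_ge0.
apply: le_trans (HC x) _; rewrite -[leLHS]mulr1 ler_wpM2l//.
rewrite -expR0 ler_expR mulNr subr_ge0 ler_wpM2l//.
by apply: le_trans xr (ler_norm _).
Qed.

Lemma csupp_der f : csupp f -> csupp (derive1 f).
Proof.
move=> [r H]; exists r => x xr; rewrite derive1E.
have -> : 'D_1 f x = 'D_1 (fun=> 0 : R) x.
  apply: near_eq_derive; near=> y; apply: H; near: y.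
  by apply: (@cvgr_gt _ _ _ _ _ _ (@norm_continuous _ _ x)).
by rewrite derive_cst.
Unshelve. all: by end_near. Qed.

Lemma test_sm f : test_fn f -> sm csupp f.
Proof.
move=> [H1 H2]; split=> //; elim=> [//|n IH]; rewrite derive1nS; exact: csupp_der.
Qed.

Lemma sm_test f : sm csupp f -> test_fn f.
Proof. by case=> H1 /(_ 0%N). Qed.

Lemma sm_affine P f a b : (forall h c d, P h -> P (fun x => c * h (a * x + d))) ->
   sm P f -> sm P (fun x => f (a * x + b)).
Proof.
move=> HP Hf.
apply: (@sm_coind _ (fun h => exists c u, sm P u /\ h = fun x => c * u (a * x + b)));
  last by exists 1, f; split=> //; apply/funext => x; rewrite mul1r.
move=> _ [c [u [Hu ->]]]; split; first exact/HP/(sm_P Hu).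
exists (fun x => c * (derive1 u (a * x + b) * a)); split.
  by apply: isdZ; apply: (isd_comp (sm_isd Hu)); exact: isd_affine.
exists (c * a), (derive1 u); split; first exact: sm_der.
by apply/funext => x; ring.
Qed.

End Calculus.

(** * Integration on the real line *)

Section Integration.
Variable R : realType.
Implicit Types (f g z : R -> R) (x y a c : R).
Notation mu := (@lebesgue_measure R).

Definition intg f := mu.-integrable setT (EFin \o f).
Definition meas f := measurable_fun [set: R] f.

Lemma cont_meas f : continuous f -> meas f.
Proof. exact: continuous_measurable_fun. Qed.

Lemma intg_meas f : intg f -> meas f.
Proof. by move/measurable_int/measurable_EFinP. Qed.

Lemma intg_dom f g : meas f -> intg g -> (forall x, `|f x| <= g x) -> intg f.
Proof.
move=> mf ig H; apply: le_integrable ig => //; first exact/measurable_EFinP.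
by move=> x _; rewrite /= lee_fin (le_trans (H x))// ler_norm.
Qed.

Lemma intgD f g : intg f -> intg g -> intg (fun x => f x + g x).
Proof. by move=> If Ig; exact: (integrableD measurableT If Ig). Qed.

Lemma intgB f g : intg f -> intg g -> intg (fun x => f x - g x).
Proof. by move=> If Ig; exact: (integrableB measurableT If Ig). Qed.

Lemma intgZ c f : intg f -> intg (fun x => c * f x).
Proof. by move=> If; exact: (integrableZl measurableT c If). Qed.

Lemma intg_norm f : intg f -> intg (fun x => `|f x|).
Proof. by move=> If; exact: (integrable_norm If). Qed.

Lemma intgMb (c : R -> R) f : bdd c -> meas c -> intg f -> intg (fun x => c x * f x).
Proof.
move=> [C HC] mc If; apply: intg_dom (intgZ C (intg_norm If)) _.
  exact: measurable_funM mc (intg_meas If).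
by move=> x; rewrite normrM ler_wpM2r.
Qed.

Lemma iRD f g : intg f -> intg g -> iR (fun x => f x + g x) = iR f + iR g.
Proof. by move=> If Ig; exact: (RintegralD measurableT If Ig). Qed.

Lemma iRB f g : intg f -> intg g -> iR (fun x => f x - g x) = iR f - iR g.
Proof. by move=> If Ig; exact: (RintegralB measurableT If Ig). Qed.

Lemma iRZ c f : intg f -> iR (fun x => c * f x) = c * iR f.
Proof. by move=> If; exact: (@RintegralZl _ _ _ mu setT f c measurableT If). Qed.

Lemma iR_le f g : intg f -> intg g -> (forall x, f x <= g x) -> iR f <= iR g.
Proof. by move=> If Ig H; apply: le_Rintegral. Qed.

Lemma iR_ge0 f : (forall x, 0 <= f x) -> 0 <= iR f.
Proof. by move=> H; apply: Rintegral_ge0. Qed.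

Lemma iR_norm f : intg f -> `|iR f| <= iR (fun x => `|f x|).
Proof. by move=> If; apply: le_normr_Rintegral. Qed.

Lemma IntRE f : intg f -> IntR f = (iR f)%:E.
Proof. by move=> If; rewrite /iR fineK//; apply: integrable_fin_num. Qed.

Lemma ae_iR f g : meas f -> meas g -> {ae mu, forall x, f x = g x} -> iR f = iR g.
Proof.
move=> mf mg H; rewrite /iR /IntR; congr fine; apply: ae_eq_integral => //; try exact/measurable_EFinP.
apply: filterS H; first exact: (ae_filter_ringOfSetsType mu).
by move=> x -> _.
Qed.

Lemma L2_intg f : L2R f -> intg (fun x => f x ^+ 2).
Proof.
move=> [mf H]; apply/integrableP; split.
  by apply/measurable_EFinP; exact: measurable_funX.
apply: le_lt_trans H; rewrite le_eqVlt; apply/orP; left; apply/eqP.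
by apply: eq_integral => x _ /=; rewrite ger0_norm// sqr_ge0.
Qed.

Lemma intg_L2 f : meas f -> intg (fun x => f x ^+ 2) -> L2R f.
Proof. by move=> mf If; split=> //; rewrite IntRE// ltry. Qed.

Lemma L2M f g : L2R f -> L2R g -> intg (fun x => f x * g x).
Proof.
move=> Lf Lg; apply: intg_dom (intgD (L2_intg Lf) (L2_intg Lg)) _.
  by case: Lf Lg => mf _ [mg _]; exact: measurable_funM.
move=> x; rewrite ler_norml; apply/andP; split.
  by have := sqr_ge0 (f x + g x); have := sqr_ge0 (f x); have := sqr_ge0 (g x); nra.
by have := sqr_ge0 (f x - g x); have := sqr_ge0 (f x); have := sqr_ge0 (g x); nra.
Qed.

Lemma L2Z c f : L2R f -> L2R (fun x => c * f x).
Proof.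
move=> Lf; have [mf _] := Lf; apply: intg_L2; first exact: measurable_funM.
rewrite (_ : (fun x => _) = (fun x => c ^+ 2 * f x ^+ 2)); last by apply/funext => x; ring.
exact/intgZ/L2_intg.
Qed.

Lemma L2D f g : L2R f -> L2R g -> L2R (fun x => f x + g x).
Proof.
move=> Lf Lg; have [mf _] := Lf; have [mg _] := Lg.
apply: intg_L2; first exact: measurable_funD.
rewrite (_ : (fun x => _) = (fun x => f x ^+ 2 + 2 * (f x * g x) + g x ^+ 2)); last first.
  by apply/funext => x; ring.
apply: intgD; last exact: L2_intg.
by apply: intgD; [exact: L2_intg|apply: intgZ; exact: L2M].
Qed.

Lemma L2Mb (c : R -> R) f : bdd c -> meas c -> L2R f -> L2R (fun x => c x * f x).
Proof.
move=> bc mc Lf; have [mf _] := Lf; apply: intg_L2; first exact: measurable_funM.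
rewrite (_ : (fun x => _) = (fun x => (c x * c x) * f x ^+ 2)); last first.
  by apply/funext => x; ring.
by apply: intgMb; [exact: bddM|exact: measurable_funM|exact: L2_intg].
Qed.

Lemma intg_expR a : 0 < a -> intg (fun x => expR (- a * `|x|)).
Proof.
move=> a0.
have ce : continuous (fun x => expR (- a * `|x|)).
  move=> x; apply: continuous_comp; last exact: continuous_expR.
  by apply: cvgM; [exact: cvg_cst|exact: norm_continuous].
have me := cont_meas ce.
apply/integrableP; split; first exact/measurable_EFinP.
have -> : (\int[mu]_x `|(EFin \o (fun x => expR (- a * `|x|))) x| =
           \int[mu]_x (expR (- a * `|x|))%:E)%E.
  by apply: eq_integral => x _ /=; rewrite ger0_norm// expR_ge0.
rewrite (@ge0_symfun_integralT R _ (fun x => expR_ge0 _) ce); last first.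
  by move=> x; rewrite /= normrN.
have -> : (\int[mu]_(x in [set x : R | (0 <= x)%R]) (expR (- a * `|x|))%:E =
           \int[mu]_(x in `[0%R, +oo[) (expR (- a * x))%:E)%E.
  rewrite set_itvcy; apply: eq_integral => x; rewrite inE /= => x0.
  by rewrite ger0_norm.
have de := isd_expRZ (- a).
have dF : isd (fun x => - a^-1 * expR (- a * x)) (fun x => expR (- a * x)).
  by apply: isd_ext (isdZ (- a^-1) de) _ _ => // x; field; lra.
rewrite (@ge0_continuous_FTC2y _ _ (fun x => - a^-1 * expR (- a * x)) 0 0).
- by rewrite -EFinB -EFinM ltry.
- by move=> x _; exact: expR_ge0.
- by apply: continuous_subspaceT; exact: isd_cont de.
- rewrite -(mulr0 (- a^-1)); apply: cvgM; first exact: cvg_cst.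
  under eq_fun do rewrite mulNr.
  apply: (@cvg_comp _ _ _ (fun x : R => a * x) (fun y : R => expR (- y))
    (pinfty_nbhs R) (pinfty_nbhs R) (nbhs (0:R))).
  + by apply: gt0_cvgMry => //; exact: cvg_id.
  + exact: cvgr_expR.
- by move=> x _; apply: isd_derivable dF.
- by apply: cvg_at_right_filter; exact: (isd_cont dF).
- by move=> x _; rewrite (isdE dF).
Qed.

Lemma edec_intg a f : 0 < a -> meas f -> edec a f -> intg f.
Proof. by move=> a0 mf [C HC]; exact: intg_dom mf (intgZ C (intg_expR a0)) HC. Qed.

Lemma edec_L2 a f : 0 < a -> meas f -> edec a f -> L2R f.
Proof.
move=> a0 mf ef; apply: intg_L2 => //; apply: (edec_intg a0).
  exact: measurable_funX.
rewrite (_ : (fun x => _) = (fun x => f x * f x)); last by apply/funext => x; rewrite expr2.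
by apply: edecM => //; apply: edec_bdd ef; exact: ltW.
Qed.

End Integration.

(** * Linear systems of ordinary differential equations *)

Section LinearODE.
Variable R : realType.
Implicit Types (f g z : R -> R) (x y : R).
Notation mu := (@lebesgue_measure R).

Lemma continuous_integrable_itv z (a b : R) : continuous z ->
  mu.-integrable `[a, b] (EFin \o z).
Proof.
move=> cz; apply: continuous_compact_integrable; first exact: segment_compact.
exact: continuous_subspaceT.
Qed.

(* Oriented primitive: exactly one of the two integrals is over a nontrivial interval. *)
Definition prim z x : R :=
  (\int[mu]_(t in `[0, x]) z t) - (\int[mu]_(t in `[x, 0]) z t).

(** Basing both integrals at one point to the left of 0 and [x] removes the sign cases, so that
    additivity and the fundamental theorem apply. *)
Lemma primE z (a x : R) : (forall u v, mu.-integrable `[u, v] (EFin \o z)) ->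
  a <= 0 -> a <= x ->
  prim z x = (\int[mu]_(t in `[a, x]) z t) - (\int[mu]_(t in `[a, 0]) z t).
Proof.
move=> cI a0 ax; rewrite /prim.
have oI u v : mu.-integrable `]u, v] (EFin \o z).
  by apply: integrableS (cI u v) => //; exact: subset_itv_oc_cc.
have [x0|x0] := leP 0 x.
  rewrite (@Rintegral_itvB _ z (BLeft a) (BRight x) 0) ?bnd_simp//.
  rewrite Rintegral_itv_obnd_cbnd//.
  move: x0; rewrite le_eqVlt => /predU1P[<-|x0]; last first.
    by rewrite (@set_itv_ge _ _ (BLeft x)) ?bnd_simp -?ltNge// Rintegral_set0 subr0.
  by rewrite !set_itv1 !Rintegral_set1 subr0.
rewrite -[RHS]opprB (@Rintegral_itvB _ z (BLeft a) (BRight 0) x) ?bnd_simp//; last exact: ltW.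
rewrite Rintegral_itv_obnd_cbnd//.
by rewrite (@set_itv_ge _ _ (BLeft 0)) ?bnd_simp -?ltNge// Rintegral_set0 sub0r.
Qed.

Lemma prim0 z : prim z 0 = 0.
Proof. by rewrite /prim subrr. Qed.

Lemma prim_itv z (a b : R) : (forall u v, mu.-integrable `[u, v] (EFin \o z)) -> a <= b ->
  prim z b - prim z a = \int[mu]_(t in `[a, b]) z t.
Proof.
move=> cI ab; pose m : R := Num.min a 0 - 1.
have ma : m <= a by rewrite /m lerBlDr; apply: (@le_trans _ _ a); rewrite ?ge_min ?lexx //; lra.
have m0 : m <= 0 by rewrite /m lerBlDr; apply: (@le_trans _ _ (0:R)); rewrite ?ge_min ?lexx ?orbT //; lra.
rewrite (@primE z m b)// ?(le_trans ma)// (@primE z m a)//.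
rewrite [LHS](_ : _ = (\int[mu]_(t in `[m, b]) z t) - (\int[mu]_(t in `[m, a]) z t)); last by ring.
rewrite (@Rintegral_itvB _ z (BLeft m) (BRight b) a) ?bnd_simp//.
rewrite Rintegral_itv_obnd_cbnd//.
by apply: integrableS (cI a b) => //; exact: subset_itv_oc_cc.
Qed.

Lemma isd_prim z : continuous z -> isd (prim z) z.
Proof.
move=> cz x.
pose a : R := Num.min 0 x - 1.
have a0 : a <= 0 by rewrite /a lerBlDr; apply: (@le_trans _ _ (0:R)); rewrite ?ge_min ?lexx //; lra.
have ax : a < x by rewrite /a ltrBlDr; apply: (@le_lt_trans _ _ x); rewrite ?ge_min ?lexx ?orbT //; lra.
pose F := fun y => (\int[mu]_(t in `[a, y]) z t) - (\int[mu]_(t in `[a, 0]) z t).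
apply: (@near_eq_is_derive _ _ _ F).
  near=> y; rewrite (@primE _ a) //; first by move=> u v; exact: continuous_integrable_itv.
  by apply/ltW; near: y; exact: lt_nbhsr.
have xx1 : x < x + 1 by rewrite ltrDl.
have [dF EF] := @continuous_FTC1_closed R z a x (x + 1) xx1
  (continuous_integrable_itv a (x+1) cz) ax (cz x).
have d1 : is_derive x 1 (fun y => \int[mu]_(t in `[a, y]) z t) (z x).
  by apply: DeriveDef; [exact: dF|rewrite -derive1E; exact: EF].
rewrite -[z x]subr0.
exact: (is_deriveB d1 (is_derive_cst (\int[mu]_(t in `[a, 0]) z t) x 1)).
Unshelve. all: by end_near. Qed.

(** In the norm weighted by e^{K|x|}, integration gains a factor 1/K. This makes the Picard map a
    contraction on the whole line at once. *)
Lemma prim_le z (K D : R) : continuous z -> 0 < K ->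
  (forall x, `|z x| <= D * expR (K * `|x|)) ->
  forall x, `|prim z x| <= D / K * expR (K * `|x|).
Proof.
move=> cz K0 Hz x.
have Kn : K != 0 by rewrite gt_eqF.
have D0 : 0 <= D.
  by have := le_trans (normr_ge0 _) (Hz 0); rewrite pmulr_lge0 ?expR_gt0.
have DK0 : 0 <= D / K by rewrite divr_ge0// ltW.
have d1 : isd (fun x => D / K * expR (K * x)) (fun x => D * expR (K * x)).
  by apply: isd_ext (isdZ (D / K) (isd_expRZ K)) _ _ => // y; field.
have d2 : isd (fun x => - (D / K * expR (- K * x))) (fun x => D * expR (- K * x)).
  by apply: isd_ext (isdN (isdZ (D / K) (isd_expRZ (- K)))) _ _ => // y; field.
have dz := isd_prim cz; have dnz := isdN dz.
have P0 := prim0 z.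
have [x0|x0] := leP 0 x.
  have B y : 0 <= y <= x -> `|z y| <= D * expR (K * y).
    by case/andP => y0 _; have := Hz y; rewrite (ger0_norm y0).
  have Bn y : 0 <= y <= x -> `|- z y| <= D * expR (K * y) by rewrite normrN; exact: B.
  have h1 := isd_le2 dz d1 x0 (fun y Hy => le_trans (ler_norm (z y)) (B y Hy)).
  have h2 := isd_le2 dnz d1 x0
    (fun y Hy => le_trans (ler_norm (- z y)) (Bn y Hy)).
  move: h1 h2; rewrite /= P0 mulr0 expR0 mulr1 (ger0_norm x0) ler_norml => h1 h2.
  by apply/andP; split; lra.
have B y : x <= y <= 0 -> `|z y| <= D * expR (- K * y).
  by case/andP => _ y0; have := Hz y; rewrite (ler0_norm y0) mulrN mulNr.
have Bn y : x <= y <= 0 -> `|- z y| <= D * expR (- K * y) by rewrite normrN; exact: B.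
have h1 := isd_le2 dz d2 (ltW x0) (fun y Hy => le_trans (ler_norm (z y)) (B y Hy)).
have h2 := isd_le2 dnz d2 (ltW x0)
  (fun y Hy => le_trans (ler_norm (- z y)) (Bn y Hy)).
move: h1 h2; rewrite /= P0 mulr0 expR0 mulr1 (ltr0_norm x0) ler_norml mulrN -mulNr => h1 h2.
by apply/andP; split; lra.
Qed.

Lemma primB z1 z2 x : continuous z1 -> continuous z2 ->
  prim (fun s => z1 s - z2 s) x = prim z1 x - prim z2 x.
Proof.
move=> c1 c2; rewrite /prim.
have cI u v z := @continuous_integrable_itv z u v.
by rewrite !(RintegralB) //; try exact: cI; ring.
Qed.

(** The intervals of radius [2 * E * 2^-1 ^+ m] around [u m] are nested, and the supremum of their
    left ends lies in all of them. The rate of convergence comes for free. *)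
Lemma geometric_limit (u : nat -> R) (E : R) :
  (forall m, `|u m.+1 - u m| <= E * 2^-1 ^+ m) ->
  exists l, forall m, `|l - u m| <= 2 * E * 2^-1 ^+ m.
Proof.
move=> H.
have h0 m : (0 : R) <= 2^-1 ^+ m by rewrite exprn_ge0// invr_ge0.
have E0 : 0 <= E by have := le_trans (normr_ge0 _) (H 0%N); rewrite expr0 mulr1.
pose lo m := u m - 2 * E * 2^-1 ^+ m; pose hi m := u m + 2 * E * 2^-1 ^+ m.
have loS m : lo m <= lo m.+1.
  have := H m; rewrite /lo ler_norml exprS => /andP[h _].
  by rewrite -subr_ge0; nra.
have hiS m : hi m.+1 <= hi m.
  have := H m; rewrite /hi ler_norml exprS => /andP[_ h].
  by rewrite -subr_ge0; nra.
have lohi m : lo m <= hi m by rewrite /lo /hi; have := mulr_ge0 E0 (h0 m); nra.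
have loM m p : lo m <= lo (m + p)%N.
  by elim: p => [|p IH]; rewrite ?addn0// addnS; apply: le_trans IH _.
have hiM m p : hi (m + p)%N <= hi m.
  by elim: p => [|p IH]; rewrite ?addn0// addnS; apply: le_trans IH.
have lh m p : lo m <= hi p.
  apply: le_trans (loM m p) _; apply: le_trans (lohi _) _.
  by rewrite addnC; exact: hiM.
have ne : range lo !=set0 by exists (lo 0%N); exists 0%N.
have ub p : ubound (range lo) (hi p) by move=> _ [m _ <-].
exists (sup (range lo)) => m.
have h1 : lo m <= sup (range lo).
  by apply: ub_le_sup; [exists (hi 0%N); exact: ub|exists m].
have h2 : sup (range lo) <= hi m by apply: ge_sup => //; exact: ub.
by move: h1 h2; rewrite /lo /hi ler_norml; lra.
Qed.

Lemma expr_half_small (E e : R) : 0 < e -> exists m, E * 2^-1 ^+ m < e.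
Proof.
move=> e0.
have := @cvg_geometric R E 2^-1.
have -> : `|2^-1 : R| < 1 by rewrite ger0_norm ?invr_ge0// invf_lt1 ?ltr1n.
move=> /(_ isT) /cvgr0_norm_lt /(_ _ e0) [m _ /(_ m (leqnn m)) /= Hm].
by exists m; apply: le_lt_trans (ler_norm _) Hm.
Qed.

Section System.
Variables (n : nat) (A : 'I_n -> 'I_n -> R -> R) (b : 'I_n -> R -> R) (c : 'I_n -> R).
Variables (Ca D : R).
Hypothesis cA : forall i j, continuous (A i j).
Hypothesis cb : forall i, continuous (b i).
Hypothesis Ca_ge0 : 0 <= Ca.
Hypothesis AC : forall i j x, `|A i j x| <= Ca.
Hypothesis HD : forall i x, `|c i + prim (b i) x| <= D.

(** Chosen so that the row sum bound [n * Ca] divided by the rate is at most 1/2; the added 1 keeps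
    the rate positive when [Ca] is 0. *)
Definition ode_rate : R := 2 * n%:R * Ca + 1.
Local Notation K := ode_rate.

Let K_gt0 : 0 < K.
Proof. by rewrite /ode_rate ltr_wpDl// !mulr_ge0. Qed.

Let F (y : 'I_n -> R -> R) i x := \sum_j A i j x * y j x.
Let Tm (y : 'I_n -> R -> R) i x := c i + prim (b i) x + prim (F y i) x.

Let cF (y : 'I_n -> R -> R) : (forall i, continuous (y i)) -> forall i, continuous (F y i).
Proof.
move=> cy i x; rewrite /F.
have -> : (fun x0 => \sum_j A i j x0 * y j x0) = \sum_j (fun x0 => A i j x0 * y j x0).
  by apply/funext => s; rewrite fct_sumE.
elim/big_ind: _ => [|f g|j _]; first exact: cvg_cst.
  exact: cvgD.
by apply: cvgM; [exact: cA|exact: cy].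
Qed.

Let cT (y : 'I_n -> R -> R) : (forall i, continuous (y i)) -> forall i, continuous (Tm y i).
Proof.
move=> cy i x.
have h1 := isd_cont (isd_prim (@cb i)).
have h2 := isd_cont (isd_prim (@cF _ cy i)).
by apply: cvgD; [apply: cvgD; [exact: cvg_cst|exact: h1]|exact: h2].
Qed.

Let FB (y z : 'I_n -> R -> R) i x : F y i x - F z i x = F (fun j s => y j s - z j s) i x.
Proof. by rewrite /F -sumrB; apply: eq_bigr => j _; rewrite mulrBr. Qed.

Let FT (y : 'I_n -> R -> R) E : (forall i, continuous (y i)) ->
  (forall i x, `|y i x| <= E * expR (K * `|x|)) ->
  forall i x, `|prim (F y i) x| <= E / 2 * expR (K * `|x|).
Proof.
move=> cy Hy i x.
have E0 : 0 <= E.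
  by have := le_trans (normr_ge0 _) (Hy i 0); rewrite pmulr_lge0 ?expR_gt0.
have nE : 0 <= n%:R * (Ca * E) by rewrite !mulr_ge0.
have h : forall x, `|F y i x| <= (n%:R * (Ca * E)) * expR (K * `|x|).
  move=> s; apply: le_trans (ler_norm_sum _ _ _) _.
  apply: (@le_trans _ _ (\sum_(j < n) Ca * E * expR (K * `|s|))).
    by apply: ler_sum => j _; rewrite normrM -mulrA; apply: ler_pM.
  by rewrite sumr_const card_ord -mulr_natl; lra.
apply: le_trans (prim_le (@cF _ cy i) K_gt0 h x) _.
rewrite ler_wpM2r ?expR_ge0// ler_pdivrMr// /ode_rate.
have : 0 <= n%:R * (Ca * E) by [].
set q := n%:R * _ => q0.
have -> : E / 2 * (2 * n%:R * Ca + 1) = q + E / 2 by rewrite /q; field.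
by lra.
Qed.

Fixpoint picard m : 'I_n -> R -> R :=
  match m with 0 => fun _ _ => 0 | m'.+1 => Tm (picard m') end.

Let cY m i : continuous (picard m i).
Proof. by elim: m i => [i x|m IH i]; [exact: cvg_cst|exact: cT]. Qed.

Let YS m i x : `|picard m.+1 i x - picard m i x| <= (D * expR (K * `|x|)) * 2^-1 ^+ m.
Proof.
elim: m i x => [i x|m IH i x].
  rewrite /= /Tm subr0 expr0 mulr1.
  have cF0 := @cF _ (@cY 0) i.
  have -> : prim (F (picard 0) i) x = 0.
    have -> : F (picard 0) i = fun=> 0.
      by apply/funext => s; rewrite /F big1// => j _; rewrite mulr0.
    by rewrite /prim !Rintegral_cst// !mul0r subrr.
  rewrite addr0; apply: le_trans (HD i x) _.
  have D0 := le_trans (normr_ge0 _) (HD i x).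
  rewrite -[leLHS]mulr1 ler_wpM2l// -expR0 ler_expR.
  by rewrite mulr_ge0// ltW.
have -> : picard m.+2 i x - picard m.+1 i x =
    prim (F (fun j s => picard m.+1 j s - picard m j s) i) x.
  rewrite [LHS]/= /Tm opprD addrACA subrr add0r -primB.
  - by congr prim; apply/funext => s; rewrite FB.
  - exact: (cF (@cY m.+1)).
  - exact: (cF (@cY m)).
apply: (@le_trans _ _ ((D * 2^-1 ^+ m) / 2 * expR (K * `|x|))).
  apply: FT => [j s|j s].
    by apply: cvgB; [exact: (@cY m.+1 j)|exact: (@cY m j)].
  by apply: le_trans (IH j s) _; rewrite mulrAC.
by rewrite exprS le_eqVlt; apply/orP; left; apply/eqP; field.
Qed.

(** Picard iteration with ratio 1/2, whence the factor 2 in the bound. The forcing is measured only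
    through [c i + prim (b i)], so tall bumps of small mass cost no more than flat ones. *)
Lemma linear_ode : exists y : 'I_n -> R -> R,
  [/\ forall i, isd (y i) (fun x => \sum_j A i j x * y j x + b i x),
      forall i, y i 0 = c i &
      forall i x, `|y i x| <= 2 * D * expR (K * `|x|)].
Proof.
have /choice [y Hy] : forall i, exists yi : R -> R, forall x m,
    `|yi x - picard m i x| <= (2 * D * 2^-1 ^+ m) * expR (K * `|x|).
  move=> i.
  have /choice [yi Hyi] : forall x, exists l, forall m, `|l - picard m i x| <= (2 * D * 2^-1 ^+ m) * expR (K * `|x|).
    move=> x; have [l Hl] := @geometric_limit (fun m => picard m i x) _ (fun m => YS m i x).
    by exists l => m; apply: le_trans (Hl m) _; rewrite le_eqVlt; apply/orP; left; apply/eqP; ring.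
  by exists yi.
(* The convergence is uniform on |s| < |x| + 1, hence the limit is continuous. This has to precede
   the integral equation, because the contraction estimate [FT] takes continuous arguments. *)
have cy i : continuous (y i).
  move=> x; apply/cvgrPdist_lt => e e0.
  have [m Hm] := @expr_half_small (2 * D * expR (K * (`|x| + 1))) (e / 3) ltac:(lra).
  have B s : `|s| < `|x| + 1 -> `|y i s - picard m i s| < e / 3.
    move=> sx; apply: le_lt_trans (Hy i s m) _; apply: le_lt_trans Hm.
    have D0 := le_trans (normr_ge0 _) (HD i 0).
    rewrite mulrAC ler_wpM2r// ?exprn_ge0// ler_wpM2l// ?ler_expR ?mulr_ge0//.
    by rewrite ler_wpM2l// ltW.
  have /cvgrPdist_lt /(_ (e / 3) ltac:(lra)) Hc := @cY m i x.
  near=> s.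
  have h1 : `|picard m i x - picard m i s| < e / 3 by near: s; exact: Hc.
  have h2 : `|s| < `|x| + 1.
    near: s; apply: (@cvgr_lt _ _ _ _ _ _ (@norm_continuous _ _ x)).
    by rewrite ltrDl.
  have h3 := B s h2; have h4 : `|y i x - picard m i x| < e / 3 by apply: B; rewrite ltrDl.
  rewrite (_ : y i x - y i s = (y i x - picard m i x) + (picard m i x - picard m i s)
     - (y i s - picard m i s)); last by ring.
  apply: le_lt_trans (ler_normB _ _) _.
  have := ler_normD (y i x - picard m i x) (picard m i x - picard m i s); lra.
have yT i x : y i x = Tm y i x.
  apply/eqP; rewrite -subr_eq0 -normr_eq0 eq_le normr_ge0 andbT.
  apply/ler_addgt0Pr => e e0; rewrite add0r.
  have [m Hm] := @expr_half_small (2 * D * expR (K * `|x|)) (e / 2) ltac:(lra).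
  have D0 := le_trans (normr_ge0 _) (HD i 0).
  have h1 := Hy i x m.+1.
  have h2 : `|Tm (picard m) i x - Tm y i x| <= (2 * D * 2^-1 ^+ m) / 2 * expR (K * `|x|).
    rewrite /Tm opprD addrACA subrr add0r -primB; last 2 first.
    - exact: (cF (@cY m)).
    - exact: (cF cy).
    have -> : (fun s => F (picard m) i s - F y i s) = F (fun j s => picard m j s - y j s) i.
      by apply/funext => s; rewrite FB.
    apply: FT => [j s|j s]; first by apply: cvgB; [exact: cY|exact: cy].
    by rewrite distrC; exact: Hy.
  rewrite (_ : y i x - Tm y i x = (y i x - picard m.+1 i x) + (Tm (picard m) i x - Tm y i x)) ;
    last by rewrite /=; ring.
  apply: le_trans (ler_normD _ _) _; apply: le_trans (lerD h1 h2) _.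
  move: Hm; rewrite exprS.
  set p := 2^-1 ^+ m; set q := expR _ => Hm.
  by rewrite (_ : _ + _ = 2 * D * q * p); [lra|field].
exists y; split => [i|i|i x].
- have -> : y i = Tm y i by apply/funext => x.
  apply: isd_ext (isdD (isdD (isdC (c i)) (isd_prim (@cb i))) (isd_prim (@cF _ cy i))) _ _ => // x.
  rewrite add0r addrC; congr (_ + _).
- by rewrite yT /Tm !prim0 !addr0.
- by have := Hy i x 0%N; rewrite subr0 expr0 mulr1.
Unshelve. all: by end_near. Qed.

End System.
End LinearODE.

(** * Mollifiers and cut-offs *)

Section Mollifier.
Variable R : realType.
Implicit Types (f g z : R -> R) (x y a c : R).
Notation mu := (@lebesgue_measure R).

Lemma dct (u : nat -> R -> R) f g : (forall n, meas (u n)) -> meas f -> intg g ->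
  (forall n x, `|u n x| <= g x) -> {ae mu, forall x, u n x @[n --> \oo] --> f x} ->
  iR (u n) @[n --> \oo] --> iR f.
Proof.
move=> mu_ mf ig ug uf.
have [If _ H] := @dominated_convergence _ _ _ mu setT measurableT
  (fun n => EFin \o u n) (EFin \o f) (EFin \o g)
  (fun n => (measurable_EFinP _ _).2 (mu_ n)) ((measurable_EFinP _ _).2 mf)
  ltac:(by apply: filterS uf; [exact: (ae_filter_ringOfSetsType mu)|
        move=> x Hx _; apply: cvg_EFin => //; exact: nearW]) ig
  ltac:(by apply: aeW => x n _; rewrite /= lee_fin).
have Iu n : intg (u n) by apply: intg_dom ig (ug n).
have := fine_cvg (_ : _ --> (iR f)%:E).
apply.
by rewrite -IntRE.
Qed.

Lemma iR_itv z (a b : R) : (forall x, ~ (a <= x <= b) -> z x = 0) ->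
  iR z = \int[mu]_(x in `[a, b]) z x.
Proof.
move=> Hz; rewrite Rintegral_mkcond /iR /IntR /Rintegral; congr fine.
apply: eq_integral => x _; rewrite patchE; case: ifPn => //.
rewrite notin_setE /= in_itv /= => /negP h; rewrite Hz//; exact/negP.
Qed.

Lemma iR_prim z (a b : R) : continuous z -> a <= b ->
  (forall x, ~ (a <= x <= b) -> z x = 0) -> iR z = prim z b - prim z a.
Proof.
move=> cz ab Hz; rewrite (iR_itv Hz) prim_itv// => u v.
exact: continuous_integrable_itv.
Qed.

(** A test function is already at hand, namely rho'. Squaring makes it nonnegative, and the factor
    [A], larger than [|rad| + |x0|], shrinks its support into the unit ball. *)
Lemma bump_exists r x0 : test_fn r -> 0 < r x0 ->
  exists beta : R -> R, [/\ sm (@csupp R) beta, forall x, 0 <= beta x, 0 < beta 0 &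
    forall x, 1 <= `|x| -> beta x = 0].
Proof.
move=> tr r0; have [_ [rad Hr]] := tr; have Sr := test_sm tr.
pose A : R := `|rad| + `|x0| + 1.
have A0 : 0 < A by rewrite /A; have := normr_ge0 rad; have := normr_ge0 x0; lra.
exists (fun x => r (A * x + x0) * r (A * x + x0)); split.
- have Sa : sm (@anyf R) (fun x => r (A * x + x0)).
    by apply: sm_affine => //; exact: sm_impl Sr.
  have Sm := @smM R _ _ _ _ _ (@anyfD R) (@anyfM R) Sa Sa.
  split; first by case: Sm.
  suff h : csupp (fun x => r (A * x + x0) * r (A * x + x0)).
    by case: Sm => h1 _; elim=> [//|n IH]; rewrite derive1nS; exact: csupp_der.
  exists 1 => x x1; rewrite Hr ?mul0r//.
  have h : `|A * x| - `|x0| <= `|A * x + x0|.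
    by rewrite lerBlDr; apply: le_trans (ler_normB _ x0); rewrite addrK.
  rewrite normrM (gtr0_norm A0) in h; apply: lt_le_trans h.
  have : A <= A * `|x| by rewrite ler_peMr// ltW.
  rewrite /A; have := ler_norm rad; lra.
- by move=> x; rewrite -expr2 sqr_ge0.
- by rewrite mulr0 add0r mulr_gt0.
- move=> x x1; rewrite Hr ?mul0r//.
  have h : `|A * x| - `|x0| <= `|A * x + x0|.
    by rewrite lerBlDr; apply: le_trans (ler_normB _ x0); rewrite addrK.
  rewrite normrM (gtr0_norm A0) in h; apply: lt_le_trans h.
  have : A <= A * `|x| by rewrite ler_peMr// ltW.
  by rewrite /A; have := ler_norm rad; lra.
Qed.

Lemma csupp_intg z : continuous z -> csupp z -> intg z.
Proof.
by move=> cz sz; apply: (@edec_intg _ 1) => //; [exact: cont_meas|exact: csupp_edec].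
Qed.

Lemma csupp_L2 z : continuous z -> csupp z -> L2R z.
Proof.
by move=> cz sz; apply: (@edec_L2 _ 1) => //; [exact: cont_meas|exact: csupp_edec].
Qed.

(** On a compact set [K], [f] is multiplied by the indicator of [K], which is square integrable
    because [K] has finite measure. *)
Lemma L2_locally_integrable f : L2R f -> locally_integrable [set: R] f.
Proof.
move=> Lf; have [mf _] := Lf; split; [exact: mf|exact: openT|move=> K _ cK].
have mK : measurable K by exact: compact_measurable.
have fK : (mu K < +oo)%E by exact: compact_finite_measure.
have mI : meas (\1_K : R -> R) by exact: measurable_indic.
have LI : L2R (\1_K : R -> R).
  apply: intg_L2 => //; rewrite (_ : (fun x => _) = \1_K); last first.
    by apply/funext => x; rewrite indicE; case: (_ \in _); rewrite ?expr1n ?expr0n.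
  apply/integrableP; split; first exact/measurable_EFinP.
  apply: le_lt_trans fK.
  have -> : mu K = (\int[mu]_x (\1_K x)%:E)%E by rewrite integral_indic// setIT.
  rewrite le_eqVlt; apply/orP; left; apply/eqP; apply: eq_integral => x _ /=.
  by rewrite ger0_norm.
have /integrableP [_] := L2M Lf LI; apply: le_lt_trans.
rewrite integral_mkcond; apply: ge0_le_integral => //.
- by move=> x _; rewrite patchE; case: ifP => _ //; rewrite lee_fin.
- apply: (measurable_restrictT _ mK).1; apply: measurable_funTS.
  by apply/measurable_EFinP; exact: measurableT_comp.
- by apply: measurableT_comp => //; apply/measurable_EFinP; exact: measurable_funM.
- move=> x _; rewrite patchE /= indicE; case: ifP => _; last by rewrite lee_fin.
  by rewrite mulr1.
Qed.

(** An approximate identity with centre [a] and width [e]. The height bound [C / e] is what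
    convergence at Lebesgue points requires. *)
Definition mollifier (eta : R -> R -> R -> R) (C : R) := forall a e, 0 < e ->
  [/\ sm (@csupp R) (eta a e), forall x, 0 <= eta a e x <= C / e, iR (eta a e) = 1 &
      forall x, e <= `|x - a| -> eta a e x = 0].

Lemma mollifier_exists r x0 : test_fn r -> 0 < r x0 -> exists eta C, mollifier eta C.
Proof.
move=> tr /(bump_exists tr) [beta [Sb b_ge0 b0 sb]].
have cb := sm_cont Sb.
have [B HB] := csupp_bdd cb (sm_P Sb).
have [d [d0 Hd]] : exists d : R, 0 < d /\ forall x, `|x| <= d -> beta 0 / 2 <= beta x.
  have /cvgrPdist_lt /(_ (beta 0 / 2) ltac:(lra)) := cb 0.
  move=> /nbhs_ballP [d /= d0 Hd]; exists (d / 2); split; first lra.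
  move=> x xd; have := Hd x; rewrite /ball /= sub0r normrN => /(_ ltac:(lra)).
  by move/ltr_normlW; lra.
pose be a e x := beta (e^-1 * x + - (e^-1 * a)).
have beE a e x : be a e x = beta ((x - a) / e) by rewrite /be; congr beta; ring.
have bes a e x : 0 < e -> e <= `|x - a| -> be a e x = 0.
  move=> e0 h; rewrite beE sb// normrM normfV (gtr0_norm e0) ler_pdivlMr// mul1r //.
have Sbe a e : 0 < e -> sm (@csupp R) (be a e).
  move=> e0.
  have Sa : sm (@anyf R) (be a e) by apply: sm_affine => //; exact: sm_impl Sb.
  suff h : csupp (be a e).
    by case: Sa => h1 _; split=> //; elim=> [//|n IH]; rewrite derive1nS; exact: csupp_der.
  exists (`|a| + e) => x hx; apply: bes => //.
  by have := lerB_dist x a; lra.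
have Ibe a e : 0 < e -> intg (be a e).
  by move=> e0; apply: csupp_intg; [exact: sm_cont (Sbe a e e0)|exact: sm_P (Sbe a e e0)].
(* [beta] is at least [beta 0 / 2] on [-d, d], so the rescaled bump has mass at least [beta 0 / 2]
   times the length 2de. Dividing the height [B] by this mass gives the constant of the
   mollifier. *)
have Zge a e : 0 < e -> beta 0 * d * e <= iR (be a e).
  move=> e0; have de0 : 0 < d * e by rewrite mulr_gt0.
  have -> : beta 0 * d * e = iR (fun x => beta 0 / 2 * \1_(`[a - d * e, a + d * e]%classic) x).
    rewrite iRZ; last exact: integrable_indic_itv.
    rewrite /iR /IntR integral_indic// setIT.
    rewrite [X in fine X](lebesgue_measure_itv `[a - d * e, a + d * e]) /=.
    by rewrite lte_fin ifT -?EFinB /=; [field|lra].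
  apply: iR_le; first by apply: intgZ; exact: integrable_indic_itv.
    exact: Ibe.
  move=> x; rewrite indicE beE.
  have [|h] := boolP (x \in _); last by rewrite mulr0 b_ge0.
  rewrite mulr1 inE /= in_itv /= => /andP[h1 h2]; apply: Hd.
  by rewrite normrM normfV (gtr0_norm e0) ler_pdivrMr// ler_norml; lra.
have Z0 a e : 0 < e -> 0 < iR (be a e).
  by move=> e0; apply: lt_le_trans (Zge a e e0); rewrite !mulr_gt0.
have B0 : 0 <= B by apply: le_trans (HB 0).
exists (fun a e x => (iR (be a e))^-1 * be a e x), (B / (beta 0 * d)) => a e e0.
have Zp := Z0 a e e0.
split.
- have [S1 S2] := Sbe a e e0.
  have Sa : sm (@anyf R) (fun x => (iR (be a e))^-1 * be a e x).
    apply: (@sm_coind _ _ (fun h => exists c u, sm (@csupp R) u /\ h = fun x => c * u x)).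
      move=> _ [c [u [Su ->]]]; split=> //; exists (fun x => c * derive1 u x); split.
        by apply: isdZ; exact: sm_isd Su.
      by exists c, (derive1 u); split; first exact: sm_der.
    by exists (iR (be a e))^-1, (be a e); split.
  suff h : csupp (fun x => (iR (be a e))^-1 * be a e x).
    by case: Sa => h1 _; split=> //; elim=> [//|n IH]; rewrite derive1nS; exact: csupp_der.
  by have [r' Hr'] := sm_P (Sbe a e e0); exists r' => x /Hr' ->; rewrite mulr0.
- move=> x; rewrite mulr_ge0 ?invr_ge0 ?(ltW Zp) ?b_ge0//=.
  rewrite mulrC ler_pdivrMr//.
  apply: (@le_trans _ _ B); first by apply: le_trans (HB _); exact: ler_norm.
  have -> : B / (beta 0 * d) / e * iR (be a e) = B * (iR (be a e) / (beta 0 * d * e)).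
    by field; rewrite !gt_eqF.
  by rewrite ler_peMr// ler_pdivlMr ?mulr_gt0// mul1r; exact: Zge.
- by rewrite iRZ ?mulVf ?gt_eqF//; exact: Ibe.
- by move=> x h; rewrite bes// mulr0.
Qed.

Variables (eta : R -> R -> R -> R) (Ce : R).
Hypothesis Heta : mollifier eta Ce.

Lemma moll_cont a e : 0 < e -> continuous (eta a e).
Proof. by move=> /(Heta a) [/sm_cont]. Qed.

Lemma moll_L2 a e : 0 < e -> L2R (eta a e).
Proof.
move=> e0; apply: csupp_L2; first exact: moll_cont.
by have [/sm_P] := Heta a e0.
Qed.

Lemma moll_intg a e : 0 < e -> intg (eta a e).
Proof.
move=> e0; apply: csupp_intg; first exact: moll_cont.
by have [/sm_P] := Heta a e0.
Qed.

Lemma moll_lebesgue f a : L2R f -> lebesgue_pt f a ->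
  forall d : R, 0 < d -> exists e0 : R, 0 < e0 /\ forall e : R, 0 < e < e0 ->
    `|iR (fun x => f x * eta a e x) - f a| < d.
Proof.
move=> Lf Hl d d0.
have C0 : 0 <= Ce.
  have [_ /(_ 0) /andP[h1 h2] _ _] := Heta 0 (@ltr01 R).
  by move: (le_trans h1 h2); rewrite divr1.
have d10 : (0 < (d / (2 * Ce + 1))%:E)%E by rewrite lte_fin divr_gt0//; lra.

move: Hl; rewrite /lebesgue_pt => /fine_cvgP [Hf /cvgrPdist_lt Hc].
have {Hf Hc} := filterI Hf (Hc (d / (2 * Ce + 1)) ltac:(by rewrite divr_gt0//; lra)).
move=> /nbhs_ballP [e0 /= e00 He].
exists e0; split=> // e /andP[egt0 ee0].
have [fd] := He e ltac:(by rewrite /ball /= sub0r normrN gtr0_norm) egt0.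
rewrite sub0r normrN ger0_norm ?fine_ge0 ?davg_ge0// => dd.
have [mf _] := Lf.
have [Seta eta_le eta1 seta] := Heta a egt0.
have If : intg (fun x => f x * eta a e x) by apply: L2M => //; exact: moll_L2.
have Ic : intg (fun x => f a * eta a e x) by apply: intgZ; exact: moll_intg.
have -> : iR (fun x => f x * eta a e x) - f a = iR (fun x => (f x - f a) * eta a e x).
  rewrite -[f a in LHS]mulr1 -eta1 -iRZ; last exact: moll_intg.
  by rewrite -iRB//; congr iR; apply/funext => x; rewrite mulrBl.
have Id : intg (fun x => (f x - f a) * eta a e x).
  by rewrite (_ : (fun x => _) = (fun x => f x * eta a e x - f a * eta a e x));
    [exact: intgB|apply/funext => x; rewrite mulrBl].
apply: le_lt_trans (iR_norm Id) _.
have mg : measurable_fun [set: R] (fun x => `|f x - f a|).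
  by apply: measurableT_comp => //; exact: measurable_funB.
(* The height [Ce / e] against the measure 2e of the ball leaves [2 * Ce] times the mean
   oscillation. The earlier choice [d / (2 * Ce + 1)] is made for this factor and is safe also when
   [Ce] is 0. *)
have key : (IntR (fun x => `|(f x - f a) * eta a e x|%R) <= (2 * Ce)%:E * davg f a e)%E.
  rewrite /davg /iavg (lebesgue_measure_ball _ (ltW egt0)) inver mulrn_eq0 /= gt_eqF//.
  rewrite muleA -EFinM.
  have mc : measurable_fun (ball a e) (fun x => `|((center (f a) \o f) x)%:E|%E).
    apply: measurable_funTS; apply: measurableT_comp => //.
    by apply/measurable_EFinP; exact: measurable_funB.
  rewrite -ge0_integralZl//; last 2 first.
    exact: measurable_ball.
    by rewrite lee_fin mulr_ge0 ?mulr_ge0// invr_ge0 mulrn_wge0// (ltW egt0).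
  rewrite [leRHS]integral_mkcond; apply: ge0_le_integral => //.
  - by apply/measurable_EFinP/measurableT_comp => //; exact: intg_meas.
  - apply/(measurable_restrictT _ _).1 => //; first exact: measurable_ball.
    exact: measurable_funeM.
  - move=> x _; rewrite patchE; case: ifPn => xb.
      rewrite -EFinM lee_fin normrM.
      have [h1 h2] := andP (eta_le x).
      rewrite (ger0_norm h1) mulrC; apply: ler_wpM2r => //.
      apply: le_trans h2 _; rewrite le_eqVlt; apply/orP; left; apply/eqP.
      by rewrite -mulr_natl; field; rewrite gt_eqF.
    rewrite seta ?mulr0 ?normr0// leNgt; apply: contra xb => xa.
    by rewrite inE /ball /= distrC.
have := lt_le_trans _ (lexx d); apply.
have : iR (fun x => `|(f x - f a) * eta a e x|) <= 2 * Ce * fine (davg f a e).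
  rewrite -lee_fin -IntRE; last exact: intg_norm.
  by apply: le_trans key _; rewrite (EFinM (2 * Ce)) fineK.
move=> /le_lt_trans; apply.
have : 2 * Ce * fine (davg f a e) <= 2 * Ce * (d / (2 * Ce + 1)).
  by apply: ler_wpM2l; [lra|exact: ltW].
move=> /le_lt_trans; apply.
by rewrite mulrA ltr_pdivrMr; [nra|lra].
Qed.

(** A smoothed Heaviside function with its jump at [a]. *)
Definition step a e x : R := prim (eta a e) x - prim (eta a e) (a - e).

Lemma isd_step a e : 0 < e -> isd (step a e) (eta a e).
Proof.
move=> e0; have ce : continuous (eta a e) by exact: moll_cont.
apply: isd_ext (isdB (isd_prim ce) (isdC (prim (eta a e) (a - e)))) _ _ => // x.
by rewrite subr0.
Qed.

Lemma step_lt a e x : 0 < e -> x <= a - e -> step a e x = 0.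
Proof.
move=> e0 xa; have [_ _ _ s] := Heta a e0.
have := @isd_cst _ _ _ _ _ (isd_step a e0) xa.
rewrite {2}/step subrr; apply => y /andP[h1 h2]; apply: s.
by rewrite ler0_norm; lra.
Qed.

Lemma step_gt a e x : 0 < e -> a + e <= x -> step a e x = 1.
Proof.
move=> e0 xa; have [_ _ i1 s] := Heta a e0.
have h : step a e (a + e) = 1.
  rewrite /step -i1 (@iR_prim _ (a - e) (a + e))//; [exact: moll_cont|lra|].
  by move=> y h; apply: s; rewrite leNgt; apply/negP => h2; apply: h; move: h2; rewrite ltr_norml; lra.
rewrite -h; apply/esym; apply: (isd_cst (isd_step a e0)) => // y /andP[h1 h2]; apply: s.
by rewrite ger0_norm; lra.
Qed.

Lemma step_itv a e x : 0 < e -> 0 <= step a e x <= 1.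
Proof.
move=> e0; have [_ ge _ s] := Heta a e0.
have H u v : u <= v -> step a e u <= step a e v.
  by move=> uv; apply: (isd_le (isd_step a e0) uv) => y _; case/andP: (ge y).
apply/andP; split.
  have [h|h] := leP x (a - e); first by rewrite step_lt.
  by rewrite -(@step_lt a e (a - e)) ?H// ltW.
have [h|h] := leP (a + e) x; first by rewrite step_gt.
by rewrite -(@step_gt a e (a + e)) ?H// ltW.
Qed.

(* Equal to 1 on [a+e, b-e], supported in [a-e, b+e]. *)
Definition plateau a b e x : R := step a e x - step b e x.

Lemma isd_plateau a b e : 0 < e -> isd (plateau a b e) (fun x => eta a e x - eta b e x).
Proof. by move=> e0; apply: isdB; exact: isd_step. Qed.

Lemma plateau_test a b e : 0 < e -> a <= b -> sm (@csupp R) (plateau a b e).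
Proof.
move=> e0 ab.
have [Sa _ _ _] := Heta a e0; have [Sb _ _ _] := Heta b e0.
have Sd : sm (@csupp R) (fun x => eta a e x - eta b e x).
  have SN : sm (@csupp R) (fun x => - eta b e x).
    apply: (@sm_coind _ _ (fun h => exists u, sm (@csupp R) u /\ h = fun x => - u x)); last by exists (eta b e).
    move=> _ [u [Su ->]]; split.
      by have [r Hr] := sm_P Su; exists r => x /Hr ->; rewrite oppr0.
    exists (fun x => - derive1 u x); split; first by apply: isdN; exact: sm_isd Su.
    by exists (derive1 u); split=> //; exact: sm_der.
  by apply: smD => //; exact: csuppD.
apply: sm_prim (isd_plateau a b e0) Sd.
exists (`|a| + `|b| + e) => x.
have := ler_norm a; have := ler_norm b; have := ler_norm (- a); have := ler_norm (- b); rewrite !normrN => h1 h2 h3 h4.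
rewrite lter_normr /plateau => /orP[h|h].
  by rewrite !step_gt// ?subrr//; have := normr_ge0 a; have := normr_ge0 b; lra.
by rewrite !step_lt// ?subrr//; have := normr_ge0 a; have := normr_ge0 b; lra.
Qed.

Lemma plateau1 a b e x : 0 < e -> a + e <= x <= b - e -> plateau a b e x = 1.
Proof. by move=> e0 /andP[h1 h2]; rewrite /plateau step_gt// step_lt// subr0. Qed.

Lemma plateau0 a b e x : 0 < e -> a <= b -> (x <= a - e) || (b + e <= x) -> plateau a b e x = 0.
Proof.
move=> e0 ab /orP[h|h]; rewrite /plateau.
  by rewrite !step_lt ?subrr//; lra.
by rewrite !step_gt ?subrr//; lra.
Qed.

Lemma plateau_norm a b e x : 0 < e -> `|plateau a b e x| <= 1.
Proof.
move=> e0; have /andP[? ?] := step_itv a x e0; have /andP[? ?] := step_itv b x e0.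
by rewrite /plateau ler_norml; lra.
Qed.

End Mollifier.

(** * Weak derivatives *)

Section WeakDerivative.
Variable R : realType.
Implicit Types (f g z w : R -> R) (x y a c : R).
Notation mu := (@lebesgue_measure R).

Lemma test_L2 (chi : R -> R) : test_fn chi -> L2R chi.
Proof. by move/test_sm => S; apply: csupp_L2; [exact: sm_cont S|exact: sm_P S]. Qed.

Lemma test_der (chi : R -> R) : test_fn chi -> test_fn (derive1 chi).
Proof. by move/test_sm/sm_der/sm_test. Qed.

(** For square integrable data both sides are finite, so the identity of extended reals is one of
    reals. *)
Lemma weak_derivP f f1 : L2R f -> L2R f1 ->
  (weak_deriv f f1 <-> forall chi, test_fn chi ->
     iR (fun x => f x * derive1 chi x) = - iR (fun x => f1 x * chi x)).
Proof.
move=> Lf Lf1; split=> H chi tc; have := H chi tc.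
  rewrite !IntRE ?L2M//; try by [exact: test_L2|exact/test_L2/test_der].
  by rewrite -EFinN => -[].
rewrite !IntRE; first by move=> ->.
- by apply: L2M => //; exact: test_L2.
- by apply: L2M => //; exact/test_L2/test_der.
Qed.

Lemma weak_deriv_lin t f f1 g g1 : L2R f -> L2R f1 -> L2R g -> L2R g1 ->
  weak_deriv f f1 -> weak_deriv g g1 ->
  weak_deriv (fun x => f x + t * g x) (fun x => f1 x + t * g1 x).
Proof.
move=> Lf Lf1 Lg Lg1 /weak_derivP wf /weak_derivP wg.
apply/weak_derivP => [||chi tc]; [by apply: L2D => //; exact: L2Z..|].
have [L L'] := (test_L2 tc, test_L2 (test_der tc)).
have E (u v w : R -> R) : L2R u -> L2R v -> L2R w ->
    iR (fun x => (u x + t * v x) * w x) = iR (fun x => u x * w x) + t * iR (fun x => v x * w x).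
  move=> Lu Lv Lw; rewrite -iRZ; last exact: L2M.
  rewrite -iRD; [|exact: L2M|by apply: intgZ; exact: L2M].
  by congr iR; apply/funext => x; ring.
by rewrite !E// wf// wg//; ring.
Qed.

Lemma H2_lin t f f1 f2 g g1 g2 : H2 f f1 f2 -> H2 g g1 g2 ->
  H2 (fun x => f x + t * g x) (fun x => f1 x + t * g1 x) (fun x => f2 x + t * g2 x).
Proof.
move=> [Lf [Lf1 [Lf2 [wf wf1]]]] [Lg [Lg1 [Lg2 [wg wg1]]]].
by do 3 (split; first by apply: L2D => //; exact: L2Z); split; exact: weak_deriv_lin.
Qed.

Lemma classical_weak w (w1 : R -> R) : isd w w1 -> continuous w1 -> weak_deriv w w1.
Proof.
move=> dw cw1 chi tc.
have Sc := test_sm tc; have dc := sm_isd Sc; have cc := isd_cont dc.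
have dcc := sm_cont (sm_der Sc); have cw := isd_cont dw.
have d := isdM dw dc.
have I1 : intg (fun x => w1 x * chi x).
  apply: csupp_intg; first by move=> x; apply: cvgM; [exact: cw1|exact: cc].
  by have [r Hr] := sm_P Sc; exists r => x /Hr ->; rewrite mulr0.
have I2 : intg (fun x => w x * derive1 chi x).
  apply: csupp_intg; first by move=> x; apply: cvgM; [exact: cw|exact: dcc].
  by have [r Hr] := sm_P (sm_der Sc); exists r => x /Hr ->; rewrite mulr0.
rewrite !IntRE// -EFinN; congr EFin.
apply/eqP; rewrite -addr_eq0 addrC -iRD//; apply/eqP.
set z := fun x => _ + _.
have cz : continuous z.
  move=> x; apply: cvgD; apply: cvgM; [exact: cw1|exact: cc|exact: cw|exact: dcc].
have [r Hr] := sm_P Sc; have [r' Hr'] := sm_P (sm_der Sc).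
pose B : R := `|r| + `|r'| + 1.
have rB : r < B by rewrite /B; have := ler_norm r; have := normr_ge0 r'; lra.
have rB' : r' < B by rewrite /B; have := ler_norm r'; have := normr_ge0 r; lra.
have B0 : 0 < B by rewrite /B; have := normr_ge0 r'; have := normr_ge0 r; lra.
rewrite (@iR_prim _ z (- B) B)//; [|lra|]; last first.
  move=> x h; have xB : B < `|x|.
    by rewrite ltNge; apply/negP => h'; apply: h; rewrite -ler_norml.
  by rewrite /z Hr ?Hr' ?mulr0 ?addr0//; lra.
have dB := isdB d (isd_prim cz).
have BB : - B <= B by lra.
have dz0 x : - B <= x <= B -> w1 x * chi x + w x * derive1 chi x - z x = 0.
  by move=> _; rewrite /z; lra.
have := isd_cst dB BB dz0; rewrite /= !Hr ?normrN ?(gtr0_norm B0)//.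
by rewrite !mulr0; lra.
Qed.

Lemma smooth_H2 a w : 0 < a -> sm (edec a) w -> H2 w (derive1 w) (derive1 (derive1 w)).
Proof.
move=> a0 S0; have S1 := sm_der S0; have S2 := sm_der S1.
have L u : sm (edec a) u -> L2R u.
  by move=> Su; apply: (edec_L2 a0); [exact: cont_meas (sm_cont Su)|exact: sm_P Su].
do 3 (split; first exact: L).
by split; apply: classical_weak; [exact: sm_isd S0|exact: sm_cont S1|exact: sm_isd S1|exact: sm_cont S2].
Qed.

Variables (eta : R -> R -> R -> R) (Ce : R).
Hypothesis Heta : mollifier eta Ce.

Lemma moll_norm a e x : 0 < e -> `|eta a e x| <= Ce / e.
Proof. by move=> e0; have [_ /(_ x) /andP[h1 h2] _ _] := Heta a e0; rewrite ger0_norm. Qed.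

(** Test functions have compact support while solutions of the ODE only decay. [G] is cut off by
    plateaus on growing intervals. Their derivatives are bounded by [2 * Ce] and vanish eventually
    at each point, so dominated convergence removes the cut-off. *)
Lemma weak_ibp a f f1 G : 0 < a -> L2R f -> L2R f1 -> weak_deriv f f1 ->
  sm (edec a) G -> iR (fun x => f1 x * G x) = - iR (fun x => f x * derive1 G x).
Proof.
move=> a0 Lf Lf1 /weak_derivP wf SG.
have [mf _] := Lf; have [mf1 _] := Lf1.
have L u : sm (edec a) u -> L2R u.
  by move=> Su; apply: (edec_L2 a0); [exact: cont_meas (sm_cont Su)|exact: sm_P Su].
have LG := L _ SG; have LG' := L _ (sm_der SG).
have [mG _] := LG; have [mG' _] := LG'.
pose N (n : nat) : R := n%:R + 1.
pose chi (n : nat) := plateau eta (- N n) (N n) 1.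
pose chi' (n : nat) x : R := eta (- N n) 1 x - eta (N n) 1 x.
have N0 n : 0 <= N n by rewrite addr_ge0.
have Nn n : - N n <= N n by have := N0 n; lra.
have Sc n : sm (@csupp R) (chi n) by exact: (plateau_test Heta ltr01 (Nn n)).
have dc n : isd (chi n) (chi' n) by exact: (isd_plateau Heta _ _ ltr01).
have mc n : meas (chi n) by exact: cont_meas (sm_cont (Sc n)).
have cc' n : continuous (chi' n) by rewrite -(isdE (dc n)); exact: sm_cont (sm_der (Sc n)).
have mc' n : meas (chi' n) by exact: cont_meas (cc' n).
have c1 n x : `|chi n x| <= 1 by exact: (plateau_norm Heta).
have c1' n x : `|chi' n x| <= 2 * Ce.
  apply: le_trans (ler_normB _ _) _.
  by have := moll_norm (- N n) x ltr01; have := moll_norm (N n) x ltr01; rewrite divr1; lra.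
have lim_chi x : chi n x @[n --> \oo] --> (1 : R).
  apply: cvg_near_cst; near=> n; apply: (plateau1 Heta) => //.
  have h : `|x| <= n%:R by near: n; exact: nbhs_infty_ger.
  by move: h; rewrite ler_norml /N; lra.
have lim_chi' x : chi' n x @[n --> \oo] --> (0 : R).
  apply: cvg_near_cst; near=> n.
  have h : `|x| <= n%:R by near: n; exact: nbhs_infty_ger.
  have [_ _ _ s1] := Heta (- N n) ltr01; have [_ _ _ s2] := Heta (N n) ltr01.
  rewrite /chi' s1 ?s2 ?subrr//; move: h; rewrite ler_norml /N => h.
    by rewrite ler0_norm; lra.
  by rewrite ger0_norm; lra.
have C0 : 0 <= 2 * Ce := le_trans (normr_ge0 _) (c1' 0%N 0).
have E n : iR (fun x => f1 x * (G x * chi n x)) =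
    - iR (fun x => f x * (derive1 G x * chi n x + G x * chi' n x)).
  have t : test_fn (fun x => G x * chi n x).
    apply: sm_test.
    apply: (@smM _ (@csupp R) (edec a) (@csupp R)) => //; first exact: csuppD.
    by move=> u v _ [r Hr]; exists r => x /Hr ->; rewrite mulr0.
  by apply/eqP; rewrite -eqr_oppLR -wf// (isdE (isdM (sm_isd SG) (dc n))).
have lim1 : iR (fun x => f1 x * (G x * chi n x)) @[n --> \oo] --> iR (fun x => f1 x * G x).
  apply: (@dct _ (fun n x => f1 x * (G x * chi n x)) _ (fun x => `|f1 x * G x|)).
  - by move=> n; exact: (measurable_funM mf1 (measurable_funM mG (mc n))).
  - exact: measurable_funM.
  - by apply: intg_norm; exact: L2M.
  - by move=> n x; rewrite mulrA normrM -[leRHS]mulr1 ler_wpM2l.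
  - apply: aeW => x; rewrite -[X in _ --> X]mulr1.
    under eq_fun do rewrite mulrA.
    by apply: cvgM; [exact: cvg_cst|exact: lim_chi].
have lim2 : iR (fun x => f x * (derive1 G x * chi n x + G x * chi' n x)) @[n --> \oo] -->
    iR (fun x => f x * derive1 G x).
  apply: (@dct _ (fun n x => f x * (derive1 G x * chi n x + G x * chi' n x)) _
    (fun x => `|f x * derive1 G x| + 2 * Ce * `|f x * G x|)).
  - move=> n; apply: (measurable_funM mf).
    exact: (measurable_funD (measurable_funM mG' (mc n)) (measurable_funM mG (mc' n))).
  - exact: measurable_funM.
  - by apply: intgD; [|apply: intgZ]; apply: intg_norm; exact: L2M.
  - move=> n x; rewrite mulrDr; apply: le_trans (ler_normD _ _) _; apply: lerD.
      by rewrite mulrA normrM -[leRHS]mulr1 ler_wpM2l.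
    by rewrite mulrA normrM mulrC ler_wpM2r.
  - apply: aeW => x; rewrite -[derive1 G x in X in _ --> X]mulr1 -[_ * 1]addr0 -[0](mulr0 (G x)).
    apply: cvgM; first exact: cvg_cst.
    by apply: cvgD; apply: cvgM; [exact: cvg_cst|exact: lim_chi|exact: cvg_cst|exact: lim_chi'].
have lim3 := cvgN lim2.
apply: (cvg_unique _ lim1); first exact: Rhausdorff.
have -> : (fun n => iR (fun x => f1 x * (G x * chi n x))) =
    (fun n => - iR (fun x => f x * (derive1 G x * chi n x + G x * chi' n x))).
  by apply/funext.
exact: lim3.
Unshelve. all: by end_near. Qed.

End WeakDerivative.

(** * Steklov averages and H^2 competitors *)

Section Translation.
Variable R : realType.
Notation mu := (@lebesgue_measure R).

Section Shift.
Variable h : R.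
Let phi (x : measurableTypeR R) : measurableTypeR R := x + h.
Let mphi : measurable_fun setT phi.
Proof. by apply: measurable_funD. Qed.
Let phi_mixin := isMeasurableFun.Build _ _ _ _ _ mphi.
Let phi_pack : {mfun _ >-> _} := HB.pack phi phi_mixin.

Let shift_measure A : measurable A -> mu A = pushforward mu phi_pack A.
Proof.
apply: lebesgue_measure_unique => X [[a b] /= _ <-].
rewrite /pushforward /=.
have -> : phi @^-1` `]a, b]%classic = `]a - h, b - h]%classic.
  by apply/seteqP; split => x /=; rewrite !in_itv /= /phi ltrBlDr lerBrDr.
rewrite [LHS](lebesgue_measure_itv `]a, b]) [RHS](lebesgue_measure_itv `]a - h, b - h]) /=.
by rewrite !lte_fin ltrD2r; case: ifP => // _; rewrite -!EFinB; congr EFin; ring.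
Qed.

(** Translation invariance: the image of Lebesgue measure agrees with it on half-open intervals,
    which determine it. *)
Lemma ge0_integral_shift (u : R -> \bar R) : measurable_fun setT u -> (forall x, (0 <= u x)%E) ->
  (\int[mu]_x u (x + h)%R = \int[mu]_x u x)%E.
Proof.
move=> mu_ u0; rewrite [RHS](@eq_measure_integral _ _ _ _ (pushforward mu phi_pack)); last first.
  by move=> A mA _; exact: shift_measure.
by rewrite ge0_integral_pushforward.
Qed.

Lemma meas_shift (u : R -> R) : meas u -> meas (fun x => u (x + h)).
Proof. by move=> mu_; apply: (measurableT_comp mu_ mphi). Qed.

Lemma intg_shift (u : R -> R) : intg u -> intg (fun x => u (x + h)).
Proof.
move=> Iu; have mu_ := intg_meas Iu; apply/integrableP; split.
  by apply/measurable_EFinP; exact: meas_shift.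
case/integrableP: Iu => _; apply: le_lt_trans.
rewrite (@ge0_integral_shift (fun x => `|(EFin \o u) x|%E))//.
by apply: measurableT_comp => //; exact/measurable_EFinP.
Qed.

Lemma iR_shift (u : R -> R) : intg u -> iR (fun x => u (x + h)) = iR u.
Proof.
move=> Iu; have mu_ := intg_meas Iu.
have -> : u = fun x => (`|u x| + u x) / 2 - (`|u x| - u x) / 2 by apply/funext => x; lra.
have Ia := intg_norm Iu.
have I1 : intg (fun x => (`|u x| + u x) / 2).
  by under [X in intg X]eq_fun do rewrite mulrC; apply: intgZ; exact: intgD.
have I2 : intg (fun x => (`|u x| - u x) / 2).
  by under [X in intg X]eq_fun do rewrite mulrC; apply: intgZ; exact: intgB.
rewrite (iRB I1 I2) (iRB (intg_shift I1) (intg_shift I2)); congr (_ - _); congr fine.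
  apply: (@ge0_integral_shift (fun x => ((`|u x| + u x) / 2)%:E)).
    by apply/measurable_EFinP; exact: (intg_meas I1).
  by move=> x; rewrite lee_fin; have := ler_norm (- u x); rewrite normrN; lra.
apply: (@ge0_integral_shift (fun x => ((`|u x| - u x) / 2)%:E)).
  by apply/measurable_EFinP; exact: (intg_meas I2).
by move=> x; rewrite lee_fin; have := ler_norm (u x); lra.
Qed.

Lemma L2_shift (u : R -> R) : L2R u -> L2R (fun x => u (x + h)).
Proof.
move=> Lu; have [mu_ _] := Lu; apply: intg_L2; first exact: meas_shift.
exact: (intg_shift (L2_intg Lu)).
Qed.
End Shift.

Lemma test_shift (h : R) (chi : R -> R) : test_fn chi -> test_fn (fun x => chi (x + h)).
Proof.
move=> tc; have Sc := test_sm tc; have [_ [r Hr]] := tc; split.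
  have [S _] : sm (@anyf R) (fun x => chi (1 * x + h)) by apply: sm_affine => //; exact: sm_impl Sc.
  by rewrite (_ : (fun x => _) = (fun x => chi (1 * x + h)))//; apply/funext => x; rewrite mul1r.
exists (`|r| + `|h|) => x xr; apply: Hr.
have h1 : `|x| - `|h| <= `|x + h| by rewrite lerBlDr -(normrN h); apply: le_trans (ler_normD _ _); rewrite addrK.
by have := ler_norm r; lra.
Qed.

Lemma weak_shift (h : R) (f f1 : R -> R) : L2R f -> L2R f1 -> weak_deriv f f1 ->
  weak_deriv (fun x => f (x + h)) (fun x => f1 (x + h)).
Proof.
move=> Lf Lf1 /(weak_derivP Lf Lf1) wf.
apply/(weak_derivP (L2_shift h Lf) (L2_shift h Lf1)) => chi tc.
have Sc := test_sm tc.
pose c2 x := chi (x - h).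
have tc2 : test_fn c2 by exact: test_shift.
have dc2 : isd c2 (fun x => derive1 chi (x - h)).
  apply: isd_ext (isd_comp (sm_isd Sc) (isdD (@isdX R) (isdC (- h)))) _ _ => x //=; ring.
have := wf c2 tc2; rewrite (isdE dc2).
have I1 : intg (fun x => f x * derive1 chi (x - h)).
  by have := L2M Lf (test_L2 (test_der tc2)); rewrite (isdE dc2).
have I2 : intg (fun x => f1 x * c2 x) by apply: L2M => //; exact: test_L2.
rewrite -(iR_shift h I1) -(iR_shift h I2) /c2.
under [X in iR X = _ -> _]eq_fun do rewrite addrK.
by under [X in _ = - iR X -> _]eq_fun do rewrite addrK.
Qed.

End Translation.

Section Steklov.
Variable R : realType.
Notation mu := (@lebesgue_measure R).
Implicit Types (f g v : R -> R) (a b x y h t : R).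

Lemma L2_locint f : L2R f -> forall u w : R, mu.-integrable `[u, w] (EFin \o f).
Proof.
move=> Lf u w; have [mf _ H] := L2_locally_integrable Lf; apply/integrableP; split.
  by apply/measurable_EFinP; exact: measurable_funTS.
exact: (H `[u, w]%classic (@subsetT _ _) (@segment_compact _ u w)).
Qed.

Definition indi a b x : R := \1_(`[a, b]%classic) x.

Lemma indi_itv a b x : indi a b x = (a <= x <= b)%R%:R.
Proof.
rewrite /indi indicE; have [h|h] := boolP (a <= x <= b).
  by rewrite mem_set//= in_itv.
by rewrite memNset//= in_itv; exact/negP.
Qed.

Lemma indi_meas a b : meas (indi a b).
Proof. exact: measurable_indic. Qed.

Lemma indi_bdd a b : bdd (indi a b).
Proof. by exists 1 => x; rewrite indi_itv; case: (_ <= _ <= _); rewrite ?normr1 ?normr0. Qed.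

Lemma indi_intg a b : intg (indi a b).
Proof. exact: integrable_indic_itv. Qed.

Lemma indi_L2 a b : L2R (indi a b).
Proof.
apply: intg_L2; first exact: indi_meas.
rewrite (_ : (fun x => _) = indi a b); first exact: indi_intg.
by apply/funext => x; rewrite indi_itv; case: (_ <= _ <= _); rewrite ?expr1n ?expr0n.
Qed.

Lemma iR_indi a b : a <= b -> iR (indi a b) = b - a.
Proof.
move=> ab; rewrite /iR /IntR /indi integral_indic// setIT.
rewrite [X in fine X](lebesgue_measure_itv `[a, b]) /= lte_fin.
move: ab; rewrite le_eqVlt => /predU1P[->|->]; first by rewrite ltxx subrr.
by rewrite -EFinB.
Qed.

Lemma itv_iR f a b : \int[mu]_(x in `[a, b]) f x = iR (fun x => f x * indi a b x).
Proof.
rewrite Rintegral_mkcond; congr fine; apply: eq_integral => x _.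
by rewrite patchE /indi indicE; case: (_ \in _); rewrite ?mulr1 ?mulr0.
Qed.

(** The integral of (v - t)^2 over [a, b] is nonnegative; [t] is taken to be the mean of [v]. *)
Lemma cs_itv v a b : L2R v -> a <= b ->
  (\int[mu]_(x in `[a, b]) v x) ^+ 2 <= (b - a) * iR (fun x => v x ^+ 2 * indi a b x).
Proof.
move=> Lv; rewrite le_eqVlt => /predU1P[->|ab].
  by rewrite set_itv1 Rintegral_set1 expr0n subrr mul0r.
rewrite itv_iR; set m := iR _.
have Ive : intg (fun x => v x * indi a b x) by apply: L2M => //; exact: indi_L2.
have Iv2 : intg (fun x => v x ^+ 2 * indi a b x).
  have := intgMb (indi_bdd a b) (indi_meas a b) (L2_intg Lv).
  by congr (intg _); apply/funext => x; rewrite mulrC.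
set q := iR (fun x => v x ^+ 2 * indi a b x).
have key t : 0 <= q - 2 * t * m + t ^+ 2 * (b - a).
  rewrite -(iR_indi (ltW ab)) /q /m -(iRZ (2 * t))// -iRZ ?indi_intg// -iRB//; last exact: intgZ.
  rewrite -iRD; [|by apply: intgB => //; exact: intgZ|by apply: intgZ; exact: indi_intg].
  apply: iR_ge0 => x.
  have -> : v x ^+ 2 * indi a b x - 2 * t * (v x * indi a b x) + t ^+ 2 * indi a b x =
    (v x - t) ^+ 2 * indi a b x by ring.
  by rewrite mulr_ge0 ?sqr_ge0// indi_itv.
have ba : 0 < b - a by lra.
have := key (m / (b - a)).
have -> : q - 2 * (m / (b - a)) * m + (m / (b - a)) ^+ 2 * (b - a) = q - m ^+ 2 / (b - a).
  by field; rewrite gt_eqF.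
by rewrite subr_ge0 ler_pdivrMr// mulrC.
Qed.

Lemma cs_itv' v a b : L2R v -> a <= b ->
  (\int[mu]_(x in `[a, b]) v x) ^+ 2 <= (b - a) * iR (fun x => v x ^+ 2).
Proof.
move=> Lv ab; apply: le_trans (cs_itv Lv ab) _; rewrite ler_wpM2l ?subr_ge0//.
apply: iR_le; [|exact: L2_intg|].
  have := intgMb (indi_bdd a b) (indi_meas a b) (L2_intg Lv).
  by congr (intg _); apply/funext => x; rewrite mulrC.
move=> x; rewrite -[leRHS]mulr1 ler_wpM2l ?sqr_ge0// indi_itv.
by case: (_ <= _ <= _).
Qed.

(* Averaging over windows contracts the L2 norm: Jensen, then Tonelli on the strip 0 <= y - x <= h. *)
Lemma steklov_L2 v (V : R -> R) h : L2R v -> 0 < h -> meas V ->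
  (forall x, V x = h^-1 * \int[mu]_(t in `[x, x + h]) v t) ->
  L2R V /\ iR (fun x => V x ^+ 2) <= iR (fun x => v x ^+ 2).
Proof.
move=> Lv h0 mV HV; have [mv _] := Lv.
pose G (p : R * R) : \bar R := (h^-1 * (v p.2 ^+ 2 * indi 0 h (p.2 - p.1)))%:E.
have mG : measurable_fun setT G.
  apply/measurable_EFinP; apply: measurable_funM => //; apply: measurable_funM.
    by apply: measurable_funX; apply: measurableT_comp.
  apply: (measurableT_comp (indi_meas 0 h)).
  by apply: measurable_funB; [exact: measurable_snd|exact: measurable_fst].
have hi : 0 <= h^-1 by rewrite invr_ge0 ltW.
have G0 p : (0 <= G p)%E.
  by rewrite lee_fin mulr_ge0// mulr_ge0 ?sqr_ge0// indi_itv.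
have Iv2 := L2_intg Lv.
have key : (IntR (fun x => (V x ^+ 2)%R) <= IntR (fun x => (v x ^+ 2)%R))%E.
  apply: (@le_trans _ _ (\int[mu]_x \int[mu]_y G (x, y))%E).
    apply: ge0_le_integral => //.
    - by move=> x _; rewrite lee_fin sqr_ge0.
    - by apply/measurable_EFinP; exact: measurable_funX.
    - exact: (measurable_fun_fubini_tonelli_F (m2 := mu) G mG G0).
    - move=> x _.
      have Iv3 : intg (fun y => v y ^+ 2 * indi x (x + h) y).
        have := intgMb (indi_bdd x (x + h)) (indi_meas x (x + h)) Iv2.
        by congr (intg _); apply/funext => y; rewrite mulrC.
      have -> : (\int[mu]_y G (x, y) = IntR (fun y => (h^-1 * (v y ^+ 2 * indi x (x + h) y))%R))%E.
        apply: eq_integral => y _; rewrite /G /= !indi_itv; congr (_ * (_ * _%:R))%:E.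
        by rewrite subr_ge0 lerBlDl.
      rewrite IntRE; last exact: intgZ.
      rewrite lee_fin iRZ// HV exprMn expr2 -mulrA ler_wpM2l//.
      rewrite -[leRHS]mul1r -[X in _ <= X * _](mulVf (lt0r_neq0 h0)) -mulrA ler_wpM2l//.
      have := @cs_itv v x (x + h) Lv; rewrite addrAC subrr add0r; apply.
      by rewrite lerDl ltW.
  have -> := fubini_tonelli (m1 := mu) (m2 := mu) G mG G0.
  rewrite le_eqVlt; apply/orP; left; apply/eqP; apply: eq_integral => y _.
  have Ii : intg (fun x => indi (y - h) y x) by exact: indi_intg.
  transitivity (IntR (fun x => (h^-1 * v y ^+ 2) * indi (y - h) y x)%R).
    apply: eq_integral => x _; rewrite /G /= !indi_itv mulrA; congr (_ * _%:R)%:E.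
    by rewrite subr_ge0 !lerBlDr andbC (addrC x).
  rewrite IntRE; last exact: intgZ.
  rewrite iRZ// iR_indi; last by rewrite gerBl ltW.
  by congr EFin; field; rewrite gt_eqF.
have LV : L2R V by split=> //; apply: le_lt_trans key _; rewrite IntRE// ltry.
split=> //; rewrite -lee_fin -!IntRE//; exact: L2_intg.
Qed.

(** Otherwise [0, 1], of measure 1, would lie in a null set. *)
Lemma ae_exists (P : R -> Prop) : {ae mu, forall x, P x} -> exists x, P x.
Proof.
move=> [N [mN N0 HN]]; apply: contrapT => H.
have sN : `[0%R, 1%R]%classic `<=` N.
  by move=> x _; apply: HN => /= Px; apply: H; exists x.
have : (mu `[0%R, 1%R]%classic <= mu N)%E by apply: le_measure => //; rewrite inE.
rewrite N0 [X in (X <= _)%E](lebesgue_measure_itv `[0%R, 1%R]) /= lte_fin ltr01.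
by rewrite -EFinB lee_fin subr0 ler10.
Qed.

Variables (eta : R -> R -> R -> R) (Ce : R).
Hypothesis Heta : mollifier eta Ce.

Lemma cvg_harmonic_dist (u : nat -> R) (l : R) :
  (forall d : R, 0 < d -> exists e0 : R, 0 < e0 /\ forall n : nat, n.+1%:R^-1 < e0 -> `|u n - l| < d) ->
  u n @[n --> \oo] --> l.
Proof.
move=> H; apply/cvgrPdist_lt => d d0; have [e0 [e00 He]] := H d d0.
near=> n; rewrite distrC; apply: He; near: n.
have /cvgrPdist_lt /(_ _ e00) := @cvg_harmonic R.
by apply: filterS => n; rewrite /= sub0r normrN ger0_norm ?invr_ge0.
Unshelve. all: by end_near. Qed.

(** Testing against a plateau on [a, b], whose derivative is a bump at [a] minus a bump at [b],
    gives the difference of the point values as the width tends to 0. *)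
Lemma weak_increment f f1 a b : L2R f -> L2R f1 -> weak_deriv f f1 -> a < b ->
  lebesgue_pt f a -> lebesgue_pt f b -> f b - f a = \int[mu]_(x in `[a, b]) f1 x.
Proof.
move=> Lf Lf1 /(weak_derivP Lf Lf1) wf ab la lb.
have [mf1 _] := Lf1.
pose e (n : nat) : R := n.+1%:R^-1.
have e0 n : 0 < e n by rewrite invr_gt0.
have e1 n : e n <= 1 by rewrite invf_le1// ler1n.
pose chi n := plateau eta a b (e n).
have Sc n : sm (@csupp R) (chi n) by exact: (plateau_test Heta (e0 n) (ltW ab)).
have dc n : isd (chi n) (fun x => eta a (e n) x - eta b (e n) x) by exact: (isd_plateau Heta _ _ (e0 n)).
have E n : iR (fun x => f x * eta a (e n) x) - iR (fun x => f x * eta b (e n) x) =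
    - iR (fun x => f1 x * chi n x).
  rewrite -wf; last exact: sm_test.
  rewrite (isdE (dc n)) -iRB; [|by apply: L2M => //; exact: (moll_L2 Heta)..].
  by congr iR; apply/funext => x; ring.
have L1 : iR (fun x => f x * eta a (e n) x) @[n --> \oo] --> f a.
  apply: cvg_harmonic_dist => d d0; have [d1 [d10 H]] := moll_lebesgue Heta Lf la d0.
  by exists d1; split=> // n hn; apply: H; rewrite e0.
have L2 : iR (fun x => f x * eta b (e n) x) @[n --> \oo] --> f b.
  apply: cvg_harmonic_dist => d d0; have [d1 [d10 H]] := moll_lebesgue Heta Lf lb d0.
  by exists d1; split=> // n hn; apply: H; rewrite e0.
have L3 : iR (fun x => f1 x * chi n x) @[n --> \oo] --> iR (fun x => f1 x * indi a b x).
  apply: (@dct _ (fun n x => f1 x * chi n x) _ (fun x => `|f1 x * indi (a - 1) (b + 1) x|)).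
  - by move=> n; apply: measurable_funM => //; exact: cont_meas (sm_cont (Sc n)).
  - by apply: measurable_funM => //; exact: indi_meas.
  - by apply: intg_norm; apply: L2M => //; exact: indi_L2.
  - move=> n x; rewrite !normrM ler_wpM2l// indi_itv.
    have [h|h] := boolP (a - 1 <= x <= b + 1).
      by rewrite normr1; exact: (plateau_norm Heta).
    rewrite /chi (plateau0 Heta (e0 n) (ltW ab)) ?normr0//.
    move: h; rewrite negb_and -!ltNge => /orP[h|h]; apply/orP; [left|right];
      have := e1 n; lra.
  (* The limit of the plateaus at the two endpoints depends on the bump, so these are left out as a
     null set. *)
  - have : mu.-negligible [set a; b].
      exists [set a; b]; split=> //; first exact: measurableU.
      by apply: countable_lebesgue_measure0; apply: finite_set_countable.
    move=> [N [mN N0 HN]]; exists N; split=> //; apply: subset_trans HN => x /= nx.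
    apply: contrapT => xab; apply: nx.
    have xa : x != a by apply/eqP => h; apply: xab; left.
    have xb : x != b by apply/eqP => h; apply: xab; right.
    apply: cvgM; first exact: cvg_cst.
    pose m : R := Num.min `|x - a| `|x - b|.
    have m0 : 0 < m by rewrite lt_min !normr_gt0 !subr_eq0 xa xb.
    apply: cvg_harmonic_dist => d d0; exists m; split=> // n.
    rewrite lt_min => /andP[]; rewrite -/(e n) indi_itv => h1 h2.
    suff -> : chi n x = (a <= x <= b)%R%:R by rewrite subrr normr0.
    have [h|h] := boolP (a <= x <= b).
      move/andP: h => [ax bx]; apply: (plateau1 Heta) => //.
      rewrite ger0_norm ?subr_ge0// in h1; rewrite ler0_norm ?subr_le0// in h2.
      by apply/andP; split; lra.
    apply: (plateau0 Heta) => //; first exact: ltW.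
    move: h; rewrite negb_and -!ltNge => /orP[h|h]; apply/orP; [left|right].
      by rewrite ltr0_norm ?subr_lt0// in h1; lra.
    by rewrite gtr0_norm ?subr_gt0// in h2; lra.
have L4 := cvgB L1 L2.
have L5 : - iR (fun x => f1 x * chi n x) @[n --> \oo] --> f a - f b.
  have <- : (fun n => iR (fun x => f x * eta a (e n) x) - iR (fun x => f x * eta b (e n) x)) =
    (fun n => - iR (fun x => f1 x * chi n x)) by apply/funext => n; rewrite E.
  exact: L4.
have := cvg_unique (@Rhausdorff R) L5 (cvgN L3); rewrite itv_iR => h.
by rewrite -[RHS]opprK -h opprB.
Qed.
End Steklov.

Section Competitor.
Variable R : realType.
Notation mu := (@lebesgue_measure R).
Implicit Types (f g v : R -> R) (a b x y h t : R).
Variables (eta : R -> R -> R -> R) (Ce : R).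
Hypothesis Heta : mollifier eta Ce.

Lemma prim_holder v a b : L2R v -> a <= b ->
  (prim v b - prim v a) ^+ 2 <= (b - a) * iR (fun x => v x ^+ 2).
Proof. by move=> Lv ab; rewrite prim_itv//; [exact: cs_itv'|exact: L2_locint]. Qed.

Lemma prim_L2_cont v : L2R v -> continuous (prim v).
Proof.
move=> Lv x; apply/cvgrPdist_lt => e e0.
set N := iR (fun x => v x ^+ 2).
have N0 : 0 <= N by apply: iR_ge0 => y; exact: sqr_ge0.
pose d : R := e ^+ 2 / (N + 1).
have d0 : 0 < d by rewrite /d divr_gt0 ?exprn_gt0//; lra.
near=> y.
have hy : `|x - y| < d.
  by near: y; have /cvgrPdist_lt := @cvg_id _ (nbhs x); apply.
have H : `|prim v x - prim v y| ^+ 2 <= `|x - y| * N.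
  rewrite real_normK ?num_real//; have [xy|yx] := leP x y.
    by rewrite -sqrrN opprB distrC ger0_norm ?subr_ge0//; exact: prim_holder.
  by rewrite gtr0_norm ?subr_gt0//; apply: prim_holder => //; exact: ltW.
have : `|x - y| * N < e ^+ 2.
  apply: (@le_lt_trans _ _ (`|x - y| * (N + 1))); first by apply: ler_wpM2l => //; lra.
  by rewrite -ltr_pdivlMr//; lra.
move=> /(le_lt_trans H); rewrite ltr_pXn2r// nnegrE ltW//.
Unshelve. all: by end_near. Qed.

(** One Lebesgue point of [f] fixes the constant; increments from it to any other Lebesgue point are
    integrals of [f1]. *)
Lemma continuous_representative f f1 : L2R f -> L2R f1 -> weak_deriv f f1 ->
  exists c, {ae mu, forall x, f x = prim f1 x + c}.
Proof.
move=> Lf Lf1 wf.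
have ael := lebesgue_differentiation (L2_locally_integrable Lf).
have [a la] := ae_exists ael.
exists (f a - prim f1 a); apply: filterS ael; first exact: (ae_filter_ringOfSetsType mu).
move=> x lx.
have [ax|xa|->] := ltgtP a x; last by ring.
- have := weak_increment Heta Lf Lf1 wf ax la lx.
  by rewrite -prim_itv ?(ltW ax)//; [lra|exact: L2_locint].
- have := weak_increment Heta Lf Lf1 wf xa lx la.
  by rewrite -prim_itv ?(ltW xa)//; [lra|exact: L2_locint].
Qed.

Lemma ae_L2 f g : meas g -> L2R f -> {ae mu, forall x, f x = g x} -> L2R g.
Proof.
move=> mg [mf Lf] H; split=> //; apply: le_lt_trans Lf.
rewrite le_eqVlt; apply/orP; left; apply/eqP; apply: ae_eq_integral => //.
- by apply/measurable_EFinP; exact: measurable_funX.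
- by apply/measurable_EFinP; exact: measurable_funX.
- by apply: filterS H; [exact: (ae_filter_ringOfSetsType mu)|move=> x -> _].
Qed.

Lemma ae_weak f g f1 : L2R f -> L2R g -> L2R f1 -> {ae mu, forall x, f x = g x} ->
  weak_deriv f f1 -> weak_deriv g f1.
Proof.
move=> Lf Lg Lf1 H /(weak_derivP Lf Lf1) wf; apply/(weak_derivP Lg Lf1) => chi tc.
rewrite -wf//; have [mc' _] := test_L2 (test_der tc).
have [[mf _] [mg _]] := (Lf, Lg).
apply: ae_iR; [exact: measurable_funM..|].
by apply: filterS H; [exact: (ae_filter_ringOfSetsType mu)|move=> x ->].
Qed.

Lemma mean_bounds v P h x m m' : isd P v -> 0 < h ->
  (forall y, x <= y <= x + h -> m <= v y <= m') -> m <= h^-1 * (P (x + h) - P x) <= m'.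
Proof.
move=> dP h0 H; have xh : x <= x + h by lra.
have d1 := isdZ m (@isdX R); have d2 := isdZ m' (@isdX R).
have e1 := isd_le2 d1 dP xh (fun y hy => eq_ind _ (fun t => is_true (t <= v y)) (andP (H y hy)).1 _ (esym (mulr1 m))).
have e2 := isd_le2 dP d2 xh (fun y hy => eq_ind _ (fun t => is_true (v y <= t)) (andP (H y hy)).2 _ (esym (mulr1 m'))).
apply/andP; split; [rewrite ler_pdivlMl//|rewrite ler_pdivrMl//]; move: e1 e2; lra.
Qed.

(** [F n] is the average of the continuous representative over a window of length [e n]. Its
    derivative is a difference quotient, which is the same average of [f1], so its norm does not
    exceed that of [f1]; its second derivative is a difference quotient of [f1], hence in L^2. The
    weighted integral converges as the window shrinks, and the strict inequality survives for some
    [n]. *)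
Lemma H1_to_H2 f f1 (r : R -> R) (M2 : R) : H1 f f1 -> test_fn r -> 0 <= M2 ->
  M2 * iR (fun x => f1 x ^+ 2) < iR (fun x => r x * f x ^+ 2) ->
  exists F F1 F2, H2 F F1 F2 /\
    0 < iR (fun x => r x * F x ^+ 2 - M2 * F1 x ^+ 2).
Proof.
move=> [Lf [Lf1 wf]] tr M20 Hf.
have Sr := test_sm tr; have cr := sm_cont Sr; have mr := cont_meas cr.
have br := csupp_bdd cr (sm_P Sr).
have Ir u : L2R u -> intg (fun x => r x * u x ^+ 2).
  by move=> Lu; apply: intgMb => //; exact: L2_intg.
have [c aef] := continuous_representative Lf Lf1 wf.
pose v x := prim f1 x + c.
have cv : continuous v.
  by move=> x; apply: cvgD; [exact: (prim_L2_cont Lf1)|exact: cvg_cst].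
have mv := cont_meas cv.
have Lv : L2R v := ae_L2 mv Lf aef.
have wv : weak_deriv v f1 := ae_weak Lf Lv Lf1 aef wf.
have dP := isd_prim cv.
pose e (n : nat) : R := n.+1%:R^-1.
have e0 n : 0 < e n by rewrite invr_gt0.
have e1 n : e n <= 1 by rewrite invf_le1// ler1n.
pose F n x := (e n)^-1 * (prim v (x + e n) - prim v x).
pose F1 n x := (e n)^-1 * (v (x + e n) - v x).
pose F2 n x := (e n)^-1 * (f1 (x + e n) - f1 x).
have dF n : isd (F n) (F1 n).
  apply: isdZ; apply: isdB => //.
  by apply: isd_ext (isd_comp dP (isdD (@isdX R) (isdC (e n)))) _ _ => // x; rewrite addr0 mulr1.
have cF1 n : continuous (F1 n).
  have cs : continuous (fun x => v (x + e n)).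
    move=> x; apply: (@continuous_comp _ _ _ (fun x => x + e n) v); last exact: cv.
    by apply: cvgD; [exact: cvg_id|exact: cvg_cst].
  by move=> x; apply: cvgM; [exact: cvg_cst|apply: cvgB; [exact: cs|exact: cv]].
have [LF _] : (forall n, L2R (F n)) /\ True.
  split=> // n; have [] // := @steklov_L2 _ v (F n) (e n) Lv (e0 n) (cont_meas (isd_cont (dF n))).
  by move=> x; rewrite /F prim_itv//; [exact: L2_locint|rewrite lerDl ltW].
have HF1 n : L2R (F1 n) /\ iR (fun x => F1 n x ^+ 2) <= iR (fun x => f1 x ^+ 2).
  apply: (@steklov_L2 _ f1 (F1 n) (e n) Lf1 (e0 n) (cont_meas (cF1 n))) => x.
  rewrite /F1 -prim_itv; [by rewrite /v; congr (_ * _); ring|exact: L2_locint|by rewrite lerDl ltW].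
have HH n : H2 (F n) (F1 n) (F2 n).
  have LF1 : L2R (F1 n) by case: (HF1 n).
  have shift u : L2R u -> L2R (fun x => u (x + e n) + (- 1) * u x).
    by move=> Lu; apply: L2D; [exact: L2_shift|exact: L2Z].
  have LF2 : L2R (F2 n).
    have := L2Z (e n)^-1 (shift _ Lf1).
    by congr L2R; apply/funext => x; rewrite /F2 mulN1r.
  split; [exact: LF|split=> //; split=> //; split; first exact: classical_weak (dF n) (cF1 n)].
  have w1 := weak_deriv_lin (- 1) (L2_shift (e n) Lv) (L2_shift (e n) Lf1) Lv Lf1
    (weak_shift (e n) Lv Lf1 wv) wv.
  apply/(weak_derivP LF1 LF2) => chi tc.
  have := (weak_derivP (shift _ Lv) (shift _ Lf1)).1 w1 chi tc.
  have T u w : L2R u -> L2R w -> iR (fun x => (e n)^-1 * (u (x + e n) - u x) * w x) =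
      (e n)^-1 * iR (fun x => (u (x + e n) + (- 1) * u x) * w x).
    move=> Lu Lw; rewrite -iRZ; first by congr iR; apply/funext => x; ring.
    by apply: L2M => //; exact: shift.
  by rewrite !T//; [move=> ->; ring|exact: test_L2|exact/test_L2/test_der].
have limF x : F n x @[n --> \oo] --> v x.
  apply: cvg_harmonic_dist => d d0.
  have /cvgrPdist_lt /(_ (d / 2) ltac:(lra)) := cv x.
  move=> /nbhs_ballP [q /= q0 Hq]; exists q; split=> // n; rewrite -/(e n) => hn.
  have h y : x <= y <= x + e n -> v x - d / 2 <= v y <= v x + d / 2.
    move=> /andP[h1 h2]; have := Hq y; rewrite /ball /= => /(_ _).
    rewrite ler0_norm ?subr_le0// => /(_ ltac:(lra)).
    by rewrite ltr_norml => /andP[h3 h4]; apply/andP; split; lra.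
  have /andP[h1 h2] := mean_bounds dP (e0 n) h.
  by rewrite ltr_norml; apply/andP; split; rewrite /F; lra.
have [rad Hr] := sm_P Sr; have [D HD] := br.
(* The window at a point of [-rad, rad] reaches at most 1 further to the right. *)
have [B [B0 HB]] := @continuous_bdd_itv _ v (- rad) (rad + 1) cv.
have D0 := le_trans (normr_ge0 _) (HD 0).
have lim : iR (fun x => r x * F n x ^+ 2) @[n --> \oo] --> iR (fun x => r x * v x ^+ 2).
  apply: (@dct _ (fun n x => r x * F n x ^+ 2) _ (fun x => D * B ^+ 2 * indi (- rad) rad x)).
  - move=> n; apply: measurable_funM => //; apply: measurable_funX.
    by case: (LF n).
  - by apply: measurable_funM => //; exact: measurable_funX.
  - by apply: intgZ; exact: indi_intg.
  - move=> n x; rewrite indi_itv normrM normrX -ler_norml.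
    have [xr|xr] := leP `|x| rad; last by rewrite Hr// normr0 mul0r mulr0.
    rewrite mulr1; apply: ler_pM => //.
    apply: lerXn2r; rewrite ?nnegrE//.
    rewrite ler_norml; apply: (mean_bounds dP (e0 n)) => y /andP[h1 h2].
    rewrite -ler_norml; apply: HB; move: xr; rewrite ler_norml => /andP[h3 h4].
    by have := e1 n; move=> h5; apply/andP; split; lra.
  - apply: aeW => x; apply: cvgM; first exact: cvg_cst.
    by rewrite expr2; under eq_fun do rewrite expr2; apply: cvgM; exact: limF.
have Ev : iR (fun x => r x * v x ^+ 2) = iR (fun x => r x * f x ^+ 2).
  have [mf _] := Lf; apply: ae_iR.
  - by apply: measurable_funM => //; exact: measurable_funX.
  - by apply: measurable_funM => //; exact: measurable_funX.
  - by apply: filterS aef; [exact: (ae_filter_ringOfSetsType mu)|move=> x ->].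
rewrite Ev in lim.
have [n Hn] : exists n, M2 * iR (fun x => f1 x ^+ 2) < iR (fun x => r x * F n x ^+ 2).
  have /(_ _) near_gt := @cvgr_gt _ _ _ _ _ _ lim _ Hf.
  by have [n Hn] := filter_ex near_gt; exists n.
exists (F n), (F1 n), (F2 n); split; first exact: HH.
have [LF1 leF1] := HF1 n.
rewrite iRB; [|exact: Ir|by apply: intgZ; exact: L2_intg].
rewrite iRZ; last exact: L2_intg.
rewrite subr_gt0; apply: le_lt_trans Hn; exact: ler_wpM2l.
Qed.

End Competitor.

(** * Decaying solutions of the profile equation *)

Section Decay.
Variable R : realType.
Implicit Types (f g z : R -> R) (w : nat -> R -> R) (x y a b k r : R).

Lemma first_order_zero c r f f1 : isd f f1 -> f r = 0 ->
  (forall x, r <= x -> f1 x = c * f x) -> forall x, r <= x -> f x = 0.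
Proof.
move=> df f0 Hf x rx.
have d := isdM df (isd_expRZ (- c)).
have := isd_cst d rx; rewrite f0 mul0r => E.
have /eqP : 0 = f x * expR (- c * x).
  by apply: E => y /andP[ry _]; rewrite Hf//; ring.
by rewrite eq_sym mulf_eq0 (gt_eqF (expR_gt0 _)) orbF => /eqP.
Qed.

(** Integrating factor e^{bx}. The strict inequality [a < b] lets the source integrate to C/(b - a)
    times e^{(b-a)x}, without a resonant factor x. *)
Lemma first_order_decay a b r f f1 v C : isd f f1 -> a < b ->
  (forall x, r <= x -> f1 x = - b * f x + v x) ->
  (forall x, r <= x -> `|v x| <= C * expR (- a * x)) ->
  exists C', forall x, r <= x -> `|f x| <= C' * expR (- a * x).
Proof.
move=> df ab Hf Hv.
have ba : 0 < b - a by lra.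
have C0 : 0 <= C.
  by have := le_trans (normr_ge0 _) (Hv r (lexx r)); rewrite pmulr_lge0 ?expR_gt0.
pose D := C / (b - a); have D0 : 0 <= D by rewrite /D divr_ge0 // ltW.
have d := isdM df (isd_expRZ b).
have dE : isd (fun x => D * expR ((b - a) * x)) (fun x => C * expR ((b - a) * x)).
  by apply: isd_ext (isdZ D (isd_expRZ (b - a))) _ _ => // x; rewrite /D; field; lra.
have dN := isdN d.
exists (`|f r| * expR (b * r) * expR (- (b - a) * r) + D) => x rx.
have B y : r <= y <= x -> `|f1 y * expR (b * y) + f y * (b * expR (b * y))| <= C * expR ((b - a) * y).
  move=> /andP[ry _]; rewrite Hf//.
  have -> : (- b * f y + v y) * expR (b * y) + f y * (b * expR (b * y)) = v y * expR (b * y) by ring.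
  rewrite normrM (gtr0_norm (expR_gt0 _)).
  have -> : (b - a) * y = - a * y + b * y by ring.
  by rewrite expRD mulrA ler_wpM2r ?expR_ge0// Hv.

have Bn y : r <= y <= x -> `|- (f1 y * expR (b * y) + f y * (b * expR (b * y)))| <= C * expR ((b - a) * y).
  by rewrite normrN; exact: B.
have h1 := isd_le2 d dE rx (fun y Hy => le_trans (ler_norm _) (B y Hy)).
have h2 := isd_le2 dN dE rx (fun y Hy => le_trans (ler_norm _) (Bn y Hy)).
have Z : `|f x * expR (b * x)| <= `|f r| * expR (b * r) + D * expR ((b - a) * x).
  have h3 : 0 <= D * expR ((b - a) * r) by rewrite mulr_ge0 ?expR_ge0.
  have h4 := ler_norm (f r * expR (b * r)); have h5 := ler_norm (- (f r * expR (b * r))).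
  rewrite normrN in h5; rewrite !normrM (gtr0_norm (expR_gt0 (b * r))) in h4 h5.
  by rewrite ler_norml; apply/andP; split; lra.
have E1 : expR (b * x) * expR (- b * x) = 1.
  by rewrite -expRD -expR0; congr expR; ring.
have -> : f x = f x * expR (b * x) * expR (- b * x) by rewrite -mulrA E1 mulr1.
rewrite normrM (gtr0_norm (expR_gt0 (- b * x))).
apply: (@le_trans _ _ ((`|f r| * expR (b * r) + D * expR ((b - a) * x)) * expR (- b * x))).
  by rewrite ler_wpM2r ?expR_ge0.
rewrite [leLHS]mulrDl [leRHS]mulrDl; apply: lerD; last first.
  by rewrite -mulrA -expRD (_ : (b - a) * x + - b * x = - a * x)//; ring.
rewrite -[leRHS]mulrA -expRD ler_wpM2l ?mulr_ge0 ?expR_ge0// ler_expR.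
have : 0 <= (b - a) * (x - r) by rewrite mulr_ge0 ?subr_ge0// ltW.
lra.
Qed.

Definition chain (w : nat -> R -> R) (w4 : R -> R) :=
  [/\ isd (w 0%N) (w 1%N), isd (w 1%N) (w 2%N), isd (w 2%N) (w 3%N) & isd (w 3%N) w4].

(* On a half-line the operator factors as (d+k)(d+b)(d-k)(d-b); a solution with
   vanishing data for (d+k)(d+b)w only sees the two decaying exponentials. *)
Lemma decay_right k b r w (w4 : R -> R) : 0 < k -> 0 < b -> chain w w4 ->
  (forall x, r <= x -> w4 x = (k ^+ 2 + b ^+ 2) * w 2%N x - k ^+ 2 * b ^+ 2 * w 0%N x) ->
  w 2%N r + (k + b) * w 1%N r + k * b * w 0%N r = 0 ->
  w 3%N r + (k + b) * w 2%N r + k * b * w 1%N r = 0 ->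
  exists C, forall i, (i < 4)%N -> forall x, r <= x ->
    `|w i x| <= C * expR (- (Num.min k b / 2) * x).
Proof.
move=> k0 b0 [d0 d1 d2 d3] H4 c0 c1.
(* Strictly below both exponents, so that the resonant case k = b, with solutions x e^{-kx}, is
   covered too. *)
pose a : R := Num.min k b / 2.
have ak : a < k.
  rewrite /a; have : Num.min k b <= k by rewrite ge_min lexx.
  lra.
have ab : a < b.
  rewrite /a; have : Num.min k b <= b by rewrite ge_min lexx orbT.
  lra.
pose v x := w 2%N x + (k + b) * w 1%N x + k * b * w 0%N x.
pose v1 x := w 3%N x + (k + b) * w 2%N x + k * b * w 1%N x.
pose v2 x := w4 x + (k + b) * w 3%N x + k * b * w 2%N x.
have dv : isd v v1 := isdD (isdD d2 (isdZ (k + b) d1)) (isdZ (k * b) d0).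
have dv1 : isd v1 v2 := isdD (isdD d3 (isdZ (k + b) d2)) (isdZ (k * b) d1).
(* The growing factors are removed one at a time: (d-b)v solves y' = k y with zero data at [r], and
   then v solves y' = b y with zero data. *)
have p0 x : r <= x -> v1 x - b * v x = 0.
  apply: (@first_order_zero k r _ _ (isdB dv1 (isdZ b dv))); first by rewrite /v1 /v c1 c0 mulr0 subr0.
  by move=> y ry; rewrite /v2 /v1 /v H4//; ring.
have v0 x : r <= x -> v x = 0.
  apply: (@first_order_zero b r _ _ dv) => // y ry.
  by have := p0 y ry; lra.
have v10 x : r <= x -> v1 x = 0.
  by move=> rx; have := p0 x rx; rewrite v0// mulr0 subr0.
have dy : isd (fun x => w 1%N x + b * w 0%N x) _ := isdD d1 (isdZ b d0).
have [C1 HC1] : exists C', forall x, r <= x -> `|w 1%N x + b * w 0%N x| <= C' * expR (- a * x).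
  apply: (@first_order_decay a k r _ _ (fun=> 0) 0 dy ak).
    by move=> x rx; have := v0 x rx; rewrite /v; lra.
  by move=> x _; rewrite normr0 mul0r.
have [C2 HC2] : exists C', forall x, r <= x -> `|w 0%N x| <= C' * expR (- a * x).
  apply: (@first_order_decay a b r _ _ (fun x => w 1%N x + b * w 0%N x) C1 d0 ab) => //.
  by move=> x rx; ring.
pose C3 := C1 + b * C2; pose C4 := (k + b) * C3 + k * b * C2; pose C5 := (k + b) * C4 + k * b * C3.
have kb0 : 0 < k * b by rewrite mulr_gt0.
have kpb : 0 < k + b by lra.
have HC3 x : r <= x -> `|w 1%N x| <= C3 * expR (- a * x).
  move=> rx; rewrite -[w 1%N x](addrK (b * w 0%N x)); apply: le_trans (ler_normB _ _) _.
  rewrite /C3 [leRHS]mulrDl lerD// ?HC1// normrM (gtr0_norm b0) -mulrA ler_wpM2l ?HC2//; exact: ltW.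
have HC4 x : r <= x -> `|w 2%N x| <= C4 * expR (- a * x).
  move=> rx; have := v0 x rx; rewrite /v => E.
  have -> : w 2%N x = - ((k + b) * w 1%N x + k * b * w 0%N x) by lra.
  rewrite normrN; apply: le_trans (ler_normD _ _) _; rewrite /C4 [leRHS]mulrDl.
  rewrite (normrM (k + b)) (gtr0_norm kpb) (normrM (k * b)) (gtr0_norm kb0).
  rewrite -[X in _ <= X + _]mulrA -[X in _ <= _ + X]mulrA.
  by apply: lerD; (apply: ler_wpM2l; first exact: ltW); [exact: HC3|exact: HC2].
have HC5 x : r <= x -> `|w 3%N x| <= C5 * expR (- a * x).
  move=> rx; have := v10 x rx; rewrite /v1 => E.
  have -> : w 3%N x = - ((k + b) * w 2%N x + k * b * w 1%N x) by lra.
  rewrite normrN; apply: le_trans (ler_normD _ _) _; rewrite /C5 [leRHS]mulrDl.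
  rewrite (normrM (k + b)) (gtr0_norm kpb) (normrM (k * b)) (gtr0_norm kb0).
  rewrite -[X in _ <= X + _]mulrA -[X in _ <= _ + X]mulrA.
  by apply: lerD; (apply: ler_wpM2l; first exact: ltW); [exact: HC4|exact: HC3].
exists (`|C2| + `|C3| + `|C4| + `|C5|) => i i4 x rx.
have e0 := expR_ge0 (- a * x).
have N1 := normr_ge0 C2; have N2 := normr_ge0 C3; have N3 := normr_ge0 C4; have N4 := normr_ge0 C5.
have L1 := ler_norm C2; have L2 := ler_norm C3; have L3 := ler_norm C4; have L4 := ler_norm C5.
move: i4; case: i => [_|[_|[_|[_|//]]]].
- by apply: le_trans (HC2 x rx) _; rewrite ler_wpM2r//; lra.
- by apply: le_trans (HC3 x rx) _; rewrite ler_wpM2r//; lra.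
- by apply: le_trans (HC4 x rx) _; rewrite ler_wpM2r//; lra.
- by apply: le_trans (HC5 x rx) _; rewrite ler_wpM2r//; lra.
Qed.

Lemma isd_reflect f f1 : isd f f1 -> isd (fun x => f (- x)) (fun x => - f1 (- x)).
Proof.
move=> df; apply: isd_ext (isd_comp df (isdN (@isdX R))) _ _ => // x; ring.
Qed.

Lemma decay_left k b r w (w4 : R -> R) : 0 < k -> 0 < b -> chain w w4 ->
  (forall x, x <= - r -> w4 x = (k ^+ 2 + b ^+ 2) * w 2%N x - k ^+ 2 * b ^+ 2 * w 0%N x) ->
  w 2%N (- r) - (k + b) * w 1%N (- r) + k * b * w 0%N (- r) = 0 ->
  w 3%N (- r) - (k + b) * w 2%N (- r) + k * b * w 1%N (- r) = 0 ->
  exists C, forall i, (i < 4)%N -> forall x, x <= - r ->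
    `|w i x| <= C * expR (Num.min k b / 2 * x).
Proof.
move=> k0 b0 [d0 d1 d2 d3] H4 c0 c1.
(* Reflection changes the sign of the odd derivatives and leaves the even-order equation
   unchanged. *)
pose W i x : R := (-1) ^+ i * w i (- x).
have ch : chain W (fun x => w4 (- x)).
  split; rewrite /W.
  - by apply: isd_ext (isd_reflect d0) _ _ => x; ring.
  - by apply: isd_ext (isdN (isd_reflect d1)) _ _ => x; ring.
  - by apply: isd_ext (isd_reflect d2) _ _ => x; ring.
  - by apply: isd_ext (isdN (isd_reflect d3)) _ _ => x; ring.
have [|||C HC] := @decay_right k b r W _ k0 b0 ch.
- by move=> x rx; rewrite H4 ?lerN2// /W; ring.
- by rewrite /W -[RHS]c0; ring.
- by rewrite /W -[RHS]oppr0 -[in RHS]c1; ring.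
exists C => i i4 x xr; have := HC i i4 (- x); rewrite lerNr => /(_ xr).
by rewrite /W normrM normrX normrN1 expr1n mul1r opprK mulrN mulNr opprK.
Qed.

Lemma decay_line (kr b1 b2 r : R) w (w4 : R -> R) : 0 < kr -> 0 < b1 -> 0 < b2 -> 0 < r -> chain w w4 ->
  (forall x, r <= x -> w4 x = (kr ^+ 2 + b1 ^+ 2) * w 2%N x - kr ^+ 2 * b1 ^+ 2 * w 0%N x) ->
  (forall x, x <= - r -> w4 x = (kr ^+ 2 + b2 ^+ 2) * w 2%N x - kr ^+ 2 * b2 ^+ 2 * w 0%N x) ->
  w 2%N r + (kr + b1) * w 1%N r + kr * b1 * w 0%N r = 0 ->
  w 3%N r + (kr + b1) * w 2%N r + kr * b1 * w 1%N r = 0 ->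
  w 2%N (- r) - (kr + b2) * w 1%N (- r) + kr * b2 * w 0%N (- r) = 0 ->
  w 3%N (- r) - (kr + b2) * w 2%N (- r) + kr * b2 * w 1%N (- r) = 0 ->
  forall i, (i < 4)%N -> edec (Num.min kr (Num.min b1 b2) / 2) (w i).
Proof.
move=> k0 b10 b20 r0 ch H1 H2 c1 c2 c3 c4 i i4.
have [C HC] := decay_right k0 b10 ch H1 c1 c2.
have [D HD] := decay_left k0 b20 ch H2 c3 c4.
have cw : continuous (w i).
  have [d0 d1 d2 d3] := ch.
  by move: i4; case: i => [_|[_|[_|[_|//]]]]; [exact: isd_cont d0|exact: isd_cont d1|exact: isd_cont d2|exact: isd_cont d3].
have [E [E0 HE]] := @continuous_bdd_itv _ (w i) (- r) r cw.
set a : R := _ / 2.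
have a0 : 0 < a by rewrite /a divr_gt0// !lt_min k0 b10 b20.
have a1 : a <= Num.min kr b1 / 2.
  rewrite /a ler_pM2r ?invr_gt0// le_min !ge_min !lexx /=.
  by rewrite orbT.
have a2 : a <= Num.min kr b2 / 2.
  rewrite /a ler_pM2r ?invr_gt0// le_min !ge_min !lexx /=.
  by rewrite !orbT.
exists (`|C| + `|D| + E * expR (a * r)) => x.
have e0 := expR_ge0 (- a * `|x|).
have N1 := normr_ge0 C; have N2 := normr_ge0 D.
have N3 : 0 <= E * expR (a * r) by rewrite mulr_ge0 ?expR_ge0.
have [xr|xr] := leP r x.
  have x0 : 0 <= x by lra.
  apply: le_trans (HC i i4 x xr) _.
  apply: (@le_trans _ _ (`|C| * expR (- a * `|x|))); last by rewrite ler_wpM2r//; lra.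
  apply: ler_pM => //; try exact: expR_ge0.
  - by have := le_trans (normr_ge0 _) (HC i i4 x xr); rewrite pmulr_lge0 ?expR_gt0.
  - exact: ler_norm.
  - by rewrite ler_expR ger0_norm// !mulNr lerN2 ler_wpM2r.
have [xr'|xr'] := leP x (- r).
  have x0 : x <= 0 by lra.
  apply: le_trans (HD i i4 x xr') _.
  apply: (@le_trans _ _ (`|D| * expR (- a * `|x|))); last by rewrite ler_wpM2r//; lra.
  apply: ler_pM => //; try exact: expR_ge0.
  - by have := le_trans (normr_ge0 _) (HD i i4 x xr'); rewrite pmulr_lge0 ?expR_gt0.
  - exact: ler_norm.
  - by rewrite ler_expR ler0_norm// mulrNN ler_wnM2r.
apply: (@le_trans _ _ E); first by apply: HE; rewrite !(ltW _).
apply: (@le_trans _ _ (E * expR (a * r) * expR (- a * `|x|))); last by rewrite ler_wpM2r//; lra.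
rewrite -mulrA -expRD -[leLHS]mulr1 ler_wpM2l// -expR0 ler_expR mulNr subr_ge0 ler_wpM2l//; first exact: ltW.
by rewrite ler_norml !ltW.
Qed.

End Decay.

(** * Alternative between a decaying homogeneous solution and uniform solvability *)

Section Alternative.
Variable R : realType.
Implicit Types (f g h : R -> R) (w : nat -> R -> R).
Variables (p0 p1 p2 : R -> R) (k b1 b2 r : R).
Hypotheses (sp0 : sm (@bdd R) p0) (sp1 : sm (@bdd R) p1) (sp2 : sm (@bdd R) p2).
Hypotheses (k0 : 0 < k) (b10 : 0 < b1) (b20 : 0 < b2) (r0 : 0 < r).
Hypothesis pR : forall x, r <= x ->
  [/\ p2 x = k ^+ 2 + b1 ^+ 2, p1 x = 0 & p0 x = - (k ^+ 2 * b1 ^+ 2)].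
Hypothesis pL : forall x, x <= - r ->
  [/\ p2 x = k ^+ 2 + b2 ^+ 2, p1 x = 0 & p0 x = - (k ^+ 2 * b2 ^+ 2)].

Definition sol h w :=
  chain w (fun x => p2 x * w 2%N x + p1 x * w 1%N x + p0 x * w 0%N x + h x).

Let amat (i j : nat) (x : R) : R :=
  if i == 3%N then nth 0 [:: p0 x; p1 x; p2 x; 0] j else (j == i.+1)%:R.

(** [amat] is the companion matrix of the fourth-order equation. The rate [K] is fixed before [h],
    so it depends on the coefficients alone. *)
Lemma sol_exists : exists K, 0 <= K /\ forall h (c : nat -> R) D, continuous h ->
  (forall i x, `|c i| + `|prim h x| <= D) ->
  exists w, [/\ sol h w, forall i, (i < 4)%N -> w i 0 = c i &
    forall i x, `|w i x| <= 2 * D * expR (K * `|x|)].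
Proof.
have [B0 H0] := sm_P sp0; have [B1 H1] := sm_P sp1; have [B2 H2] := sm_P sp2.
have N0 := le_trans (normr_ge0 _) (H0 0); have N1 := le_trans (normr_ge0 _) (H1 0).
have N2 := le_trans (normr_ge0 _) (H2 0).
pose Ca : R := 1 + B0 + B1 + B2.
have Ca0 : 0 <= Ca by rewrite /Ca; lra.
have cz (c : R) : continuous (fun _ : R => c) by move=> x; exact: cvg_cst.
have cA (i j : 'I_4) : continuous (amat i j).
  rewrite /amat; case: (nat_of_ord i == 3%N); last exact: cz.
  case: j => [[|[|[|[|j]]]]] /= _; [exact: sm_cont sp0|exact: sm_cont sp1|exact: sm_cont sp2|exact: cz|].
  exact: cz.
have AC (i j : 'I_4) x : `|amat i j x| <= Ca.
  rewrite /amat /Ca; case: (nat_of_ord i == 3%N); last by case: eqP => _; rewrite ?normr1 ?normr0; lra.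
  have := H0 x; have := H1 x; have := H2 x.
  by case: j => [[|[|[|[|j]]]]] /= _; rewrite ?nth_nil ?normr0; lra.
exists (ode_rate 4 Ca); split; first by rewrite /ode_rate addr_ge0// !mulr_ge0.
move=> h c D ch HD.
pose b (i : 'I_4) : R -> R := if val i == 3%N then h else fun=> 0.
have cb i : continuous (b i) by rewrite /b; case: (val i == 3%N) => //; exact: cz.
have HDb (i : 'I_4) x : `|c i + prim (b i) x| <= D.
  apply: le_trans (ler_normD _ _) _; apply: le_trans (HD i x); apply: lerD => //.
  rewrite /b; case: (val i == 3%N) => //.
  by rewrite /prim !Rintegral_cst// !mul0r subrr normr0.
have [y [dy y0 yD]] := @linear_ode R 4 (fun i j => amat i j) b (fun i => c i) Ca D cA cb Ca0 AC HDb.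
pose w n := y (inord n).
have dw n : (n < 4)%N -> isd (w n) (fun x => amat n 0 x * w 0%N x + (amat n 1 x * w 1%N x +
    (amat n 2 x * w 2%N x + amat n 3 x * w 3%N x)) + b (inord n) x).
  move=> n4; apply: isd_ext (dy (inord n)) _ _ => // x; congr (_ + _).
  rewrite inordK//; transitivity (\sum_(j < 4) amat n j x * w j x).
    by apply: eq_bigr => j _; rewrite /w inord_val.
  by rewrite !big_ord_recl big_ord0 addr0.
exists w; split.
- split.
  + by apply: isd_ext (dw 0%N isT) _ _ => // x; rewrite /amat /b /= inordK //=; ring.
  + by apply: isd_ext (dw 1%N isT) _ _ => // x; rewrite /amat /b /= inordK //=; ring.
  + by apply: isd_ext (dw 2%N isT) _ _ => // x; rewrite /amat /b /= inordK //=; ring.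
  + by apply: isd_ext (dw 3%N isT) _ _ => // x; rewrite /amat /b /= inordK //=; ring.
- by move=> i i4; rewrite /w y0 inordK.
- by move=> i x; exact: yD.
Qed.

(* Data of (d+k)(d+b1)w at r and of (d-k)(d-b2)w at -r: their vanishing means decay. *)
Definition ell w (i : 'I_4) : R :=
  match val i with
  | 0 => w 2%N r + (k + b1) * w 1%N r + k * b1 * w 0%N r
  | 1 => w 3%N r + (k + b1) * w 2%N r + k * b1 * w 1%N r
  | 2 => w 2%N (- r) - (k + b2) * w 1%N (- r) + k * b2 * w 0%N (- r)
  | _ => w 3%N (- r) - (k + b2) * w 2%N (- r) + k * b2 * w 1%N (- r)
  end.

Let rate : R := Num.min k (Num.min b1 b2) / 2.

Lemma rate_gt0 : 0 < rate.
Proof. by rewrite divr_gt0// !lt_min k0 b10 b20. Qed.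

Lemma sol_edec h w : (forall x, r <= `|x| -> h x = 0) -> sol h w -> (forall i, ell w i = 0) ->
  forall i, (i < 4)%N -> edec rate (w i).
Proof.
move=> hs sw el.
have := @el (Ordinal (isT : (0 < 4)%N)); have := @el (Ordinal (isT : (1 < 4)%N)).
have := @el (Ordinal (isT : (2 < 4)%N)); have := @el (Ordinal (isT : (3 < 4)%N)).
rewrite /ell /= => e3 e2 e1 e0.
apply: (decay_line k0 b10 b20 r0 sw) => // x xr.
  have x0 : 0 <= x by apply: le_trans xr; exact: ltW.
  have hx : h x = 0 by apply: hs; rewrite (ger0_norm x0).
  by have [-> -> ->] := pR xr; rewrite hx; ring.
have x0 : x <= 0 by apply: le_trans xr _; rewrite oppr_le0 ltW.
have hx : h x = 0 by apply: hs; rewrite (ler0_norm x0) lerNr.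
by have [-> -> ->] := pL xr; rewrite hx; ring.
Qed.

(** Bounded smooth coefficients times [w i] with i < 4, together with smooth decaying functions, are
    closed under differentiation up to sums: the fourth derivative is eliminated by the equation. *)
Lemma sol_smooth a h w : sm (edec a) h -> sol h w ->
  (forall i, (i < 4)%N -> edec a (w i)) -> sm (edec a) (w 0%N).
Proof.
move=> sh [d0 d1 d2 d3] ew.
pose F f := sm (edec a) f \/ exists (c : R -> R) i,
  [/\ sm (@bdd R) c, (i < 4)%N & f = fun x => c x * w i x].
apply: (@sm_lincomb _ (edec a) F); first exact: edecD; last first.
  right; exists (fun=> 1), 0%N; split=> //; last by apply/funext => x; rewrite mul1r.
  apply: (@sm_coind _ _ (fun u => exists c : R, u = fun=> c)); last by exists 1.
  move=> _ [c ->]; split; first exact: bddC.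
  by exists (fun=> 0); split; [exact: isdC|exists 0].
move=> f [sf|[c [i [sc i4 ->]]]].
  split; first exact: sm_P sf.
  by exists (derive1 f); split; [exact: sm_isd sf|apply: lc_in; left; exact: sm_der].
split; first by apply: edecM; [exact: sm_P sc|exact: ew].
have sc' := sm_der sc; have dc := sm_isd sc.
have T j (e : R -> R) : (j < 4)%N -> sm (@bdd R) e -> lincomb F (fun x => e x * w j x).
  by move=> j4 se; apply: lc_in; right; exists e, j.
have sM (e e' : R -> R) : sm (@bdd R) e -> sm (@bdd R) e' -> sm (@bdd R) (fun x => e x * e' x).
  by apply: smM; [exact: bddD|exact: bddM].
have step j wj : (j < 3)%N -> isd (w j) (w j.+1) -> wj = w j ->
    exists g, isd (fun x => c x * wj x) g /\ lincomb F g.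
  move=> j3 dj ->; exists (fun x => derive1 c x * w j x + c x * w j.+1 x); split.
    exact: isdM.
  by apply: lc_add; apply: T => //; exact: ltnW.
move: i4; case: i => [_|[_|[_|[_|//]]]].
- exact: (@step 0%N).
- exact: (@step 1%N).
- exact: (@step 2%N).
exists (fun x => derive1 c x * w 3%N x + c x *
  (p2 x * w 2%N x + p1 x * w 1%N x + p0 x * w 0%N x + h x)); split; first exact: isdM.
have -> : (fun x => derive1 c x * w 3%N x + c x *
  (p2 x * w 2%N x + p1 x * w 1%N x + p0 x * w 0%N x + h x)) =
  (fun x => derive1 c x * w 3%N x + ((c x * p2 x) * w 2%N x + ((c x * p1 x) * w 1%N x +
    ((c x * p0 x) * w 0%N x + c x * h x)))) by apply/funext => x; ring.
do 4 (apply: lc_add; first by apply: T => //; exact: sM).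
apply: lc_in; left; apply: (@smM _ _ (@bdd R) (edec a)) => //; first exact: edecD.
exact: edecM.
Qed.

Lemma isd_sum n (f f1 : 'I_n -> R -> R) (v : 'I_n -> R) : (forall j, isd (f j) (f1 j)) ->
  isd (fun x => \sum_j v j * f j x) (fun x => \sum_j v j * f1 j x).
Proof.
move=> H; elim: n f f1 v H => [|n IH] f f1 v H.
  by apply: isd_ext (isdC 0) _ _ => x; rewrite big_ord0.
apply: isd_ext (isdD (isdZ (v ord0) (H ord0)) (IH (fun j => f (lift ord0 j)) _ (fun j => v (lift ord0 j)) (fun j => H (lift ord0 j)))) _ _ => x;
by rewrite big_ord_recl.
Qed.

Lemma sol_comb h w (phi : 'I_4 -> nat -> R -> R) (v : 'I_4 -> R) : sol h w ->
  (forall j, sol (fun=> 0) (phi j)) -> sol h (fun n x => w n x + \sum_j v j * phi j n x).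
Proof.
move=> [d0 d1 d2 d3] H; split; try (apply: isdD => //; apply: isd_sum => j; by case: (H j)).
have d3' j : isd (phi j 3%N) (fun x => p2 x * phi j 2%N x + p1 x * phi j 1%N x + p0 x * phi j 0%N x + 0).
  by case: (H j).
apply: isd_ext (isdD d3 (isd_sum v d3')) _ _ => // x.
rewrite /= (_ : \sum_j v j * (p2 x * phi j 2%N x + p1 x * phi j 1%N x + p0 x * phi j 0%N x + 0) =
   p2 x * (\sum_j v j * phi j 2%N x) + p1 x * (\sum_j v j * phi j 1%N x) +
   p0 x * (\sum_j v j * phi j 0%N x)); first by ring.
by rewrite !mulr_sumr -!big_split /=; apply: eq_bigr => j _; ring.
Qed.

Lemma ell_comb w (phi : 'I_4 -> nat -> R -> R) (v : 'I_4 -> R) i :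
  ell (fun n x => w n x + \sum_j v j * phi j n x) i = ell w i + \sum_j v j * ell (phi j) i.
Proof.
by rewrite /ell; case: i => [[|[|[|i]]]] /= _; rewrite !big_ord_recl !big_ord0; ring.
Qed.

Lemma ell_bound w (E : R) i : 0 <= E -> (forall n x, `|x| <= r -> `|w n x| <= E) ->
  `|ell w i| <= (1 + (k + b1 + b2) + k * (b1 + b2)) * E.
Proof.
move=> E0 H.
have [hk [hb1 hb2]] := (k0, (b10, b20)).
have rr : `|r| <= r by rewrite gtr0_norm.
have rr' : `|- r| <= r by rewrite normrN gtr0_norm.
have T (u v1 v2 c d : R) : `|u| <= E -> `|v1| <= E -> `|v2| <= E -> 0 <= c -> 0 <= d ->
    `|u + c * v1 + d * v2| <= (1 + c + d) * E.
  move=> hu h1 h2 c0 d0.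
  apply: le_trans (ler_normD _ _) _; rewrite !mulrDl mul1r.
  rewrite normrM (ger0_norm d0); apply: lerD; last exact: ler_wpM2l.
  by apply: le_trans (ler_normD _ _) _; rewrite normrM (ger0_norm c0); apply: lerD => //; exact: ler_wpM2l.
have T' (u v1 v2 c d : R) : `|u| <= E -> `|v1| <= E -> `|v2| <= E -> 0 <= c -> 0 <= d ->
    `|u - c * v1 + d * v2| <= (1 + c + d) * E.
  by move=> hu h1 h2 c0 d0; rewrite -mulrN; apply: T => //; rewrite normrN.
have kb1 : 0 < k * b1 by rewrite mulr_gt0.
have kb2 : 0 < k * b2 by rewrite mulr_gt0.
have M1 : (1 + (k + b1) + k * b1) * E <= (1 + (k + b1 + b2) + k * (b1 + b2)) * E.
  by apply: ler_wpM2r => //; rewrite mulrDr; lra.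
have M2 : (1 + (k + b2) + k * b2) * E <= (1 + (k + b1 + b2) + k * (b1 + b2)) * E.
  by apply: ler_wpM2r => //; rewrite mulrDr; lra.
rewrite /ell; case: i => [[|[|[|i]]]] /= _.
- by apply: le_trans M1; apply: T; rewrite ?H ?(ltW kb1)//; lra.
- by apply: le_trans M1; apply: T; rewrite ?H ?(ltW kb1)//; lra.
- by apply: le_trans M2; apply: T'; rewrite ?H ?(ltW kb2)//; lra.
- by apply: le_trans M2; apply: T'; rewrite ?H ?(ltW kb2)//; lra.
Qed.

(** The primitive is nondecreasing, vanishes at 0 and has total variation 1, whatever the height of
    [h]. *)
Lemma prim_unit h x : continuous h -> (forall x, 0 <= h x) -> (forall x, r <= `|x| -> h x = 0) ->
  iR h = 1 -> `|prim h x| <= 1.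
Proof.
move=> ch h_ge0 hs h1.
have hr := r0; have dh := isd_prim ch.
have mono u v : u <= v -> prim h u <= prim h v by move=> uv; apply: (isd_le dh uv).
pose B : R := `|x| + r.
have := normr_ge0 x; have := ler_norm x; have := ler_norm (- x); rewrite normrN => l1 l2 l3.
have E : 1 = prim h B - prim h (- B).
  rewrite -h1; apply: iR_prim => //; rewrite /B; first lra.
  move=> y hy; apply: hs; rewrite leNgt; apply/negP => h2; apply: hy.
  by move: h2; rewrite ltr_norml; lra.
have m1 := mono (- B) 0 ltac:(rewrite /B; lra); have m2 := mono 0 B ltac:(rewrite /B; lra).
have m3 := mono (- B) x ltac:(rewrite /B; lra); have m4 := mono x B ltac:(rewrite /B; lra).
by rewrite prim0 in m1 m2; rewrite ler_norml; lra.
Qed.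

Lemma ode_alternative :
  (exists psi w, [/\ sm (edec rate) psi, exists x, psi x != 0, sol (fun=> 0) w & psi = w 0%N])
  \/ (exists W, forall h, sm (@csupp R) h -> (forall x, 0 <= h x) ->
        (forall x, r <= `|x| -> h x = 0) -> iR h = 1 ->
        exists w, [/\ sm (edec rate) (w 0%N), sol h w & forall x, `|x| <= r -> `|w 0%N x| <= W]).
Proof.
have [K [K0 HK]] := sol_exists.
have z0 : continuous (fun _ : R => 0 : R) by move=> x; exact: cvg_cst.
have /choice [phi Hphi] : forall j : 'I_4, exists w, [/\ sol (fun=> 0) w,
    forall i, (i < 4)%N -> w i 0 = (i == j)%:R & forall i x, `|w i x| <= 2 * 1 * expR (K * `|x|)].
  move=> j; apply: (HK _ (fun i => (i == j)%:R)) => // i x.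
  rewrite /prim !Rintegral_cst// !mul0r subrr normr0 addr0.
  by case: eqP => _; rewrite ?normr1 ?normr0.
have sphi j : sol (fun=> 0) (phi j) by case: (Hphi j).
(* Rows are indexed by the fundamental solutions [phi j], normalised by their data at 0, and columns
   by the four decay conditions. *)
pose N : 'M[R]_4 := \matrix_(j, i) ell (phi j) i.
have [|Nd] := boolP (\det N == 0).
  move=> /det0P [v v0 vN]; left.
  pose zw : nat -> R -> R := fun _ _ => 0.
  have szw : sol (fun=> 0) zw.
    split; rewrite /zw; try exact: isdC.
    by apply: isd_ext (isdC 0) _ _ => // x; ring.
  pose w n x := zw n x + \sum_j v 0 j * phi j n x.
  have sw : sol (fun=> 0) w := sol_comb (fun j => v 0 j) szw sphi.
  have ew i : ell w i = 0.
    rewrite /w ell_comb (_ : ell zw i = 0) ?add0r; last first.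
      by rewrite /ell /zw; case: i => [[|[|[|i]]]] /= _; ring.
    have := congr1 (fun A : 'rV[R]_4 => A 0 i) vN; rewrite !mxE => E.
    by rewrite -[RHS]E; apply: eq_bigr => j _; rewrite mxE.
  exists (w 0%N), w; split=> //.
    apply: (sol_smooth _ sw); last by apply: (sol_edec _ sw).
    apply: (@sm_coind _ _ (fun u => u = fun=> 0)) => // _ ->; split.
      by exists 0 => x; rewrite normr0 mul0r.
    by exists (fun=> 0); split=> //; exact: isdC.
  (* If [w 0] vanished identically, so would its derivatives and hence its data at 0; but these are
     the entries of the nonzero vector [v]. *)
  apply: contrapT => H.
  have w00 : w 0%N = fun=> 0.
    by apply/funext => x; apply/eqP; apply: contrapT => h; apply: H; exists x; exact/negP.
  have [d0 d1 d2 d3] := sw.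
  have w10 : w 1%N = fun=> 0 by rewrite -(isdE d0) w00 (isdE (isdC 0)).
  have w20 : w 2%N = fun=> 0 by rewrite -(isdE d1) w10 (isdE (isdC 0)).
  have w30 : w 3%N = fun=> 0 by rewrite -(isdE d2) w20 (isdE (isdC 0)).
  have W n : (n < 4)%N -> w n 0 = 0.
    by case: n => [_|[_|[_|[_|//]]]]; rewrite ?w00 ?w10 ?w20 ?w30.
  move/eqP: v0; apply; apply/rowP => i; rewrite mxE -(W i)// /w /zw add0r.
  rewrite (bigD1 i)//= big1 ?addr0 => [|j ji].
    by have [_ -> // _] := Hphi i; rewrite eqxx mulr1.
  have [_ -> // _] := Hphi j.
  by rewrite (_ : (val i == val j) = false) ?mulr0//; apply/negP => /eqP/val_inj ij; rewrite ij eqxx in ji.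
right.
pose E : R := 2 * 1 * expR (K * r).
have E0 : 0 <= E by rewrite /E !mulr_ge0 ?expR_ge0.
have bE w : (forall i x, `|w i x| <= 2 * 1 * expR (K * `|x|)) ->
    forall n x, `|x| <= r -> `|w n x| <= E.
  move=> H n x xr; apply: le_trans (H n x) _; rewrite /E ler_wpM2l// ler_expR.
  exact: ler_wpM2l.
pose M1 : R := (1 + (k + b1 + b2) + k * (b1 + b2)) * E.
exists (E + \sum_(j < 4) (\sum_(i < 4) M1 * `|invmx N i j|) * E) => h sh h_ge0 hs h1.
have ch := sm_cont sh.
(* With zero data at 0 and forcing of unit mass, [D = 1] is allowed, so this solution satisfies the
   same bound [E] as the fundamental ones. *)
have [w [sw w0 wb]] : exists w, [/\ sol h w, forall i, (i < 4)%N -> w i 0 = 0 &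
    forall i x, `|w i x| <= 2 * 1 * expR (K * `|x|)].
  by apply: (HK h (fun=> 0) 1) => // i x; rewrite normr0 add0r; exact: prim_unit.
pose l : 'rV[R]_4 := \row_i ell w i.
(* The homogeneous correction that cancels the four decay data of [w]; its size is bounded through
   the inverse of [N], independently of [h]. *)
pose v : 'rV[R]_4 := - (l *m invmx N).
have vN : v *m N = - l.
  by rewrite /v mulNmx -mulmxA mulVmx ?mulmx1// unitmxE unitfE.
have vb j : `|v 0 j| <= \sum_(i < 4) M1 * `|invmx N i j|.
  rewrite /v !mxE normrN; apply: le_trans (ler_norm_sum _ _ _) _.
  apply: ler_sum => i _; rewrite normrM mxE ler_wpM2r//.
  exact: ell_bound E0 (bE _ wb).
clearbody v.
have su := sol_comb (fun j => v 0 j) sw sphi.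
have eu i : ell (fun n x => w n x + \sum_j v 0 j * phi j n x) i = 0.
  rewrite ell_comb; have := congr1 (fun A : 'rV[R]_4 => A 0 i) vN; rewrite !mxE => E1.
  rewrite (_ : \sum_j v 0 j * ell (phi j) i = - ell w i) ?subrr// -[RHS]E1.
  by apply: eq_bigr => j _; rewrite mxE.
exists (fun n x => w n x + \sum_j v 0 j * phi j n x); split=> //.
- apply: (sol_smooth _ su); last by apply: (sol_edec _ su).
  by apply: sm_impl sh => u cu su'; apply: csupp_edec => //; exact/ltW/rate_gt0.
- move=> x xr; apply: le_trans (ler_normD _ _) _; apply: lerD; first exact: bE.
  apply: le_trans (ler_norm_sum _ _ _) _; apply: ler_sum => j _.
  rewrite normrM; apply: ler_pM => //.
  by apply: bE => // i y; have [_ _ ->] := Hphi j.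
Qed.

End Alternative.

(** * The variational problem *)

Section Minimizer.
Variable R : realType.
Notation mu := (@lebesgue_measure R).
Variables (rhob : R -> R) (g nu k mV mH s r c0 : R) (x0 : R).
Implicit Types (x a t q e d : R) (f u v : R -> R).
Hypotheses (g0 : 0 < g) (nu0 : 0 < nu) (k0 : 0 < k) (mV0 : 0 <= mV) (mH0 : 0 <= mH) (s0 : 0 < s).
Hypothesis (r0 : 0 < r).
Hypothesis rho_bdd : bdd rhob.
Hypothesis rho_der : forall x, derivable rhob x 1.
Hypothesis rho_test : test_fn (derive1 rhob).
Hypothesis rho_pos : forall x, c0 <= rhob x.
Hypothesis c00 : 0 < c0.
Hypothesis rho_x0 : 0 < derive1 rhob x0.
Hypothesis rho_supp : forall x, r <= `|x| -> derive1 rhob x = 0.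

Local Notation rho' := (derive1 rhob).

Lemma rho_smooth : sm (@bdd R) rhob.
Proof.
apply: sm_prim rho_bdd (isdP rho_der) _.
by apply: sm_impl (test_sm rho_test) => h ch sh; exact: csupp_bdd.
Qed.

Lemma sm_cst (a : R) : sm (@bdd R) (fun=> a).
Proof.
apply: (@sm_coind _ _ (fun u => exists c : R, u = fun=> c)); last by exists a.
move=> _ [c ->]; split; first exact: bddC.
by exists (fun=> 0); split; [exact: isdC|exists 0].
Qed.

Lemma sm_bddM (e e' : R -> R) : sm (@bdd R) e -> sm (@bdd R) e' -> sm (@bdd R) (fun x => e x * e' x).
Proof. by apply: smM; [exact: bddD|exact: bddM]. Qed.

Lemma sm_bddD (e e' : R -> R) : sm (@bdd R) e -> sm (@bdd R) e' -> sm (@bdd R) (fun x => e x + e' x).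
Proof. by apply: smD; exact: bddD. Qed.

(** Q(f) is the integral of A f''^2 + 2B f f'' + C f'^2 + D f^2. Its Euler-Lagrange equation is A
    w'''' = (C - 2B) w'' + C' w' - D w; [cp2], [cp1], [cp0] are its coefficients after division by
    A. *)
Definition cA : R := s * nu + mV.
Definition cB : R := s * nu * k ^+ 2.
Definition cC x : R := 4 * s * nu * k ^+ 2 + mV * k ^+ 2 + mH + s ^+ 2 * rhob x.
Definition cD x : R := s * nu * k ^+ 4 + mH * k ^+ 2 + s ^+ 2 * k ^+ 2 * rhob x
  + - (g * k ^+ 2) * rho' x.

Definition cp2 x : R := cA^-1 * (cC x + - (2 * cB)).
Definition cp1 x : R := cA^-1 * (s ^+ 2 * rho' x).
Definition cp0 x : R := - cA^-1 * cD x.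

Lemma cA_gt0 : 0 < cA.
Proof. by rewrite /cA ltr_pwDl// mulr_gt0. Qed.

Lemma sm_cC : sm (@bdd R) cC.
Proof.
exact: (sm_bddD (sm_cst (4 * s * nu * k ^+ 2 + mV * k ^+ 2 + mH))
  (sm_bddM (sm_cst (s ^+ 2)) rho_smooth)).
Qed.

Lemma sm_cD : sm (@bdd R) cD.
Proof.
exact: (sm_bddD (sm_bddD (sm_cst (s * nu * k ^+ 4 + mH * k ^+ 2))
  (sm_bddM (sm_cst (s ^+ 2 * k ^+ 2)) rho_smooth))
  (sm_bddM (sm_cst (- (g * k ^+ 2))) (sm_der rho_smooth))).
Qed.

Lemma isd_cC : isd cC (fun x => s ^+ 2 * rho' x).
Proof.
apply: isd_ext (isdD (isdC _) (isdZ (s ^+ 2) (isdP rho_der))) _ _ => x //=.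
by rewrite add0r.
Qed.

Lemma sm_cp2 : sm (@bdd R) cp2.
Proof. exact: (sm_bddM (sm_cst cA^-1) (sm_bddD sm_cC (sm_cst (- (2 * cB))))). Qed.

Lemma sm_cp1 : sm (@bdd R) cp1.
Proof.
exact: (sm_bddM (sm_cst cA^-1) (sm_bddM (sm_cst (s ^+ 2)) (sm_der rho_smooth))).
Qed.

Lemma sm_cp0 : sm (@bdd R) cp0.
Proof. exact: (sm_bddM (sm_cst (- cA^-1)) sm_cD). Qed.

(** Where the density is constant equal to [q], the characteristic polynomial factors as (X^2 -
    k^2)(X^2 - b^2) with this b. *)
Let b_ (q : R) : R := Num.sqrt (cA^-1 * (s * nu * k ^+ 2 + s ^+ 2 * q + mH)).

Let b_gt0 q : 0 < q -> 0 < b_ q.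
Proof.
move=> q0; rewrite sqrtr_gt0 mulr_gt0 ?invr_gt0 ?cA_gt0//.
by rewrite ltr_pwDl// addr_gt0 ?mulr_gt0// exprn_gt0.
Qed.

Let b_sq q : 0 < q -> b_ q ^+ 2 = cA^-1 * (s * nu * k ^+ 2 + s ^+ 2 * q + mH).
Proof.
move=> q0; rewrite sqr_sqrtr// mulr_ge0 ?invr_ge0 ?(ltW cA_gt0)//.
by rewrite addr_ge0 ?addr_ge0 ?mulr_ge0 ?sqr_ge0// ltW.
Qed.

Let coefE x q : 0 < q -> rhob x = q -> rho' x = 0 ->
  [/\ cp2 x = k ^+ 2 + b_ q ^+ 2, cp1 x = 0 & cp0 x = - (k ^+ 2 * b_ q ^+ 2)].
Proof.
move=> q0 rx r'x; rewrite b_sq// /cp2 /cp1 /cp0 /cC /cD rx r'x.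
have A0 : cA != 0 by rewrite gt_eqF// cA_gt0.
split; [|by ring|by ring].
apply: (mulfI A0); rewrite [RHS]mulrDr !mulVKf//.
by rewrite /cA /cB; ring.
Qed.

Let rhoR x : r <= x -> rhob x = rhob r.
Proof.
move=> rx; apply/esym; apply: (isd_cst (isdP rho_der) rx) => y /andP[ry _].
by apply: rho_supp; rewrite ger0_norm// (le_trans _ ry)// ltW.
Qed.

Let rhoL x : x <= - r -> rhob x = rhob (- r).
Proof.
move=> rx; apply: (isd_cst (isdP rho_der) rx) => y /andP[_ ry].
apply: rho_supp; have y0 : y <= 0 by apply: le_trans ry _; rewrite oppr_le0 ltW.
by rewrite ler0_norm// lerNr.
Qed.

Let rho_gt0 x : 0 < rhob x.
Proof. exact: lt_le_trans c00 (rho_pos x). Qed.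

Definition normal_sol := sol cp0 cp1 cp2.

(** Density of the symmetric bilinear form polar to Q. *)
Definition qb (u u1 u2 v v1 v2 : R -> R) x : R :=
  cA * (u2 x * v2 x) + cB * (u x * v2 x) + cB * (u2 x * v x) + cC x * (u1 x * v1 x) + cD x * (u x * v x).

Lemma qb_intg u u1 u2 v v1 v2 : L2R u -> L2R u1 -> L2R u2 -> L2R v -> L2R v1 -> L2R v2 ->
  intg (qb u u1 u2 v v1 v2).
Proof.
move=> Lu Lu1 Lu2 Lv Lv1 Lv2; rewrite /qb.
have I (c : R -> R) (a b : R -> R) : sm (@bdd R) c -> L2R a -> L2R b -> intg (fun x => c x * (a x * b x)).
  move=> sc La Lb; apply: intgMb; [exact: sm_P sc|exact: cont_meas (sm_cont sc)|exact: L2M].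
exact: (intgD (intgD (intgD (intgD (intgZ cA (L2M Lu2 Lv2)) (intgZ cB (L2M Lu Lv2)))
  (intgZ cB (L2M Lu2 Lv))) (I _ _ _ sm_cC Lu1 Lv1)) (I _ _ _ sm_cD Lu Lv)).
Qed.

(* [|xi|^2 E_0 + s E_1]: the vertical field is [mH = 0], the horizontal one [mV = 0]. *)
Definition energy (f f1 f2 : R -> R) : R := iR (fun x =>
  mV * (k ^+ 2 * f1 x ^+ 2 + f2 x ^+ 2) + mH * (k ^+ 2 * f x ^+ 2 + f1 x ^+ 2)
  - g * k ^+ 2 * (rho' x * f x ^+ 2)
  + s * nu * (4 * k ^+ 2 * f1 x ^+ 2 + (k ^+ 2 * f x + f2 x) ^+ 2)).
Definition mass (f f1 : R -> R) : R := iR (fun x => rhob x * (k ^+ 2 * f x ^+ 2 + f1 x ^+ 2)).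
Definition quad (f f1 f2 : R -> R) : R := iR (qb f f1 f2 f f1 f2).

Let bddMi (c f : R -> R) : sm (@bdd R) c -> L2R f -> intg (fun x => c x * f x ^+ 2).
Proof. by move=> sc Lf; apply: intgMb; [exact: sm_P sc|exact: cont_meas (sm_cont sc)|exact: L2_intg]. Qed.

Lemma mass_intg f f1 : L2R f -> L2R f1 -> intg (fun x => rhob x * (k ^+ 2 * f x ^+ 2 + f1 x ^+ 2)).
Proof.
move=> Lf Lf1; apply: intgMb; [exact: rho_bdd|exact: cont_meas (sm_cont rho_smooth)|].
by apply: intgD; [apply: intgZ; exact: L2_intg|exact: L2_intg].
Qed.

Lemma quadE f f1 f2 : L2R f -> L2R f1 -> L2R f2 ->
  quad f f1 f2 = energy f f1 f2 + s ^+ 2 * mass f f1.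
Proof.
move=> Lf Lf1 Lf2.
rewrite /quad /energy /mass -iRZ; last exact: mass_intg.
have Iq := qb_intg Lf Lf1 Lf2 Lf Lf1 Lf2.
have Im := intgZ (s ^+ 2) (mass_intg Lf Lf1).
rewrite -iRD //; last first.
  rewrite (_ : (fun x => _) = (fun x => qb f f1 f2 f f1 f2 x -
     s ^+ 2 * (rhob x * (k ^+ 2 * f x ^+ 2 + f1 x ^+ 2)))); first exact: intgB.
  by apply/funext => x; rewrite /qb /cA /cB /cC /cD; ring.
by congr iR; apply/funext => x; rewrite /qb /cA /cB /cC /cD; ring.
Qed.

Lemma quad_lin t f f1 f2 v v1 v2 : L2R f -> L2R f1 -> L2R f2 -> L2R v -> L2R v1 -> L2R v2 ->
  quad (fun x => f x + t * v x) (fun x => f1 x + t * v1 x) (fun x => f2 x + t * v2 x) =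
  quad f f1 f2 + 2 * t * iR (qb f f1 f2 v v1 v2) + t ^+ 2 * quad v v1 v2.
Proof.
move=> Lf Lf1 Lf2 Lv Lv1 Lv2.
rewrite /quad -iRZ; last exact: qb_intg.
rewrite -(iRZ (t ^+ 2)); last exact: qb_intg.
rewrite -iRD; [|exact: qb_intg|by apply: intgZ; exact: qb_intg].
rewrite -iRD; [|by apply: intgD; [|apply: intgZ]; exact: qb_intg|by apply: intgZ; exact: qb_intg].
by congr iR; apply/funext => x; rewrite /qb; ring.
Qed.

(** Weak form of the inhomogeneous equation: all derivatives move from [f] to the smooth [w]. The
    factor [cA] appears because the equation is normalised to leading coefficient 1. *)
Lemma quad_weak a f f1 f2 h w eta (Ce : R) : mollifier eta Ce -> 0 < a -> H2 f f1 f2 -> sm (edec a) (w 0%N) -> normal_sol h w ->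
  sm (edec a) h ->
  iR (qb f f1 f2 (w 0%N) (w 1%N) (w 2%N)) = cA * iR (fun x => f x * h x).
Proof.
move=> He a0 [Lf [Lf1 [Lf2 [wf wf1]]]] s_0 [d0 d1 d2 d3] sh.
have s1 : sm (edec a) (w 1%N) by rewrite -(isdE d0); exact: sm_der.
have s2 : sm (edec a) (w 2%N) by rewrite -(isdE d1); exact: sm_der.
have s3 : sm (edec a) (w 3%N) by rewrite -(isdE d2); exact: sm_der.
set w4 := (fun x => _ + h x) in d3.
have s4 : sm (edec a) w4 by rewrite -(isdE d3); exact: sm_der.
have L u : sm (edec a) u -> L2R u.
  by move=> Su; apply: (edec_L2 a0); [exact: cont_meas (sm_cont Su)|exact: sm_P Su].
have [L0 L1 L2 L3] := And4 (L _ s_0) (L _ s1) (L _ s2) (L _ s3); have L4 := L _ s4; have Lh := L _ sh.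
have sC1 : sm (edec a) (fun x => cC x * w 1%N x).
  by apply: (@smM _ _ (@bdd R) (edec a)) => //; [exact: edecD|exact: edecM|exact: sm_cC].
have e1 : iR (fun x => f2 x * w 2%N x) = iR (fun x => f x * w4 x).
  rewrite (weak_ibp He a0 Lf1 Lf2 wf1 s2) (isdE d2).
  by rewrite (weak_ibp He a0 Lf Lf1 wf s3) (isdE d3) opprK.
have e2 : iR (fun x => f2 x * w 0%N x) = iR (fun x => f x * w 2%N x).
  rewrite (weak_ibp He a0 Lf1 Lf2 wf1 s_0) (isdE d0).
  by rewrite (weak_ibp He a0 Lf Lf1 wf s1) (isdE d1) opprK.
have dC1 := isdM isd_cC d1.
have e3 : iR (fun x => cC x * (f1 x * w 1%N x)) =
    - iR (fun x => f x * (s ^+ 2 * rho' x * w 1%N x + cC x * w 2%N x)).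
  have := weak_ibp He a0 Lf Lf1 wf sC1; rewrite (isdE dC1) => <-.
  by congr iR; apply/funext => x; ring.
have LC := L _ (sm_der sC1); rewrite (isdE dC1) in LC.
have LD : L2R (fun x => cD x * w 0%N x).
  by apply: L2Mb => //; [exact: sm_P sm_cD|exact: cont_meas (sm_cont sm_cD)].
have IC : intg (fun x => cC x * (f1 x * w 1%N x)).
  by apply: intgMb; [exact: sm_P sm_cC|exact: cont_meas (sm_cont sm_cC)|exact: L2M].
have ID : intg (fun x => cD x * (f x * w 0%N x)).
  by apply: intgMb; [exact: sm_P sm_cD|exact: cont_meas (sm_cont sm_cD)|exact: L2M].
have I1 : intg (fun x => cA * (f2 x * w 2%N x)) by apply: intgZ; exact: L2M.
have I2 : intg (fun x => cB * (f x * w 2%N x)) by apply: intgZ; exact: L2M.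
have I3 : intg (fun x => cB * (f2 x * w 0%N x)) by apply: intgZ; exact: L2M.
have I12 := intgD I1 I2; have I123 := intgD I12 I3; have I4 := intgD I123 IC.
rewrite /qb !iRD// !iRZ; try exact: L2M.
rewrite e1 e2 e3 -!iRZ; try exact: L2M.
have J1 : intg (fun x => cA * (f x * w4 x)) by apply: intgZ; exact: L2M.
have J2 := intgD J1 I2; have J3 := intgD J2 I2; have J4 := intgB J3 (L2M Lf LC).
rewrite -(iRD J1 I2) -(iRD J2 I2) -(iRB J3 (L2M Lf LC)) -(iRD J4 ID).
congr iR; apply/funext => x.
rewrite /w4 /cp2 /cp1 /cp0.
have A0 : cA != 0 by rewrite gt_eqF// cA_gt0.
by field.
Qed.

(** The function u + max(v - u, 0) dominates [u] everywhere and equals [v] almost everywhere. *)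
Lemma ae_iR_le (u v : R -> R) : intg u -> intg v -> {ae mu, forall x, u x <= v x} -> iR u <= iR v.
Proof.
move=> Iu Iv H.
have mu_ := intg_meas Iu; have mv := intg_meas Iv.
pose m x := u x + Num.max (v x - u x) 0.
have mm : meas m.
  by apply: measurable_funD => //; apply: measurable_maxr => //; exact: measurable_funB.
have Im : intg m.
  apply: intg_dom (intgD (intgZ 2 (intg_norm Iu)) (intg_norm Iv)) _ => // x.
  rewrite /m; apply: le_trans (ler_normD _ _) _.
  have : `|Num.max (v x - u x) 0| <= `|v x| + `|u x|.
    rewrite ger0_norm ?le_max ?lexx ?orbT// ge_max addr_ge0// andbT.
    by apply: le_trans (ler_norm _) (ler_normB _ _).
  by lra.
rewrite -(@ae_iR _ m v)//.
  by apply: iR_le => // x; rewrite /m lerDl le_max lexx orbT.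
apply: filterS H; first exact: (ae_filter_ringOfSetsType mu).
by move=> x uv; rewrite /m max_l ?subr_ge0//; ring.
Qed.

(** With the next hypothesis: [- s ^+ 2] is the infimum of the energy on unit mass, which is the
    fixed-point equation for lambda(xi). *)
Hypothesis energy_ge : forall f f1 f2, H2 f f1 f2 -> mass f f1 = 1 -> - s ^+ 2 <= energy f f1 f2.
Hypothesis energy_inf : forall e, 0 < e -> exists f f1 f2,
  [/\ H2 f f1 f2, mass f f1 = 1 & energy f f1 f2 < - s ^+ 2 + e].

Let sup' : exists D : R, 0 < D /\ forall x, `|rho' x| <= D.
Proof.
have [D HD] := csupp_bdd (sm_cont (test_sm rho_test)) (sm_P (test_sm rho_test)).
exists (D + 1); split; first by have := le_trans (normr_ge0 _) (HD 0); lra.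
by move=> x; have := HD x; lra.
Qed.

(** Once gravity is added back, the difference of Q and s^2 J consists of magnetic and viscous
    squares. *)
Let quadP f f1 f2 : L2R f -> L2R f1 -> L2R f2 ->
  s ^+ 2 * mass f f1 <= quad f f1 f2 + g * k ^+ 2 * iR (fun x => rho' x * f x ^+ 2).
Proof.
move=> Lf Lf1 Lf2.
have Ir : intg (fun x => rho' x * f x ^+ 2) by apply: bddMi => //; exact: sm_der rho_smooth.
rewrite /quad /mass -!iRZ//; last exact: mass_intg.
rewrite -iRD; [|exact: qb_intg|exact: intgZ].
apply: iR_le; first by apply: intgZ; exact: mass_intg.
  by apply: intgD; [exact: qb_intg|exact: intgZ].
move=> x; rewrite -subr_ge0.
have -> : qb f f1 f2 f f1 f2 x + g * k ^+ 2 * (rho' x * f x ^+ 2) -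
  s ^+ 2 * (rhob x * (k ^+ 2 * f x ^+ 2 + f1 x ^+ 2)) =
  mV * (k ^+ 2 * f1 x ^+ 2 + f2 x ^+ 2) + mH * (k ^+ 2 * f x ^+ 2 + f1 x ^+ 2)
  + s * nu * (4 * k ^+ 2 * f1 x ^+ 2 + (k ^+ 2 * f x + f2 x) ^+ 2).
  by rewrite /qb /cA /cB /cC /cD; ring.
have K2 := sqr_ge0 k.
have K4 : 0 <= 4 * k ^+ 2 by rewrite mulr_ge0.
have P a b c : 0 <= c -> 0 <= c * a ^+ 2 + b ^+ 2.
  by move=> cge0; apply: addr_ge0; [apply: mulr_ge0 => //; exact: sqr_ge0|exact: sqr_ge0].
apply: addr_ge0; first by apply: addr_ge0; apply: mulr_ge0 => //; exact: P.
by apply: mulr_ge0; [rewrite mulr_ge0// ltW|exact: P].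
Qed.

Let mass_ge0 f f1 : 0 <= mass f f1.
Proof.
apply: iR_ge0 => x; rewrite mulr_ge0 ?(ltW (rho_gt0 x))//.
by apply: addr_ge0; [apply: mulr_ge0|]; exact: sqr_ge0.
Qed.

(** For positive mass, homogeneity reduces to unit mass. For zero mass, the gravity integral is at
    most a multiple of the mass, because the density is bounded below. *)
Lemma quad_ge0 f f1 f2 : H2 f f1 f2 -> 0 <= quad f f1 f2.
Proof.
move=> hf; have [Lf [Lf1 [Lf2 _]]] := hf.
have := mass_ge0 f f1; rewrite le_eqVlt => /predU1P[m0|m0].
  have := quadP Lf Lf1 Lf2; rewrite -m0 mulr0.
  have [D [D0 HD]] := sup'.
  have Ir : intg (fun x => rho' x * f x ^+ 2) by apply: bddMi => //; exact: sm_der rho_smooth.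
  have : iR (fun x => rho' x * f x ^+ 2) <= D / (c0 * k ^+ 2) * mass f f1.
    rewrite -iRZ; last exact: mass_intg.
    apply: iR_le => //; first by apply: intgZ; exact: mass_intg.
    move=> x; apply: (@le_trans _ _ (D * f x ^+ 2)).
      by rewrite ler_wpM2r ?sqr_ge0//; apply: le_trans (ler_norm _) (HD x).
    have ck : 0 < c0 * k ^+ 2 by rewrite mulr_gt0// exprn_gt0.
    have -> : D * f x ^+ 2 = D / (c0 * k ^+ 2) * (c0 * (k ^+ 2 * f x ^+ 2)).
      by field; rewrite !gt_eqF.
    rewrite ler_wpM2l ?divr_ge0 ?(ltW D0) ?(ltW ck)//.
    apply: ler_pM; [exact: ltW|by apply: mulr_ge0; exact: sqr_ge0|exact: rho_pos|].
    by rewrite lerDl sqr_ge0.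
  rewrite -m0 mulr0 => h1 h2.
  have : g * k ^+ 2 * iR (fun x => rho' x * f x ^+ 2) <= 0.
    by apply: mulr_ge0_le0 => //; rewrite mulr_ge0 ?sqr_ge0// ltW.
  by lra.
pose m := Num.sqrt (mass f f1).
have m_gt0 : 0 < m by rewrite sqrtr_gt0.
have m2 : m ^+ 2 = mass f f1 by rewrite sqr_sqrtr// ltW.
have Hz : H2 (fun=> 0 : R) (fun=> 0 : R) (fun=> 0 : R).
  have s0z : sm (edec (1:R)) (fun=> 0).
    apply: (@sm_coind _ _ (fun u => u = fun=> 0)) => // _ ->; split.
      by exists 0 => x; rewrite normr0 mul0r.
    by exists (fun=> 0); split=> //; exact: isdC.
  by have := smooth_H2 ltr01 s0z; rewrite !(isdE (isdC 0)).
(* The rescaled function is written as the combination [0 + m^-1 * f], so that the linearity lemmas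
   for [H2] and [quad] apply. *)
have Hh := H2_lin m^-1 Hz hf.
have [Lz [_ _]] := Hz.
have q1 := quad_lin m^-1 Lz Lz Lz Lf Lf1 Lf2.
have qz : quad (fun=> 0) (fun=> 0) (fun=> 0) = 0.
  rewrite /quad (_ : qb _ _ _ _ _ _ = fun=> 0 * 0%:R); last by apply/funext => x; rewrite /qb; ring.
  by rewrite iRZ ?mul0r//; have := L2_intg Lz; rewrite expr0n.
have qz' : iR (qb (fun=> 0) (fun=> 0) (fun=> 0) f f1 f2) = 0.
  rewrite (_ : qb _ _ _ _ _ _ = fun x => 0 * f x ^+ 2); last by apply/funext => x; rewrite /qb; ring.
  by rewrite iRZ ?mul0r//; exact: L2_intg.
rewrite qz qz' mulr0 !add0r in q1.
have [Lh [Lh1 [Lh2 _]]] := Hh.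
have mh : mass (fun x => 0 + m^-1 * f x) (fun x => 0 + m^-1 * f1 x) = 1.
  rewrite -[RHS](@mulVf _ (m ^+ 2)) ?expf_neq0 ?gt_eqF// [in RHS]m2 -iRZ; last exact: mass_intg.
  congr iR; apply/funext => x; rewrite -m2; field.
  by rewrite gt_eqF.
have h := energy_ge Hh mh.
have := quadE Lh Lh1 Lh2; rewrite q1 mh mulr1 => E.
have : 0 <= m^-1 ^+ 2 * quad f f1 f2 by rewrite E; lra.
by rewrite pmulr_rge0// exprn_gt0// invr_gt0.
Qed.

(* If the ODE were solvable for all bumps, testing the weak equation with the solution w
   would give (int f h)^2 <= C Q(f), hence f^2 <= C Q(f) at Lebesgue points of f. *)
Let decaying_solution : exists psi w, [/\ sm (edec (Num.min k (Num.min (b_ (rhob r)) (b_ (rhob (- r)))) / 2)) psi,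
    exists x, psi x != 0, normal_sol (fun=> 0) w & psi = w 0%N].
Proof.
have hr := r0; have hc := c00; have hs := s0; have hg := g0; have hk := k0.
apply: contrapT => Hno.
have coR x (rx : r <= x) := coefE (rho_gt0 r) (rhoR rx) (rho_supp (le_trans rx (ler_norm x))).
have hL x : x <= - r -> r <= `|x|.
  by rewrite lerNr => rx; apply: le_trans rx _; rewrite -normrN ler_norm.
have coL x (rx : x <= - r) := coefE (rho_gt0 (- r)) (rhoL rx) (rho_supp (hL x rx)).
have [Hyes|[W HW]] := ode_alternative sm_cp0 sm_cp1 sm_cp2 k0 (b_gt0 (rho_gt0 r)) (b_gt0 (rho_gt0 (- r))) r0
  coR coL.
  exact: Hno Hyes.
have [eta [Ce He]] := mollifier_exists rho_test rho_x0.
set a : R := _ / 2 in HW Hno.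
have a0 : 0 < a by rewrite divr_gt0// !lt_min k0 !b_gt0.
(* Nothing is known about the sign of [W], and a positive bound is divided by below. *)
pose W' : R := `|W| + 1.
have W'0 : 0 < W' by rewrite /W' ltr_wpDl.
have hA := cA_gt0.
have key h f f1 f2 : sm (@csupp R) h -> (forall x, 0 <= h x) ->
   (forall x, r <= `|x| -> h x = 0) -> iR h = 1 -> H2 f f1 f2 ->
   iR (fun x => f x * h x) ^+ 2 <= W' / cA * quad f f1 f2.
  move=> sh h0 hsu h1 hf; have [w [sw nw wb]] := HW h sh h0 hsu h1.
  have [Lf [Lf1 [Lf2 _]]] := hf.
  have she : sm (edec a) h.
    by apply: sm_impl sh => u cu su; apply: csupp_edec => //; exact: ltW.
  have hw : H2 (w 0%N) (w 1%N) (w 2%N).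
    by have [d0 d1 _ _] := nw; have := smooth_H2 a0 sw; rewrite (isdE d0) (isdE d1).
  have [Lw [Lw1 [Lw2 _]]] := hw.
  have Efw := quad_weak He a0 hf sw nw she.
  have Eww := quad_weak He a0 hw sw nw she; rewrite -/(quad _ _ _) in Eww.
  have Lh : L2R h by apply: csupp_L2; [exact: sm_cont sh|exact: sm_P sh].
  have Ih : intg h by apply: csupp_intg; [exact: sm_cont sh|exact: sm_P sh].
  have wh : iR (fun x => w 0%N x * h x) <= W'.
    rewrite -[W']mulr1 -h1 -iRZ//; apply: iR_le; [exact: L2M|exact: intgZ|].
    move=> x; have [xr|xr] := leP `|x| r; last by rewrite hsu ?mulr0// ltW.
    rewrite ler_wpM2r//; apply: le_trans (ler_norm _) _; apply: le_trans (wb x xr) _.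
    by rewrite /W'; have := ler_norm W; lra.
  set I := iR (fun x => f x * h x) in Efw *.
  (* The minimiser of q + 2t A I + t^2 A W', the upper bound for Q(f + t w) once Q(w) = A int w h is
     estimated by A W'. *)
  pose t : R := - I / W'.
  have := quad_ge0 (H2_lin t hf hw).
  rewrite (quad_lin t Lf Lf1 Lf2 Lw Lw1 Lw2) Efw Eww.
  set q := quad f f1 f2 => hq.
  have h2 : t ^+ 2 * (cA * iR (fun x => w 0%N x * h x)) <= t ^+ 2 * (cA * W').
    by rewrite ler_wpM2l ?sqr_ge0// ler_wpM2l// ltW.
  have h3 : 0 <= q - cA / W' * I ^+ 2.
    have -> : q - cA / W' * I ^+ 2 = q + 2 * t * (cA * I) + t ^+ 2 * (cA * W').
      by rewrite /t; field; rewrite gt_eqF.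
    by lra.
  have -> : I ^+ 2 = W' / cA * (cA / W' * I ^+ 2) by field; rewrite !gt_eqF.
  by rewrite ler_wpM2l ?divr_ge0 ?(ltW W'0) ?(ltW hA)//; lra.
have ptw f f1 f2 : H2 f f1 f2 ->
   {ae mu, forall x, `|x| < r -> f x ^+ 2 <= W' / cA * quad f f1 f2}.
  move=> hf; have [Lf _] := hf.
  have lf := L2_locally_integrable Lf.
  have := lebesgue_differentiation lf; apply: filterS; first exact: (ae_filter_ringOfSetsType mu).
  move=> x Hx xr.
  have B0 : 0 <= W' / cA * quad f f1 f2.
    by rewrite mulr_ge0 ?quad_ge0// ?divr_ge0 ?(ltW W'0) ?(ltW hA).
  have bn : `|f x| <= Num.sqrt (W' / cA * quad f f1 f2).
    apply/ler_addgt0Pr => d d0.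
    have [e0 [e00 Hd]] := moll_lebesgue He Lf Hx d0.
    (* The bump must be narrow enough for the Lebesgue point and keep its support inside [-r, r]. *)
    pose e : R := Num.min e0 (r - `|x|) / 2.
    have e_gt0 : 0 < e by rewrite divr_gt0// lt_min e00 subr_gt0.
    have ee0 : e < e0.
      by rewrite ltr_pdivrMr// (le_lt_trans (y := e0)) ?ge_min ?lexx// ltr_pMr// ltr1n.
    have er : e <= r - `|x|.
      rewrite ler_pdivrMr// (le_trans (y := r - `|x|)) ?ge_min ?lexx ?orbT// ler_peMr ?ler1n//.
      by rewrite subr_ge0 ltW.
    have [Se ge i1 se] := He x e e_gt0.
    have := key (eta x e) f f1 f2 Se (fun y => (andP (ge y)).1) _ i1 hf.
    move=> /(_ _)/wrap[y ry|hk2].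
      apply: se; have := lerB_dist y x; lra.
    have h1 := Hd e ltac:(by rewrite e_gt0 ee0).
    have h2 : `|iR (fun y => f y * eta x e y)| <= Num.sqrt (W' / cA * quad f f1 f2).
      by rewrite -sqrtr_sqr ler_wsqrtr.
    rewrite -[f x](subrK (iR (fun y => f y * eta x e y))); apply: le_trans (ler_normD _ _) _.
    rewrite distrC in h1; lra.
  rewrite -real_normK ?num_real// -[leRHS]sqr_sqrtr//.
  by apply: lerXn2r => //; rewrite nnegrE ?sqrtr_ge0.
have [D [D0 HD]] := sup'.
(* Gravity coefficient times the bound of rho', the pointwise constant for f^2, and the length 2r of
   the interval carrying rho'. *)
pose C : R := g * k ^+ 2 * (D * (W' / cA) * (2 * r)).
have WA : 0 <= W' / cA by apply: divr_ge0; exact: ltW.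
have GK : 0 <= g * k ^+ 2 by apply: mulr_ge0; [exact: ltW|exact: sqr_ge0].
have C0 : 0 <= C.
  rewrite /C; apply: mulr_ge0 => //; apply: mulr_ge0; first by apply: mulr_ge0 => //; exact: ltW.
  by apply: mulr_ge0 => //; exact: ltW.
have coer f f1 f2 : H2 f f1 f2 -> s ^+ 2 * mass f f1 <= (1 + C) * quad f f1 f2.
  move=> hf; have [Lf [Lf1 [Lf2 _]]] := hf.
  apply: le_trans (quadP Lf Lf1 Lf2) _; rewrite mulrDl mul1r lerD2l.
  rewrite /C -(mulrA (g * k ^+ 2)); apply: ler_wpM2l => //.
  have Iind : intg (fun x => D * (W' / cA * quad f f1 f2) * \1_(`[- r, r]%classic) x).
    by apply: intgZ; exact: integrable_indic_itv.
  have -> : D * (W' / cA) * (2 * r) * quad f f1 f2 =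
      iR (fun x => D * (W' / cA * quad f f1 f2) * \1_(`[- r, r]%classic) x).
    rewrite iRZ; last exact: integrable_indic_itv.
    rewrite /iR /IntR integral_indic// setIT.
    rewrite [X in fine X](lebesgue_measure_itv `[- r, r]) /=.
    by rewrite lte_fin ifT -?EFinB /=; [ring|lra].
  apply: ae_iR_le => //; first by apply: bddMi => //; exact: sm_der rho_smooth.
  have := ptw _ _ _ hf; apply: filterS; first exact: (ae_filter_ringOfSetsType mu).
  move=> x Hx; rewrite indicE.
  have [xr|xr] := ltP `|x| r; last first.
    rewrite rho_supp// mul0r mulr_ge0// mulr_ge0 ?(ltW D0)//.
    by rewrite mulr_ge0 ?quad_ge0// ?divr_ge0 ?(ltW W'0) ?(ltW hA).
  rewrite mem_set ?mulr1; last first.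
    by rewrite /= in_itv /= -ler_norml ltW.
  apply: (@le_trans _ _ (D * f x ^+ 2)).
    by rewrite ler_wpM2r ?sqr_ge0//; apply: le_trans (ler_norm _) (HD x).
  by rewrite ler_wpM2l ?(ltW D0) ?Hx.
have C1 : 0 < 1 + C by lra.
(* This tolerance makes Q(f) less than s^2 / (1 + C), while coercivity at unit mass requires at
   least that much. *)
have [f [f1 [f2 [hf m1 hE]]]] := energy_inf (e := s ^+ 2 / (1 + C)) ltac:(by rewrite divr_gt0 ?exprn_gt0).
have [Lf [Lf1 [Lf2 _]]] := hf.
have := coer _ _ _ hf; rewrite (quadE Lf Lf1 Lf2) m1 !mulr1 => h.
have h' : s ^+ 2 / (1 + C) <= energy f f1 f2 + s ^+ 2.
  by rewrite ler_pdivrMr// mulrC.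
by lra.
Qed.

Lemma minimizer_exists : exists a psi w, 0 < a /\ [/\ sm (edec a) psi,
   exists x, psi x != 0, normal_sol (fun=> 0) w & psi = w 0%N].
Proof.
have [psi [w Hw]] := decaying_solution.
exists (Num.min k (Num.min (b_ (rhob r)) (b_ (rhob (- r)))) / 2), psi, w; split=> //.
by rewrite divr_gt0// !lt_min k0 !b_gt0.
Qed.

End Minimizer.

(** * The growth rate as a fixed point *)

Section FixedPoint.
Variable R : realType.
Implicit Types (s t u v e : R).
Variables (S : set (R * R)) (C0 : R).
Hypothesis S_ge : forall p, S p -> - C0 <= p.1 /\ 0 <= p.2.
Hypothesis S_neg : exists p, S p /\ p.1 < 0.

(** With p.1 = |xi|^2 E_0 and p.2 = E_1 this is alpha(xi, s): an infimum of affine functions of [s]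
    with nonnegative slopes and intercepts bounded below. *)
Definition lower_env s : R := inf [set p.1 + s * p.2 | p in S].

Let lb s : 0 <= s -> lbound [set p.1 + s * p.2 | p in S] (- C0).
Proof.
move=> s0 _ [p Sp <-]; have [h1 h2] := S_ge Sp.
by have := mulr_ge0 s0 h2; lra.
Qed.

Let ne s : [set p.1 + s * p.2 | p in S] !=set0.
Proof. by have [p [Sp _]] := S_neg; exists (p.1 + s * p.2); exists p. Qed.

Lemma lower_env_le s p : 0 <= s -> S p -> lower_env s <= p.1 + s * p.2.
Proof. by move=> s0 Sp; apply: ge_inf; [exists (- C0); exact: lb|exists p]. Qed.

Lemma lower_env_ge s : 0 <= s -> - C0 <= lower_env s.
Proof. by move=> s0; apply: lb_le_inf; [exact: ne|exact: lb]. Qed.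

Lemma lower_env_near s e : 0 <= s -> 0 < e -> exists p, S p /\ p.1 + s * p.2 < lower_env s + e.
Proof.
move=> s0 e0.
have hi : has_inf [set p.1 + s * p.2 | p in S] by split; [exact: ne|exists (- C0); exact: lb].
by have [_ [p Sp <-] h] := inf_adherent e0 hi; exists p.
Qed.

Lemma lower_envE s : 0 <= s ->
  ereal_inf [set x | exists p, S p /\ x = (p.1 + s * p.2)%:E] = (lower_env s)%:E.
Proof.
move=> s0; rewrite -ereal_inf_EFin; [|by exists (- C0); exact: lb|exact: ne].
congr ereal_inf; apply/seteqP; split => [_ [p [Sp ->]]|_ [_ [p Sp <-] <-]].
  by exists (p.1 + s * p.2) => //; exists p.
by exists p.
Qed.

Lemma lower_env_mono s t : 0 <= s -> s <= t -> lower_env s <= lower_env t.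
Proof.
move=> s0 st; apply: lb_le_inf; first exact: ne.
move=> _ [p Sp <-]; apply: le_trans (lower_env_le s0 Sp) _.
by have [_ h2] := S_ge Sp; rewrite lerD2l ler_wpM2r.
Qed.

(* A near-minimiser at [s] controls its own slope, because the intercepts are bounded below. *)
Lemma lower_env_lip s t : 0 < s -> s <= t ->
  lower_env t <= lower_env s + (t - s) * ((lower_env s + C0) / s).
Proof.
move=> s0 st; apply/ler_addgt0Pr => e e0.
have t0 : 0 < t by apply: lt_le_trans s0 st.
(* The error [d] at [s] becomes d + (t - s) d / s = d t / s at [t], which is to equal [e]. *)
pose d : R := e * s / t.
have d0 : 0 < d by rewrite /d divr_gt0// mulr_gt0.
have [p [Sp h]] := lower_env_near (ltW s0) d0.
have h1 := lower_env_le (ltW t0) Sp.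
have [h2 h3] := S_ge Sp.
have B : p.2 <= (lower_env s + C0 + d) / s by rewrite ler_pdivlMr//; lra.
apply: le_trans h1 _.
have : (t - s) * p.2 <= (t - s) * ((lower_env s + C0 + d) / s) by rewrite ler_wpM2l// subr_ge0.
have -> : (t - s) * ((lower_env s + C0 + d) / s) =
   (t - s) * ((lower_env s + C0) / s) + (e - d).
  by rewrite /d; field; rewrite !gt_eqF.
lra.
Qed.

Lemma lower_env_cont s : 0 < s -> {for s, continuous lower_env}.
Proof.
move=> s0; apply/cvgrPdist_lt => e e0.
(* Bounds the slopes of the previous lemma on [s/2, 2s]: numerator at its largest, denominator at
   its smallest. *)
pose K : R := (lower_env (2 * s) + C0) / (s / 2) + 1.
have K0 : 0 < K.
  rewrite /K ltr_wpDl// divr_ge0//; last lra.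
  by have := @lower_env_ge (2 * s); lra.
have L u v : s / 2 <= u -> u <= v -> v <= 2 * s -> `|lower_env u - lower_env v| <= (v - u) * K.
  move=> hu uv hv; have u0 : 0 < u by lra.
  have m := lower_env_mono (ltW u0) uv; rewrite distrC ger0_norm ?subr_ge0//.
  have := lower_env_lip u0 uv.
  have : (v - u) * ((lower_env u + C0) / u) <= (v - u) * K.
    rewrite ler_wpM2l ?subr_ge0//; rewrite /K.
    have : (lower_env u + C0) / u <= (lower_env (2 * s) + C0) / (s / 2).
      apply: ler_pM.
      - by have := lower_env_ge (ltW u0); lra.
      - by rewrite invr_ge0 ltW.
      - by rewrite lerD2r; apply: lower_env_mono; lra.
      - by rewrite lef_pV2// posrE; lra.
    lra.
  lra.
near=> t.
have ht : `|s - t| < e / K.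
  near: t; have /cvgrPdist_lt := @cvg_id _ (nbhs s); apply; exact: divr_gt0.
have ht2 : `|s - t| < s / 2.
  near: t; have /cvgrPdist_lt := @cvg_id _ (nbhs s); apply; lra.
have htK : `|s - t| * K < e by rewrite -ltr_pdivlMr.
have [st|ts] := leP s t.
  have h : `|s - t| = t - s by rewrite distrC ger0_norm// subr_ge0.
  rewrite h in ht2 htK; apply: le_lt_trans (L s t _ st _) htK; lra.
have h : `|s - t| = s - t by rewrite gtr0_norm// subr_gt0.
rewrite h in ht2 htK; rewrite distrC; apply: le_lt_trans (L t s _ (ltW ts) _) htK; lra.
Unshelve. all: by end_near. Qed.

(** Intermediate value theorem for s^2 + alpha(s). The margin [d] beyond the fixed point is what
    later makes [s] strictly smaller than the supremum [Sfrak]. *)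
Lemma fixed_point : exists s, [/\ 0 < s, lower_env s = - s ^+ 2 &
  exists d, 0 < d /\ forall t, 0 < t < s + d -> lower_env t < 0].
Proof.
have [p [Sp p0]] := S_neg; have [h1 h2] := S_ge Sp.
(* So small that s0^2 <= s0 and s0 (1 + p.2) <= - p.1 / 2, which makes s0^2 + p.1 + s0 p.2
   negative. *)
pose s0 : R := Num.min 1 (- p.1 / (2 * (p.2 + 1))).
have q0 : 0 < - p.1 / (2 * (p.2 + 1)) by rewrite divr_gt0//; lra.
have s00 : 0 < s0 by rewrite lt_min ltr01 q0.
have s01 : s0 <= 1 by rewrite ge_min lexx.
have s0q : s0 * (2 * (p.2 + 1)) <= - p.1.
  rewrite -ler_pdivlMr; last lra.
  by rewrite ge_min lexx orbT.
have e0 : s0 ^+ 2 + lower_env s0 <= 0.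
  have := lower_env_le (ltW s00) Sp.
  have : s0 ^+ 2 <= s0 by rewrite expr2 ler_piMl// ltW.
  lra.
(* Beyond 1 and beyond [C0], so that s1^2 >= s1 outweighs the lower bound [- C0]. *)
pose s1 : R := s0 + `|C0| + 1.
have C00 := normr_ge0 C0; have C01 := ler_norm C0.
have s1_ge : s0 <= s1 by rewrite /s1; lra.
have e1 : 0 <= s1 ^+ 2 + lower_env s1.
  have h3 : 0 <= s1 by rewrite /s1; lra.
  have := lower_env_ge h3.
  have h4 : `|C0| + 1 <= s1 by rewrite /s1; lra.
  have : s1 <= s1 ^+ 2 by rewrite expr2 ler_peMl//; lra.
  lra.
have cF : {within `[s0, s1], continuous (fun s => s ^+ 2 + lower_env s)}.
  apply: continuous_in_subspaceT => s; rewrite inE /= in_itv /= => /andP[hs _].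
  apply: cvgD; first by apply: cvgM; exact: cvg_id.
  by apply: lower_env_cont; lra.
have [|s /[!in_itv] /= /andP[hs hs'] E] := @IVT _ _ _ _ 0 s1_ge cF.
  by rewrite ge_min e0 le_max e1 orbT.
have sp : 0 < s by lra.
have E' : lower_env s = - s ^+ 2 by lra.
exists s; split=> //.
have s2 : 0 < s ^+ 2 by rewrite exprn_gt0.
(* Starting from [- s ^+ 2] and rising at rate at most [K], the envelope stays negative up to s +
   s^2 / K. *)
pose K : R := `|(lower_env s + C0) / s| + 1.
have K0 : 0 < K by rewrite /K ltr_wpDl.
exists (s ^+ 2 / K); split; first by rewrite divr_gt0.
move=> t /andP[t0 ts]; have [ts'|st] := leP t s.
  by have := lower_env_mono (ltW t0) ts'; lra.
have := lower_env_lip sp (ltW st).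
have : (t - s) * ((lower_env s + C0) / s) < s ^+ 2.
  have h : t - s < s ^+ 2 / K by lra.
  rewrite ltr_pdivlMr// in h; apply: le_lt_trans h.
  rewrite ler_wpM2l//; first lra.
  by rewrite /K; have := ler_norm ((lower_env s + C0) / s); lra.
lra.
Qed.

End FixedPoint.

(** * The dispersion relation for both field orientations *)

Section Spectral.
Variable R : realType.
Implicit Types (s t x : R) (f : R -> R).
Variables (g nu c0 D : R) (rhob : R -> R) (c : Mcase) (M : R) (xi : R * R).
Local Notation rho' := (derive1 rhob).
Local Notation k := (xnorm xi).
Hypotheses (g_gt0 : 0 < g) (nu_gt0 : 0 < nu) (c0_gt0 : 0 < c0) (k_gt0 : 0 < k).
Hypothesis rho_bdd : bdd rhob.
Hypothesis rho_der : forall x, derivable rhob x 1.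
Hypothesis rho_test : test_fn rho'.
Hypothesis rho_pos : forall x, c0 <= rhob x.
Hypothesis rho'_le : forall x, `|rho' x| <= D.

Definition mVert : R := if c is Vertical then M ^+ 2 else 0.
Definition mHor : R := if c is Vertical then 0 else M ^+ 2 * xi.1 ^+ 2.

Lemma mVert_ge0 : 0 <= mVert.
Proof. by rewrite /mVert; case: c => //; exact: sqr_ge0. Qed.

Lemma mHor_ge0 : 0 <= mHor.
Proof. by rewrite /mHor; case: c => //; apply: mulr_ge0; exact: sqr_ge0. Qed.

Local Notation nrg := (energy rhob g nu k mVert mHor).

Lemma rho'_sm : sm (@bdd R) rho'.
Proof. exact: sm_der (rho_smooth rho_bdd rho_der rho_test). Qed.

Let I_ (f : R -> R) : L2R f -> intg (fun x => rho' x * f x ^+ 2).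
Proof.
move=> Lf; apply: intgMb; [exact: sm_P rho'_sm|exact: cont_meas (sm_cont rho'_sm)|].
exact: L2_intg.
Qed.

Lemma E1_intg f f1 f2 : L2R f -> L2R f1 -> L2R f2 ->
  intg (fun x => 4 * k ^+ 2 * f1 x ^+ 2 + (k ^+ 2 * f x + f2 x) ^+ 2).
Proof.
move=> Lf Lf1 Lf2; apply: intgD; first by apply: intgZ; exact: L2_intg.
exact: (L2_intg (L2D (L2Z (k ^+ 2) Lf) Lf2)).
Qed.

Lemma energyE s f f1 f2 : L2R f -> L2R f1 -> L2R f2 ->
  nrg s f f1 f2 = k ^+ 2 * E0 g rhob c M xi f f1 f2 + s * E1 nu xi f f1 f2.
Proof.
move=> Lf Lf1 Lf2; rewrite /energy /E1 (mulrA s) -(iRZ (s * nu)); last exact: E1_intg.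
have Is := intgZ (s * nu) (E1_intg Lf Lf1 Lf2).
have kn : k != 0 by rewrite gt_eqF.
have [S0 [S1 S2]] := (L2_intg Lf, (L2_intg Lf1, L2_intg Lf2)).
rewrite /E0 /mVert /mHor /drhob; case: c.
- have I : intg (fun x => M ^+ 2 * xi.1 ^+ 2 * (f x ^+ 2 + f1 x ^+ 2 / k ^+ 2) - g * rho' x * f x ^+ 2).
    have := intgB (intgD (intgZ (M ^+ 2 * xi.1 ^+ 2) S0) (intgZ (M ^+ 2 * xi.1 ^+ 2 / k ^+ 2) S1)) (intgZ g (I_ Lf)).
    by congr (intg _); apply/funext => x; field.
  rewrite -iRZ// -iRD//; last exact: intgZ.
  by congr iR; apply/funext => x; field.
- have I : intg (fun x => M ^+ 2 * (f1 x ^+ 2 + f2 x ^+ 2 / k ^+ 2) - g * rho' x * f x ^+ 2).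
    have := intgB (intgD (intgZ (M ^+ 2) S1) (intgZ (M ^+ 2 / k ^+ 2) S2)) (intgZ g (I_ Lf)).
    by congr (intg _); apply/funext => x; field.
  rewrite -iRZ// -iRD//; last exact: intgZ.
  by congr iR; apply/funext => x; field.
Qed.

Lemma E1_ge0 f f1 f2 : 0 <= E1 nu xi f f1 f2.
Proof.
rewrite /E1; apply: mulr_ge0; first exact: ltW.
apply: iR_ge0 => x; apply: addr_ge0; last exact: sqr_ge0.
by apply: mulr_ge0; [apply: mulr_ge0 => //|]; exact: sqr_ge0.
Qed.

Let D_ge0 : 0 <= D.
Proof. exact: le_trans (normr_ge0 _) (rho'_le 0). Qed.

(** Gravity is the only negative contribution, and its density is at most g D / c0 times that of the
    mass. The constant does not depend on xi, which later bounds Lambda. *)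
Lemma energy0_ge f f1 f2 : L2R f -> L2R f1 -> L2R f2 ->
  - (g * D / c0) * mass rhob k f f1 <= nrg 0 f f1 f2.
Proof.
move=> Lf Lf1 Lf2.
have Im := mass_intg k rho_bdd rho_der rho_test Lf Lf1.
have [S0 [S1 S2]] := (L2_intg Lf, (L2_intg Lf1, L2_intg Lf2)).
rewrite /mass -iRZ// /energy; apply: iR_le; first exact: intgZ.
  have := intgB (intgD (intgD (intgZ (mVert * k ^+ 2) S1) (intgZ mVert S2))
    (intgD (intgZ (mHor * k ^+ 2) S0) (intgZ mHor S1))) (intgZ (g * k ^+ 2) (I_ Lf)).
  by congr (intg _); apply/funext => x; ring.
move=> x; have hV := mVert_ge0; have hH := mHor_ge0; have hg := g_gt0; have hD := D_ge0.
have K2 := sqr_ge0 k; have hc := c0_gt0.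
have Q0 := sqr_ge0 (f x); have Q1 := sqr_ge0 (f1 x); have Q2 := sqr_ge0 (f2 x).
have P1 : 0 <= mVert * (k ^+ 2 * f1 x ^+ 2 + f2 x ^+ 2).
  by apply: mulr_ge0 => //; apply: addr_ge0 => //; apply: mulr_ge0.
have P2 : 0 <= mHor * (k ^+ 2 * f x ^+ 2 + f1 x ^+ 2).
  by apply: mulr_ge0 => //; apply: addr_ge0 => //; apply: mulr_ge0.
have P3 : g * k ^+ 2 * (rho' x * f x ^+ 2) <= g * k ^+ 2 * (D * f x ^+ 2).
  apply: ler_wpM2l; first by apply: mulr_ge0 => //; exact: ltW.
  by apply: ler_wpM2r => //; apply: le_trans (ler_norm _) (rho'_le x).
have P4 : g * D / c0 * (c0 * (k ^+ 2 * f x ^+ 2)) <=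
    g * D / c0 * (rhob x * (k ^+ 2 * f x ^+ 2 + f1 x ^+ 2)).
  apply: ler_wpM2l; first by apply: divr_ge0; [apply: mulr_ge0|]; exact: ltW || exact: D_ge0.
  apply: ler_pM; [exact: ltW|exact: mulr_ge0|exact: rho_pos|by rewrite lerDl].
have P5 : g * D / c0 * (c0 * (k ^+ 2 * f x ^+ 2)) = g * k ^+ 2 * (D * f x ^+ 2).
  by field; rewrite gt_eqF.
by lra.
Qed.

Definition pairs : set (R * R) := [set p | exists f f1 f2, Adm rhob xi f f1 f2 /\
  p = (k ^+ 2 * E0 g rhob c M xi f f1 f2, E1 nu xi f f1 f2)].

Lemma pairs_ge p : pairs p -> - (g * D / c0) <= p.1 /\ 0 <= p.2.
Proof.
move=> [f [f1 [f2 [[[Lf [Lf1 [Lf2 _]]] m1] ->]]]]; split; last exact: E1_ge0.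
have := energy0_ge Lf Lf1 Lf2; rewrite /mass m1 mulr1.
by rewrite energyE// mul0r addr0.
Qed.

(** Negative energy forces positive mass by the previous bound; dividing by the root of the mass
    gives an admissible function. *)
Lemma pairs_neg f f1 f2 : H2 f f1 f2 -> nrg 0 f f1 f2 < 0 -> exists p, pairs p /\ p.1 < 0.
Proof.
move=> hf neg; have [Lf [Lf1 [Lf2 _]]] := hf.
have m0 : 0 < mass rhob k f f1.
  rewrite ltNge; apply/negP => m0.
  have := energy0_ge Lf Lf1 Lf2.
  have : 0 <= - (g * D / c0) * mass rhob k f f1.
    rewrite mulNr -mulrN; apply: mulr_ge0; last by rewrite oppr_ge0.
    by apply: divr_ge0; [apply: mulr_ge0 => //|]; exact: ltW.
  by move: neg; lra.
pose m := Num.sqrt (mass rhob k f f1).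
have m_gt0 : 0 < m by rewrite sqrtr_gt0.
have m2 : m ^+ 2 = mass rhob k f f1 by rewrite sqr_sqrtr// ltW.
have s0z : sm (edec (1:R)) (fun=> 0).
  apply: (@sm_coind _ _ (fun u => u = fun=> 0)) => // _ ->; split.
    by exists 0 => x; rewrite normr0 mul0r.
  by exists (fun=> 0); split=> //; exact: isdC.
have Hz : H2 (fun=> 0 : R) (fun=> 0 : R) (fun=> 0 : R).
  by have := smooth_H2 ltr01 s0z; rewrite !(isdE (isdC 0)).
have Hh := H2_lin m^-1 Hz hf; have [Lh [Lh1 [Lh2 _]]] := Hh.
set h := (fun x => 0 + m^-1 * f x) in Hh Lh.
set h1 := (fun x => 0 + m^-1 * f1 x) in Hh Lh1.
set h2 := (fun x => 0 + m^-1 * f2 x) in Hh Lh2.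
have mh : iR (fun x => rhob x * (k ^+ 2 * h x ^+ 2 + h1 x ^+ 2)) = 1.
  have Im := mass_intg k rho_bdd rho_der rho_test Lf Lf1.
  rewrite -[RHS](@mulVf _ (m ^+ 2)) ?expf_neq0 ?gt_eqF// [in RHS]m2 -iRZ//.
  by congr iR; apply/funext => x; rewrite -m2 /h /h1; field; rewrite gt_eqF.
exists (k ^+ 2 * E0 g rhob c M xi h h1 h2, E1 nu xi h h1 h2); split.
  by exists h, h1, h2.
rewrite /=; have := energyE 0 Lh Lh1 Lh2; rewrite mul0r addr0 => <-.
have -> : nrg 0 h h1 h2 = (m ^+ 2)^-1 * nrg 0 f f1 f2.
  rewrite /energy -iRZ; first by congr iR; apply/funext => x; rewrite /h /h1 /h2; field; rewrite gt_eqF.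
  have [S0 [S1 S2]] := (L2_intg Lf, (L2_intg Lf1, L2_intg Lf2)).
  have := intgB (intgD (intgD (intgZ (mVert * k ^+ 2) S1) (intgZ mVert S2))
    (intgD (intgZ (mHor * k ^+ 2) S0) (intgZ mHor S1))) (intgZ (g * k ^+ 2) (I_ Lf)).
  by congr (intg _); apply/funext => x; ring.
by rewrite pmulr_rlt0// invr_gt0 exprn_gt0.
Qed.

Local Notation al := (alpha g nu rhob c M xi).

(** [esqrt] sends negative arguments to 0, so a positive [s] equal to the root of - alpha makes
    alpha negative. Since E_1 is nonnegative, some admissible E_0 is then negative. *)
Lemma lam_spec_neg s : lam_spec g nu rhob c M xi s -> exists p, pairs p /\ p.1 < 0.
Proof.
move=> [s0 [_ Es]].
have : (al s < 0)%E.
  rewrite ltNge; apply/negP => h; move: Es.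
  case: (al s) h => [x| |] //=.
  - rewrite lee_fin => x0 [] Es; have := s0; rewrite Es sqrtr_gt0; lra.
  - by move=> _ [] Es; move: s0; rewrite Es ltxx.
move=> /ereal_inf_lt [_ [f [f1 [f2 [A ->]]]]]; rewrite lte_fin => h.
exists (k ^+ 2 * E0 g rhob c M xi f f1 f2, E1 nu xi f f1 f2); split; first by exists f, f1, f2.
have := mulr_ge0 (ltW s0) (E1_ge0 f f1 f2); rewrite /=; lra.
Qed.

Hypothesis neg : exists p, pairs p /\ p.1 < 0.

Lemma alphaE s : 0 <= s -> al s = (lower_env pairs s)%:E.
Proof.
move=> s0; rewrite -(lower_envE pairs_ge neg s0) /alpha; congr ereal_inf.
apply/seteqP; split => [_ [f [f1 [f2 [A ->]]]]|_ [_ [[f [f1 [f2 [A ->]]]] ->]]].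
  by exists (k ^+ 2 * E0 g rhob c M xi f f1 f2, E1 nu xi f f1 f2); split=> //; exists f, f1, f2.
by exists f, f1, f2.
Qed.

Lemma lam_specP s : lam_spec g nu rhob c M xi s -> 0 < s /\ lower_env pairs s = - s ^+ 2.
Proof.
move=> [s0 [_]]; rewrite (alphaE (ltW s0)) -EFinN /esqrt => -[E]; split=> //.
have : 0 < Num.sqrt (- lower_env pairs s) by rewrite -E.
rewrite sqrtr_gt0 => h; have := congr1 (fun z => z ^+ 2) E.
by rewrite sqr_sqrtr; [move=> ->; rewrite opprK|exact: ltW].
Qed.

(** s^2 = - alpha is at most g D / c0, and s < s^2 as soon as s > 1. *)
Lemma lam_spec_le s : lam_spec g nu rhob c M xi s -> s <= g * D / c0 + 1.
Proof.
move=> /lam_specP [s0 E]; have := lower_env_ge pairs_ge neg (ltW s0); rewrite E => h.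
have hC : 0 <= g * D / c0 by apply: divr_ge0; [apply: mulr_ge0 => //|]; exact: ltW.
rewrite leNgt; apply/negP => h1.
have : s < s ^+ 2 by rewrite expr2 ltr_pMr//; lra.
lra.
Qed.

Lemma lam_spec_exists : exists s, lam_spec g nu rhob c M xi s.
Proof.
have [s [s0 E [d [d0 Hd]]]] := fixed_point pairs_ge neg.
exists s; split=> //; split; last first.
  by rewrite (alphaE (ltW s0)) E -EFinN opprK /= sqrtr_sqr gtr0_norm.
apply: (@lt_le_trans _ _ (s + d)%:E); first by rewrite lte_fin ltrDl.
apply: ereal_sup_ubound; exists (s + d); split; first by lra.
split=> // t ht; rewrite alphaE; first by rewrite lte_fin Hd.
by case/andP: ht => /ltW.
Qed.

Lemma minimizer r x0 s : 0 < r -> 0 < rho' x0 -> (forall x, r <= `|x| -> rho' x = 0) ->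
  lam_spec g nu rhob c M xi s ->
  exists a psi w, 0 < a /\ [/\ sm (edec a) psi, exists x, psi x != 0,
    normal_sol rhob g nu k mVert mHor s (fun=> 0) w & psi = w 0%N].
Proof.
move=> r0 rx0 rsup /lam_specP [s0 E].
apply: (minimizer_exists g_gt0 nu_gt0 k_gt0 mVert_ge0 mHor_ge0 s0 r0 rho_bdd rho_der rho_test
  rho_pos c0_gt0 rx0 rsup).
- move=> f f1 f2 hf m1; have [Lf [Lf1 [Lf2 _]]] := hf.
  rewrite energyE// -E.
  apply: (@lower_env_le _ _ _ pairs_ge s (_, _) (ltW s0)).
  by exists f, f1, f2.
- move=> e e0; have [p [[f [f1 [f2 [[hf m1] pE]]]] Hp]] := lower_env_near pairs_ge neg (ltW s0) e0.
  have [Lf [Lf1 [Lf2 _]]] := hf.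
  by exists f, f1, f2; split=> //; rewrite energyE// -E; rewrite pE in Hp.
Qed.

End Spectral.

(** * Normal modes and their norms *)

Section Modes.
Variable R : realType.
Notation mu := (@lebesgue_measure R).
Variables (s a L : R) (xi : R * R).
Hypotheses (a_gt0 : 0 < a) (L_gt0 : 0 < L) (xi_lat : lattice L xi) (xi_neq0 : xi != (0, 0)).
Implicit Types (F G : R -> R) (b : bool).

Definition trig b : R -> R := if b then cos else sin.
Definition sgn b : R := if b then -1 else 1.

Lemma isd_trig b : isd (trig b) (fun x => sgn b * trig (~~ b) x).
Proof.
case: b => x; rewrite /trig /sgn /=.
  by apply: is_derive_eq; rewrite mulN1r.
by apply: is_derive_eq; rewrite mul1r.
Qed.

Definition phase (x1 x2 : R) : R := xi.1 * x1 + xi.2 * x2.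
(** The boolean selects cosine or sine, so that a horizontal derivative merely flips [b] and
    rescales the profile. *)
Definition mode b F : fld R := fun t x1 x2 x3 => expR (s * t) * trig b (phase x1 x2) * F x3.

Lemma isd_mode0 b F x1 x2 x3 : isd (fun t => mode b F t x1 x2 x3)
  (fun t => mode b (fun x => s * F x) t x1 x2 x3).
Proof.
apply: isd_ext (isdZ (trig b (phase x1 x2) * F x3) (isd_expRZ s)) _ _ => t; rewrite /mode; ring.
Qed.

Lemma isd_mode1 b F t x2 x3 : isd (fun x1 => mode b F t x1 x2 x3)
  (fun x1 => mode (~~ b) (fun x => sgn b * xi.1 * F x) t x1 x2 x3).
Proof.
have d := isd_comp (isd_trig b) (isd_affine xi.1 (xi.2 * x2)).
apply: isd_ext (isdZ (expR (s * t) * F x3) d) _ _ => x; rewrite /mode /phase; ring.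
Qed.

Lemma isd_mode2 b F t x1 x3 : isd (fun x2 => mode b F t x1 x2 x3)
  (fun x2 => mode (~~ b) (fun x => sgn b * xi.2 * F x) t x1 x2 x3).
Proof.
have d := isd_comp (isd_trig b) (isd_affine xi.2 (xi.1 * x1)).
apply: isd_ext (isdZ (expR (s * t) * F x3) d) _ _ => x; rewrite /mode /phase.
  by rewrite (addrC (xi.2 * x)); ring.
by rewrite (addrC (xi.2 * x)); ring.
Qed.

Lemma isd_mode3 b F F1 t x1 x2 : isd F F1 -> isd (fun x3 => mode b F t x1 x2 x3)
  (fun x3 => mode b F1 t x1 x2 x3).
Proof. by move=> dF; apply: isdZ. Qed.

Lemma pd0_mode b F : pd 0 (mode b F) = mode b (fun x => s * F x).
Proof.
apply/funext => t; apply/funext => x1; apply/funext => x2; apply/funext => x3.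
by rewrite /pd (isdE (isd_mode0 b F x1 x2 x3)).
Qed.

Lemma pd1_mode b F : pd 1 (mode b F) = mode (~~ b) (fun x => sgn b * xi.1 * F x).
Proof.
apply/funext => t; apply/funext => x1; apply/funext => x2; apply/funext => x3.
by rewrite /pd (isdE (isd_mode1 b F t x2 x3)).
Qed.

Lemma pd2_mode b F : pd 2 (mode b F) = mode (~~ b) (fun x => sgn b * xi.2 * F x).
Proof.
apply/funext => t; apply/funext => x1; apply/funext => x2; apply/funext => x3.
by rewrite /pd (isdE (isd_mode2 b F t x1 x3)).
Qed.

Lemma pd3_mode i b F F1 : isd F F1 -> pd i.+3 (mode b F) = mode b F1.
Proof.
move=> dF; apply/funext => t; apply/funext => x1; apply/funext => x2; apply/funext => x3.
by rewrite /pd (isdE (isd_mode3 b t x1 x2 dF)).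
Qed.

(** Closed under every partial derivative; smoothness, periodicity, decay and Sobolev norms are thus
    settled for all fields at once. *)
Definition is_mode (f : fld R) := exists b F, sm (edec a) F /\ f = mode b F.

Lemma sm_edecZ (c : R) F : sm (edec a) F -> sm (edec a) (fun x => c * F x).
Proof.
move=> SF; apply: (@sm_coind _ _ (fun u => exists G, sm (edec a) G /\ u = fun x => c * G x)); last by exists F.
move=> _ [G [SG ->]]; split; first exact: edecZ (sm_P SG).
exists (fun x => c * derive1 G x); split; first exact: isdZ (sm_isd SG).
by exists (derive1 G); split; first exact: sm_der.
Qed.

Lemma is_mode_pd i f : is_mode f -> is_mode (pd i f) /\ forall t x1 x2 x3, pdable i f t x1 x2 x3.
Proof.
move=> [b [F [SF ->]]]; case: i => [|[|[|i]]].
- rewrite pd0_mode; split; first by exists b, (fun x => s * F x); split; first exact: sm_edecZ.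
  by move=> t x1 x2 x3; exact: isd_derivable (isd_mode0 b F x1 x2 x3).
- rewrite pd1_mode; split; first by exists (~~ b), (fun x => sgn b * xi.1 * F x); split; first exact: sm_edecZ.
  by move=> t x1 x2 x3; exact: isd_derivable (isd_mode1 b F t x2 x3).
- rewrite pd2_mode; split; first by exists (~~ b), (fun x => sgn b * xi.2 * F x); split; first exact: sm_edecZ.
  by move=> t x1 x2 x3; exact: isd_derivable (isd_mode2 b F t x1 x3).
- have dF := sm_isd SF.
  rewrite (pd3_mode i b dF); split; first by exists b, (derive1 F); split; first exact: sm_der.
  by move=> t x1 x2 x3; exact: isd_derivable (isd_mode3 b t x1 x2 dF).
Qed.

Lemma is_mode_smooth f : is_mode f -> smoothF f.
Proof.
move=> mf l i; have ml : is_mode (foldr (@pd R) f l).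
  by elim: l => [//|j l IH] /=; have [] := is_mode_pd j IH.
by have [_ H] := is_mode_pd i ml.
Qed.

Lemma is_mode_dmi a1 a2 a3 f : is_mode f -> is_mode (dmi a1 a2 a3 f).
Proof.
have it_mode i n g : is_mode g -> is_mode (iter n (@pd R i) g).
  by move=> mg; elim: n => [//|n IH] /=; have [] := is_mode_pd i IH.
by move=> mf; apply: (it_mode); apply: (it_mode); apply: (it_mode).
Qed.

Lemma trig_period b (z : int) x : trig b (x + pi *+ 2 * z%:~R) = trig b x.
Proof.
have P : periodic (trig b) (pi *+ 2) by rewrite /trig; case: b; [exact: cosD2pi|exact: sinD2pi].
have Pn n y : trig b (y + pi *+ 2 * n%:R) = trig b y by rewrite mulr_natr (periodicn P).
case: z => n; first by rewrite -[(Posz n)%:~R]/(n%:R : R) Pn.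
by rewrite NegzE mulrNz mulrN -[LHS](Pn n.+1) subrK.
Qed.

Lemma phase_shift i (x : R) : (i = xi.1 \/ i = xi.2) -> exists z : int,
  i * (x + 2 * pi * L) = i * x + pi *+ 2 * z%:~R.
Proof.
have [k1 [k2 E]] := xi_lat; have Ln : L != 0 by rewrite gt_eqF.
move=> [->|->]; rewrite E /=; [exists k1|exists k2]; by rewrite -mulr_natl; field.
Qed.

Lemma is_mode_periodic f : is_mode f -> hperiodic L f.
Proof.
move=> [b [F [_ ->]]] t x1 x2 x3; rewrite /mode /phase; split.
  have [z ->] := phase_shift x1 (or_introl (erefl xi.1)).
  by rewrite addrAC trig_period.
have [z ->] := phase_shift x2 (or_intror (erefl xi.2)).
by rewrite addrA trig_period.
Qed.

Lemma edec_vanish F : edec a F -> F x @[x --> +oo] --> 0 /\ F x @[x --> -oo] --> 0.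
Proof.
move=> [C HC].
have C0 : 0 <= C by have := le_trans (normr_ge0 _) (HC 0); rewrite pmulr_lge0 ?expR_gt0.
have key e : 0 < e -> exists B : R, 0 < B /\ forall x, B < `|x| -> `|F x| < e.
  move=> e0; have : expR (- x) @[x --> +oo] --> (0 : R) := @cvgr_expR R.
  move=> /cvgrPdist_lt /(_ (e / (C + 1)) ltac:(by rewrite divr_gt0//; lra)) [B [_ HB]].
  exists ((`|B| + 1) / a); split; first by rewrite divr_gt0// ltr_wpDl.
  move=> x; rewrite ltr_pdivrMr// => hx; have := HB (`|x| * a) ltac:(by have := ler_norm B; lra).
  rewrite sub0r normrN ger0_norm ?expR_ge0// => h.
  apply: le_lt_trans (HC x) _; rewrite mulNr (mulrC a).
  apply: (@le_lt_trans _ _ ((C + 1) * expR (- (`|x| * a)))).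
    by rewrite ler_wpM2r ?expR_ge0//; lra.
  by rewrite mulrC -ltr_pdivlMr//; lra.
split; apply/cvgrPdist_lt => e e0; have [B [B0 HB]] := key e e0.
  near=> x; rewrite sub0r normrN; apply: HB.
  have h : B < x by near: x; apply: nbhs_pinfty_gt; exact: num_real.
  by rewrite gtr0_norm// (lt_trans B0).
near=> x; rewrite sub0r normrN; apply: HB.
have h : x < - B by near: x; apply: nbhs_ninfty_lt; exact: num_real.
by rewrite ltr0_norm; lra.
Unshelve. all: by end_near. Qed.

Lemma is_mode_vanish f : is_mode f -> vanish_at_infty f.
Proof.
move=> [b [F [SF ->]]] t x1 x2 _; have [h1 h2] := edec_vanish (sm_P SF).
rewrite /mode -[X in _ --> X /\ _](mulr0 (expR (s * t) * trig b (phase x1 x2))).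
split; first by apply: cvgM; [exact: cvg_cst|exact: h1].
rewrite -[X in _ --> X](mulr0 (expR (s * t) * trig b (phase x1 x2))).
by apply: cvgM; [exact: cvg_cst|exact: h2].
Qed.

(* Over full periods, cos^2 and sin^2 have mean 1/2. *)
Lemma trig_sq b (z : int) (A c : R) : z != 0 ->
  (\int[mu]_(x in `[0%R, (2 * pi * L)%R]) ((A * trig b (z%:~R / L * x + c)) ^+ 2)%:E =
   (A ^+ 2 * (pi * L))%:E)%E.
Proof.
move=> z0; pose q : R := z%:~R / L.
have zn : z%:~R != 0 :> R by rewrite intr_eq0.
have Ln : L != 0 by rewrite gt_eqF.
have qn : q != 0 by rewrite mulf_neq0// invr_eq0.
pose G x := A ^+ 2 * (x / 2 + (- sgn b) * (sin ((2 * q) * x + 2 * c) * (4 * q)^-1)).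
have dG : isd G (fun x => (A * trig b (q * x + c)) ^+ 2).
  have d1 := isd_comp (isd_trig false) (isd_affine (2 * q) (2 * c)).
  have d2 : isd (fun x : R => x / 2) (fun=> 2^-1).
    by apply: isd_ext (isdZ 2^-1 (@isdX R)) _ _ => x; ring.
  have d3 : isd (fun x => sin (2 * q * x + 2 * c) * (4 * q)^-1)
      (fun x => (4 * q)^-1 * (sgn false * trig (~~ false) (2 * q * x + 2 * c) * (2 * q))).
    by apply: isd_ext (isdZ (4 * q)^-1 d1) _ _ => x //; rewrite mulrC.
  apply: isd_ext (isdZ (A ^+ 2) (isdD d2 (isdZ (- sgn b) d3))) _ _ => x //.
  rewrite /sgn /trig /=.
  have -> : 2 * q * x + 2 * c = (q * x + c) *+ 2 by rewrite mulr2n; ring.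
  rewrite cos_mulr2n exprMn.
  have := cos2Dsin2 (q * x + c); clear G.
  case: b => /= [_|E].
    by field.
  rewrite (_ : cos (q * x + c) ^+ 2 = 1 - sin (q * x + c) ^+ 2); last by lra.
  by field.
have pL : 0 < 2 * pi * L by rewrite !mulr_gt0// pi_gt0.
have cG := isd_cont dG.
have cf : continuous (fun x => (A * trig b (q * x + c)) ^+ 2).
  have dt := isd_comp (isd_trig b) (isd_affine q c).
  have ct := isd_cont (isdZ A dt).
  by move=> x; rewrite /GRing.exp /=; apply: cvgM; exact: ct.
rewrite (@continuous_FTC2 _ _ G)//.
- rewrite -EFinB; congr EFin; rewrite /G mulr0 mul0r add0r add0r.
  have -> : 2 * q * (2 * pi * L) + 2 * c = 2 * c + pi *+ 2 * (z + z)%:~R.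
    by rewrite /q rmorphD /= mulr2n; field.
  have := trig_period false (z + z) (2 * c); rewrite /trig => ->.
  by field.
- exact: continuous_subspaceT.
- split; first by move=> x _; apply: isd_derivable dG.
  + by apply: cvg_at_right_filter; exact: cG.
  + by apply: cvg_at_left_filter; exact: cG.
- by move=> x _; rewrite (isdE dG).
Qed.

(** The factor is half the area (2 pi L)^2 of the cell. Averaging takes place in a horizontal
    variable with nonzero frequency, which exists because [xi] is nonzero. *)
Lemma cell_mode b F t : sm (edec a) F ->
  cellL2 L (mode b F t) = (expR (2 * s * t) * (2 * pi ^+ 2 * L ^+ 2 * iR (fun x => F x ^+ 2)))%:E.
Proof.
move=> SF.
have LF : L2R F by apply: (edec_L2 a_gt0); [exact: cont_meas (sm_cont SF)|exact: sm_P SF].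
have IF := L2_intg LF.
have pL : 0 < 2 * pi * L by rewrite !mulr_gt0// pi_gt0.
have E2 : expR (2 * s * t) = expR (s * t) ^+ 2.
  by rewrite expr2 -expRD; congr expR; ring.
have cstint (c : R) : (\int[mu]_(x in `[0%R, (2 * pi * L)%R]) c%:E = (c * (2 * pi * L))%:E)%E.
  rewrite integral_cst//= [X in (_ * X)%E](lebesgue_measure_itv `[0%R, (2 * pi * L)%R]) /=.
  by rewrite lte_fin pL -EFinB subr0.
have [k1 [k2 E]] := xi_lat.
have key x3 : (\int[mu]_(x2 in `[0%R, (2 * pi * L)%R])
    \int[mu]_(x1 in `[0%R, (2 * pi * L)%R]) ((mode b F t x1 x2 x3) ^+ 2)%:E =
    (expR (2 * s * t) * (2 * pi ^+ 2 * L ^+ 2) * F x3 ^+ 2)%:E)%E.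
  have [k10|k10] := eqVneq k1 0; last first.
    transitivity (\int[mu]_(x2 in `[0%R, (2 * pi * L)%R]) ((expR (s * t) * F x3) ^+ 2 * (pi * L))%:E)%E.
      apply: eq_integral => x2 _; rewrite -(trig_sq b _ (k2%:~R / L * x2) k10).
      by apply: eq_integral => x1 _; rewrite /mode /phase E /=; congr EFin; ring.
    by rewrite cstint E2; congr EFin; ring.
  have k20 : k2 != 0.
    apply/eqP => k20; move/eqP: xi_neq0; apply.
    by rewrite E k10 k20 !mul0r.
  (* The trivial x1-integral contributes the length 2 pi L; its root goes into the amplitude, so
     that [trig_sq] applies in x2. *)
  transitivity (\int[mu]_(x2 in `[0%R, (2 * pi * L)%R])
     ((expR (s * t) * F x3 * Num.sqrt (2 * pi * L) * trig b (k2%:~R / L * x2 + 0)) ^+ 2)%:E)%E.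
    apply: eq_integral => x2 _.
    transitivity (\int[mu]_(x1 in `[0%R, (2 * pi * L)%R]) ((expR (s * t) * F x3 * trig b (k2%:~R / L * x2 + 0)) ^+ 2)%:E)%E.
      apply: eq_integral => x1 _; rewrite /mode /phase E k10 /= addr0; congr EFin.
      by rewrite (_ : 0%:~R / L * x1 + _ = k2%:~R / L * x2); ring.
    rewrite cstint; congr EFin.
    rewrite -[in LHS](sqr_sqrtr (ltW pL)); ring.
  rewrite trig_sq// !exprMn sqr_sqrtr ?(ltW pL)// E2; congr EFin; ring.
transitivity (IntR (fun x3 => expR (2 * s * t) * (2 * pi ^+ 2 * L ^+ 2) * F x3 ^+ 2)).
  by apply: eq_integral => x3 _; exact: key.
rewrite IntRE; last exact: intgZ.
by rewrite iRZ//; congr EFin; ring.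
Qed.

(** Squared norms are all of this form, which is stable under sums. The exact factor e^{st}
    therefore holds for norms of several fields together. *)
Definition grows (u : R -> \bar R) :=
  exists A : R, 0 <= A /\ forall t, u t = (expR (2 * s * t) * A)%:E.

Lemma growsD u v : grows u -> grows v -> grows (fun t => (u t + v t)%E).
Proof.
move=> [A [A0 HA]] [B [B0 HB]]; exists (A + B); split; first exact: addr_ge0.
by move=> t; rewrite HA HB -EFinD mulrDr.
Qed.

Lemma grows_sum (I : Type) (r : seq I) (P : pred I) (u : I -> R -> \bar R) :
  (forall i, grows (u i)) -> grows (fun t => (\sum_(i <- r | P i) u i t)%E).
Proof.
move=> Hu; elim: r => [|i r IH].
  by exists 0; split=> // t; rewrite big_nil mulr0.
have [Pi|nPi] := boolP (P i).
  have [A [A0 HA]] := growsD (Hu i) IH; exists A; split=> // t.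
  by rewrite big_cons Pi HA.
have [A [A0 HA]] := IH; exists A; split=> // t.
by rewrite big_cons (negbTE nPi) HA.
Qed.

Lemma grows_Hk2 k f : is_mode f -> grows (Hk2 L k f).
Proof.
move=> mf; rewrite /Hk2; apply: (grows_sum _ _ (u := fun a1 t => _)) => a1.
apply: (grows_sum _ _ (u := fun a2 t => _)) => a2; apply: (grows_sum _ _ (u := fun a3 t => _)) => a3.
have [b [F [SF E]]] := is_mode_dmi a1 a2 a3 mf.
exists (2 * pi ^+ 2 * L ^+ 2 * iR (fun x => F x ^+ 2)); split.
  apply: mulr_ge0; last by apply: iR_ge0 => x; exact: sqr_ge0.
  by apply: mulr_ge0; [apply: mulr_ge0 => //|]; exact: sqr_ge0.
by move=> t; rewrite E cell_mode.
Qed.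

Lemma grows_lt u t : grows u -> (u t < +oo)%E.
Proof. by move=> [A [_ ->]]; rewrite ltry. Qed.

Lemma grows_sqrt u t : grows u -> esqrt (u t) = ((expR (s * t))%:E * esqrt (u 0%R))%E.
Proof.
move=> [A [A0 H]]; rewrite !H mulr0 expR0 mul1r /= -EFinM; congr EFin.
rewrite sqrtrM ?expR_ge0//; congr (_ * _).
have -> : expR (2 * s * t) = expR (s * t) ^+ 2.
  by rewrite expr2 -expRD; congr expR; ring.
by rewrite sqrtr_sqr ger0_norm ?expR_ge0.
Qed.

Lemma grows_sqrt_lt u t : grows u -> (esqrt (u t) < +oo)%E.
Proof. by move=> [A [_ ->]]; rewrite ltry. Qed.

Lemma Hk2_0 b F : sm (edec a) F ->
  Hk2 L 0 (mode b F) 0 = (2 * pi ^+ 2 * L ^+ 2 * iR (fun x => F x ^+ 2))%:E.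
Proof.
move=> SF; rewrite /Hk2 !big_ord1 big_mkcond big_ord1 /=.
by rewrite cell_mode// mulr0 expR0 mul1r.
Qed.

Lemma iR_sq_gt0 F x0 : continuous F -> L2R F -> F x0 != 0 -> 0 < iR (fun x => F x ^+ 2).
Proof.
move=> cF LF F0.
have n0 : 0 < `|F x0| / 2 by rewrite divr_gt0// normr_gt0.
have /cvgrPdist_lt /(_ _ n0) := cF x0.
move=> /nbhs_ballP [d /= d0 Hd].
have hd : x0 - d / 2 <= x0 + d / 2 by lra.
apply: (@lt_le_trans _ _ (iR (fun x => (`|F x0| / 2) ^+ 2 * indi (x0 - d / 2) (x0 + d / 2) x))).
  rewrite iRZ; last exact: indi_intg.
  by rewrite iR_indi// mulr_gt0 ?exprn_gt0//; lra.
apply: iR_le; [by apply: intgZ; exact: indi_intg|exact: L2_intg|].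
move=> x; rewrite indi_itv; have [/andP[h1 h2]|_] := boolP (_ <= x <= _); last by rewrite mulr0 sqr_ge0.
rewrite mulr1 -[leRHS]real_normK ?num_real//.
have h : `|F x0 - F x| < `|F x0| / 2 by apply: Hd; rewrite /ball /= ltr_norml; lra.
apply: lerXn2r; rewrite ?nnegrE ?(ltW n0)//.
have : `|F x0| <= `|F x0 - F x| + `|F x| by apply: le_trans (ler_normD _ _); rewrite subrK.
lra.
Qed.

End Modes.

#[local] Arguments pd : simpl never.

(** * Explicit fields of a normal mode *)

Section Solution.
Variable R : realType.
Variables (g nu : R) (rhob : R -> R) (c : Mcase) (M : R) (xi : R * R).
Variables (s a : R) (w : nat -> R -> R).
Local Notation rho' := (derive1 rhob).
Hypotheses (s_gt0 : 0 < s) (nu_gt0 : 0 < nu) (a_gt0 : 0 < a) (xi_neq0 : xi != (0, 0)).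
Hypothesis rho_bdd : bdd rhob.
Hypothesis rho_der : forall x, derivable rhob x 1.
Hypothesis rho_test : test_fn rho'.
Local Notation mV := (mVert c M).
Local Notation mH := (mHor c M xi).
Hypothesis w_sol : normal_sol rhob g nu (xnorm xi) mV mH s (fun=> 0) w.
Hypothesis w_edec : sm (edec a) (w 0%N).

Local Notation K2 := (xi.1 ^+ 2 + xi.2 ^+ 2).

Lemma K2_gt0 : 0 < K2.
Proof.
rewrite lt_neqAle addr_ge0 ?sqr_ge0// andbT eq_sym paddr_eq0 ?sqr_ge0//.
rewrite !sqrf_eq0; move: xi_neq0; case: xi => x y /=.
by apply: contra => /andP[/eqP -> /eqP ->].
Qed.

Lemma xnorm_sq : xnorm xi ^+ 2 = K2.
Proof. by rewrite /xnorm sqr_sqrtr// ltW// K2_gt0. Qed.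

Local Notation smode := (mode s xi).

(** The horizontal velocity is taken parallel to xi, with the amplitude that makes its divergence
    cancel the vertical derivative of u_3. *)
Definition Ufield : vfld R := fun i =>
  match i with
  | 0 => smode false (fun x => - (xi.1 / K2) * w 1%N x)
  | 1 => smode false (fun x => - (xi.2 / K2) * w 1%N x)
  | _ => smode true (w 0%N)
  end.
Definition RHOfield : fld R := smode true (fun x => - s^-1 * (rho' x * w 0%N x)).
(* s N = (Mbar . grad) u, the induction equation for div u = 0. *)
Definition Nfield : vfld R := fun i =>
  match c with
  | Vertical =>
    match i with
    | 0 => smode false (fun x => - (M * xi.1 / (s * K2)) * w 2%N x)
    | 1 => smode false (fun x => - (M * xi.2 / (s * K2)) * w 2%N x)
    | _ => smode true (fun x => M / s * w 1%N x)
    end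
  | Horizontal =>
    match i with
    | 0 => smode true (fun x => - (M * xi.1 ^+ 2 / (s * K2)) * w 1%N x)
    | 1 => smode true (fun x => - (M * xi.1 * xi.2 / (s * K2)) * w 1%N x)
    | _ => smode false (fun x => - (M * xi.1 / s) * w 0%N x)
    end
  end.
(* Determined by the horizontal momentum equations. *)
Definition qprof x : R :=
  K2^-1 * ((nu + mV / s) * (w 3%N x + - K2 * w 1%N x) + - s * (rhob x * w 1%N x)).
Definition Qfield : fld R := smode true qprof.

Let w4 x : R := cp2 rhob nu (xnorm xi) mV mH s x * w 2%N x + cp1 rhob nu mV s x * w 1%N x
   + cp0 rhob g nu (xnorm xi) mV mH s x * w 0%N x + 0.

Let d0 : isd (w 0%N) (w 1%N). Proof. by case: w_sol. Qed.
Let d1 : isd (w 1%N) (w 2%N). Proof. by case: w_sol. Qed.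
Let d2 : isd (w 2%N) (w 3%N). Proof. by case: w_sol. Qed.
Let d3 : isd (w 3%N) w4. Proof. by case: w_sol. Qed.

Let w4E x : (s * nu + mV) * w4 x =
  (2 * s * nu * K2 + mV * K2 + mH + s ^+ 2 * rhob x) * w 2%N x + s ^+ 2 * rho' x * w 1%N x
  - (s * nu * K2 ^+ 2 + mH * K2 + s ^+ 2 * K2 * rhob x - g * K2 * rho' x) * w 0%N x.
Proof.
have A0 : cA nu mV s != 0 by rewrite gt_eqF// cA_gt0// mVert_ge0.
rewrite -[s * nu + mV]/(cA nu mV s) /w4 /cp2 /cp1 /cp0 /cC /cB /cD.
rewrite (_ : xnorm xi ^+ 4 = (xnorm xi ^+ 2) ^+ 2); last by rewrite -exprM.
rewrite xnorm_sq; field.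
exact: A0.
Qed.

Let qprof1 x : R :=
  K2^-1 * ((nu + mV / s) * (w4 x + - K2 * w 2%N x) + - s * (rho' x * w 1%N x + rhob x * w 2%N x)).
Let dq : isd qprof qprof1.
Proof.
exact: (isdZ K2^-1 (isdD (isdZ (nu + mV / s) (isdD d3 (isdZ (- K2) d1)))
  (isdZ (- s) (isdM (isdP rho_der) d1)))).
Qed.

Let S1 : sm (edec a) (w 1%N). Proof. by rewrite -(isdE d0); exact: sm_der. Qed.
Let S2 : sm (edec a) (w 2%N). Proof. by rewrite -(isdE d1); exact: sm_der. Qed.
Let S3 : sm (edec a) (w 3%N). Proof. by rewrite -(isdE d2); exact: sm_der. Qed.

Let smBM (e F : R -> R) : sm (@bdd R) e -> sm (edec a) F -> sm (edec a) (fun x => e x * F x).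
Proof. by move=> se sF; apply: (@smM _ _ (@bdd R) (edec a)) => //; [exact: edecD|exact: edecM]. Qed.

Let smDD (F G : R -> R) : sm (edec a) F -> sm (edec a) G -> sm (edec a) (fun x => F x + G x).
Proof. by apply: smD; exact: edecD. Qed.

Let ism := is_mode s a xi.

Lemma U_mode i : ism (Ufield i).
Proof.
case: i => [|[|i]]; [exists false|exists false|exists true]; eexists; (split; last by []) => //.
- exact: sm_edecZ.
- exact: sm_edecZ.
Qed.

Lemma N_mode i : ism (Nfield i).
Proof.
rewrite /Nfield; case: c; case: i => [|[|i]];
  [exists true|exists true|exists false|exists false|exists false|exists true];
  eexists; (split; last by []); exact: sm_edecZ.
Qed.

Lemma RHO_mode : ism RHOfield.
Proof.
exists true; eexists; (split; last by []).
apply: sm_edecZ; apply: smBM => //.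
exact: sm_der (rho_smooth rho_bdd rho_der rho_test).
Qed.

Lemma Q_mode : ism Qfield.
Proof.
exists true; eexists; (split; last by []); rewrite /qprof.
apply: sm_edecZ; apply: smDD; apply: sm_edecZ.
  by apply: smDD => //; exact: sm_edecZ.
by apply: smBM => //; exact: (rho_smooth rho_bdd rho_der rho_test).
Qed.

Let p30 b (q : R) : pd 3 (smode b (fun x => q * w 0%N x)) = smode b (fun x => q * w 1%N x).
Proof. by apply: (pd3_mode s xi 0); exact: isdZ. Qed.
Let p31 b (q : R) : pd 3 (smode b (fun x => q * w 1%N x)) = smode b (fun x => q * w 2%N x).
Proof. by apply: (pd3_mode s xi 0); exact: isdZ. Qed.
Let p32 b (q : R) : pd 3 (smode b (fun x => q * w 2%N x)) = smode b (fun x => q * w 3%N x).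
Proof. by apply: (pd3_mode s xi 0); exact: isdZ. Qed.
Let p30' b : pd 3 (smode b (w 0%N)) = smode b (w 1%N).
Proof. exact: (pd3_mode s xi 0). Qed.
Let p31' b : pd 3 (smode b (w 1%N)) = smode b (w 2%N).
Proof. exact: (pd3_mode s xi 0). Qed.
Let p3q b : pd 3 (smode b qprof) = smode b qprof1.
Proof. exact: (pd3_mode s xi 0). Qed.

Let pd_comb i (f h : fld R) (p q : R) t x1 x2 x3 : ism f -> ism h ->
  pd i (fun t x1 x2 x3 => f t x1 x2 x3 * p - h t x1 x2 x3 * q) t x1 x2 x3 =
  pd i f t x1 x2 x3 * p - pd i h t x1 x2 x3 * q.
Proof.
move=> /(is_mode_pd i) [_ Hf] /(is_mode_pd i) [_ Hh].
have T (u v : R -> R) : (forall x, derivable u x 1) -> (forall x, derivable v x 1) ->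
    derive1 (fun x => u x * p - v x * q) = fun x => derive1 u x * p - derive1 v x * q.
  move=> /isdP du /isdP dv; apply: isdE.
  by apply: isd_ext (isdB (isdZ p du) (isdZ q dv)) _ _ => x; ring.
case: i Hf Hh => [|[|[|i]]] Hf Hh; rewrite /pd.
- by rewrite (T (fun y => f y x1 x2 x3) (fun y => h y x1 x2 x3) (fun y => Hf y x1 x2 x3) (fun y => Hh y x1 x2 x3)).
- by rewrite (T (fun y => f t y x2 x3) (fun y => h t y x2 x3) (fun y => Hf t y x2 x3) (fun y => Hh t y x2 x3)).
- by rewrite (T (fun y => f t x1 y x3) (fun y => h t x1 y x3) (fun y => Hf t x1 y x3) (fun y => Hh t x1 y x3)).
- by rewrite (T (fun y => f t x1 x2 y) (fun y => h t x1 x2 y) (fun y => Hf t x1 x2 y) (fun y => Hh t x1 x2 y)).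
Qed.

Lemma divU t x1 x2 x3 : divF Ufield t x1 x2 x3 = 0.
Proof.
rewrite /divF /Ufield pd1_mode pd2_mode p30' /mode /trig /sgn /=.
have Kn : K2 != 0 by rewrite gt_eqF// K2_gt0.
by field.
Qed.

Lemma divN t x1 x2 x3 : divF Nfield t x1 x2 x3 = 0.
Proof.
have Kn : K2 != 0 by rewrite gt_eqF// K2_gt0.
have sn : s != 0 by rewrite gt_eqF.
rewrite /divF /Nfield; case: c; rewrite pd1_mode pd2_mode ?p30 ?p31 /mode /trig /sgn /=; field;
by rewrite Kn sn.
Qed.

(** The profile equation is used only in the vertical momentum balance. All other equations are
    identities, the horizontal balances by the choice of q. *)
Lemma modes_solve : lin_sol g nu rhob (Mvec c M) RHOfield Ufield Nfield Qfield.
Proof.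
move=> t x1 x2 x3 _.
have Kn : K2 != 0 by rewrite gt_eqF// K2_gt0.
have sn : s != 0 by rewrite gt_eqF.
split; [|move=> i i3|move=> i i3|exact: divU|exact: divN].
- by rewrite /RHOfield /Ufield pd0_mode /mode /drhob; field.
- have := w4E x3; move: i3; case: i => [|[|[|//]]] _ H4;
    rewrite /lapF /crossC /curlF /Mvec /Nfield /Qfield /Ufield /RHOfield /=;
    rewrite ?p3q ?pd1_mode ?pd2_mode /qprof /qprof1; move: H4; rewrite /mVert /mHor; case: c => H4;
    rewrite ?pd0_mode ?pd1_mode ?pd2_mode ?pd1_mode ?pd2_mode ?p31 ?p32 ?p30 ?p30' ?p31' ?p32;
    rewrite /mode /trig /sgn /=.
  + by field; rewrite Kn sn.
  + by field; rewrite Kn sn.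
  + by field; rewrite Kn sn.
  + by field; rewrite Kn sn.
  (* The residual of the vertical balance is the residual of [w4E] times e^{st} cos / (s |xi|^2). *)
  + apply/eqP; rewrite -subr_eq0; apply/eqP.
    transitivity (expR (s * t) * cos (phase xi x1 x2) / (s * K2) * ((s * nu + 0) * w4 x3 -
      ((2 * s * nu * K2 + 0 * K2 + M ^+ 2 * xi.1 ^+ 2 + s ^+ 2 * rhob x3) * w 2%N x3 + s ^+ 2 * rho' x3 * w 1%N x3 -
       (s * nu * K2 ^+ 2 + M ^+ 2 * xi.1 ^+ 2 * K2 + s ^+ 2 * K2 * rhob x3 - g * K2 * rho' x3) * w 0%N x3))); last first.
      by rewrite H4 subrr mulr0.
    by field; rewrite Kn sn.
  + apply/eqP; rewrite -subr_eq0; apply/eqP.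
    transitivity (expR (s * t) * cos (phase xi x1 x2) / (s * K2) * ((s * nu + M ^+ 2) * w4 x3 -
      ((2 * s * nu * K2 + M ^+ 2 * K2 + 0 + s ^+ 2 * rhob x3) * w 2%N x3 + s ^+ 2 * rho' x3 * w 1%N x3 -
       (s * nu * K2 ^+ 2 + 0 * K2 + s ^+ 2 * K2 * rhob x3 - g * K2 * rho' x3) * w 0%N x3))); last first.
      by rewrite H4 subrr mulr0.
    by field; rewrite Kn sn.
- have [u0 [u1 u2]] := (U_mode 0, (U_mode 1, U_mode 2)).
  move: i3; case: i => [|[|[|//]]] _; rewrite /curlF /crossC !pd_comb//;
    move: u0 u1 u2; rewrite /Mvec /Nfield /Ufield /= => _ _ _; case: c => /=;
    rewrite pd0_mode ?pd1_mode ?pd2_mode ?p30' ?p31 ?p30 ?p31' /mode /trig /sgn /=;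
    by field; rewrite ?Kn ?sn.
Qed.

End Solution.

(** * Unstable frequencies *)

Section Existence.
Variable R : realType.
Variables (L g nu : R) (rhob : R -> R) (c : Mcase) (M c0 x0 : R).
Local Notation rho' := (derive1 rhob).
Hypotheses (L_gt0 : 0 < L) (g_gt0 : 0 < g) (nu_gt0 : 0 < nu) (c0_gt0 : 0 < c0).
Hypothesis rho_bdd : bdd rhob.
Hypothesis rho_der : forall x, derivable rhob x 1.
Hypothesis rho_test : test_fn rho'.
Hypothesis rho_pos : forall x, c0 <= rhob x.
Hypothesis rho_x0 : 0 < rho' x0.
Hypothesis hM : Mhyp g rhob c M.

Lemma Ag_xnorm xi : Ag g rhob c M xi -> 0 < xnorm xi /\ xi != (0, 0).
Proof.
have nz : 0 < xnorm xi -> xi != (0, 0).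
  by apply: contraTN => /eqP ->; rewrite /xnorm /= expr0n addr0 sqrtr0 ltxx.
have pz : xi != (0, 0) -> 0 < xnorm xi.
  move=> h; rewrite /xnorm sqrtr_gt0; exact: K2_gt0.
rewrite /Ag; case: c => [[h _]|h]; first by split=> //; exact: pz.
have h1 : 0 < xnorm xi.
  rewrite -lte_fin; apply: le_lt_trans h; rewrite /xi_vc /esqrt.
  by case: (ereal_inf _) => [x| |] /=; rewrite ?leey// lee_fin ?sqrtr_ge0.
by split=> //; exact: nz.
Qed.

Let Sr := rho'_sm rho_bdd rho_der rho_test.

Let Ir f : L2R f -> intg (fun x => rho' x * f x ^+ 2).
Proof.
by move=> Lf; apply: intgMb; [exact: sm_P Sr|exact: cont_meas (sm_cont Sr)|exact: L2_intg].
Qed.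

Lemma unstable_bump : exists f, sm (@csupp R) f /\ 0 < iR (fun x => rho' x * f x ^+ 2).
Proof.
have [eta [Ce He]] := mollifier_exists rho_test rho_x0.
have h2 : 0 < rho' x0 / 2 by rewrite divr_gt0.
have /cvgrPdist_lt /(_ _ h2) := sm_cont Sr (x := x0).
move=> /nbhs_ballP [d /= d0 Hd].
have [Se ge i1 se] := He x0 d d0.
have Le := moll_L2 He x0 d0.
exists (eta x0 d); split=> //.
have [y Hy] : exists y, eta x0 d y != 0.
  apply: contrapT => H; have : iR (eta x0 d) = 0.
    rewrite (_ : eta x0 d = fun=> 0); last first.
      by apply/funext => y; apply/eqP; apply: contrapT => h; apply: H; exists y; exact/negP.
    by rewrite /iR /IntR integral0.
  by rewrite i1 => /eqP; rewrite oner_eq0.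
have h := iR_sq_gt0 (sm_cont Se) Le Hy.
apply: (@lt_le_trans _ _ (rho' x0 / 2 * iR (fun x => eta x0 d x ^+ 2))).
  by rewrite mulr_gt0// divr_gt0.
rewrite -iRZ; last exact: L2_intg.
apply: iR_le; [by apply: intgZ; exact: L2_intg|exact: Ir|].
move=> x; have [xd|xd] := leP d `|x - x0|; first by rewrite se// expr0n !mulr0.
rewrite ler_wpM2r ?sqr_ge0//.
have := Hd x; rewrite /ball /= distrC => /(_ xd).
by rewrite ltr_norml => /andP[_]; lra.
Qed.

(** At xi = (0, 1/L) the magnetic energy vanishes, so any bump located where rho' is positive has
    negative energy. *)
Lemma horizontal_mode : c = Horizontal -> exists xi, [/\ lattice L xi, Ag g rhob c M xi &
  exists p, pairs g nu rhob c M xi p /\ p.1 < 0].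
Proof.
move=> cH; rewrite cH; have Li : 0 < L^-1 by rewrite invr_gt0.
pose xi : R * R := (0, L^-1).
have A : Ag g rhob Horizontal M xi.
  split; last by right.
  by apply/eqP => -[h]; rewrite h ltxx in Li.
have [k0 _] : 0 < xnorm xi /\ xi != (0, 0).
  by split; [rewrite sqrtr_gt0 /xi /= expr0n add0r exprn_gt0|case: A].
exists xi; split=> //.
  by exists 0, 1; rewrite /xi mul0r mul1r.
have [f [Sf hf]] := unstable_bump.
have Sfe : sm (edec (1:R)) f by apply: sm_impl Sf => u cu su; exact: csupp_edec.
have hH := smooth_H2 ltr01 Sfe; have [Lf [Lf1 [Lf2 _]]] := hH.
have [D HD] := sm_P Sr.
apply: (pairs_neg g_gt0 c0_gt0 k0 rho_bdd rho_der rho_test rho_pos HD hH).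
rewrite /energy.
rewrite (_ : (fun x => _) = (fun x => - (g * xnorm xi ^+ 2) * (rho' x * f x ^+ 2))); last first.
  by apply/funext => x; rewrite /mVert /mHor /xi /=; ring.
rewrite iRZ; last exact: Ir.
by rewrite mulNr oppr_lt0 mulr_gt0// mulr_gt0// exprn_gt0.
Qed.

(** |M| < M_c gives an H^1 function on which gravity beats M^2 times the Dirichlet integral. After
    regularisation to H^2, the bending term is divided by |xi|^2 and loses at large frequencies. *)
Lemma vertical_mode : c = Vertical -> exists xi, [/\ lattice L xi, Ag g rhob c M xi &
  exists p, pairs g nu rhob c M xi p /\ p.1 < 0].
Proof.
move=> cV; move: hM; rewrite cV => -[M0 HM].
have M2 : 0 < M ^+ 2 by rewrite -real_normK ?num_real// exprn_gt0.
have [f [f1 [hf [_ Hratio]]]] : exists f f1, H1 f f1 /\ nz f /\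
    M ^+ 2 < iR (fun x => g * rho' x * f x ^+ 2) / iR (fun x => f1 x ^+ 2).
  move: HM; rewrite /Mc; set S := ereal_sup _ => HS.
  have : ((M ^+ 2)%:E < S)%E.
    case: S HS => [x| |] /=; rewrite ?ltry//.
    - rewrite !lte_fin => h; rewrite -real_normK ?num_real//.
      have x0' : 0 < x by rewrite -sqrtr_gt0; apply: lt_trans h.
      by rewrite -[ltRHS](sqr_sqrtr (ltW x0')) ltrXn2r// nnegrE ?sqrtr_ge0.
    - by rewrite lte_fin => h; have := lt_trans M0 h; rewrite ltxx.
  move=> /ereal_sup_gt [_ [f [f1 [h1 [h2 ->]]]]]; rewrite lte_fin => h.
  by exists f, f1.
have [Lf [Lf1 _]] := hf.
(* With a zero denominator the quotient would be 0 by convention and could not exceed M^2. *)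
have n0 : 0 < iR (fun x => f1 x ^+ 2).
  rewrite lt_neqAle iR_ge0 ?andbT => [|x]; last exact: sqr_ge0.
  by apply/eqP => h; move: Hratio; rewrite -h invr0 mulr0 => /(lt_trans M2); rewrite ltxx.
have Hf : M ^+ 2 / g * iR (fun x => f1 x ^+ 2) < iR (fun x => rho' x * f x ^+ 2).
  move: Hratio; rewrite ltr_pdivlMr// (_ : (fun x => g * rho' x * f x ^+ 2) = (fun x => g * (rho' x * f x ^+ 2))); last first.
    by apply/funext => x; rewrite -mulrA.
  rewrite iRZ; last exact: Ir.
  by rewrite (mulrAC (M ^+ 2)) ltr_pdivrMr// (mulrC _ g).
have [eta [Ce He]] := mollifier_exists rho_test rho_x0.
have Mg : 0 <= M ^+ 2 / g by rewrite divr_ge0 ?sqr_ge0 ?ltW.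
have [F [F1 [F2 [HF dpos]]]] := H1_to_H2 He hf rho_test Mg Hf.
have [LF [LF1 [LF2 _]]] := HF.
have [IF [IF1 IF2]] := (Ir LF, (L2_intg LF1, L2_intg LF2)).
pose d := iR (fun x => g * rho' x * F x ^+ 2 - M ^+ 2 * F1 x ^+ 2).
have d0 : 0 < d.
  rewrite /d (_ : (fun x => _) = (fun x => g * (rho' x * F x ^+ 2 - M ^+ 2 / g * F1 x ^+ 2))); last first.
    by apply/funext => x; field; rewrite gt_eqF.
  by rewrite iRZ ?mulr_gt0//; apply: intgB => //; exact: intgZ.
have dE : d = g * iR (fun x => rho' x * F x ^+ 2) - M ^+ 2 * iR (fun x => F1 x ^+ 2).
  rewrite -!iRZ// -iRB; [|exact: intgZ|exact: intgZ].
  by congr iR; apply/funext => x; rewrite -mulrA.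
pose kap := M ^+ 2 * iR (fun x => F2 x ^+ 2) / d.
have kap0 : 0 <= kap.
  by rewrite /kap divr_ge0 ?(ltW d0)// mulr_ge0 ?sqr_ge0// iR_ge0// => x; exact: sqr_ge0.
(* The added 1 makes the frequency n/L exceed 1 as well as [kap], so that its square exceeds
   [kap]. *)
have [n Hn] : exists n : nat, (kap + 1) * L < n%:R.
  exists (Num.truncn ((kap + 1) * L)).+1; exact: truncnS_gt.
have kL0 : 0 < (kap + 1) * L by rewrite mulr_gt0//; lra.
have nL : kap + 1 < n%:R / L by rewrite ltr_pdivlMr.
have nL0 : 0 < n%:R / L by lra.
pose xi : R * R := (n%:R / L, 0).
have xiE : xnorm xi = n%:R / L.
  by rewrite /xnorm /xi /= expr0n addr0 sqrtr_sqr gtr0_norm.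
have k0 : 0 < xnorm xi by rewrite xiE.
have sq : kap < (n%:R / L) ^+ 2.
  by have : 1 * (n%:R / L) <= n%:R / L * (n%:R / L); [apply: ler_wpM2r; lra|rewrite -expr2; lra].
exists xi; split.
- by exists n%:Z, 0; rewrite /xi mul0r.
- rewrite /Ag xiE; apply: (@le_lt_trans _ _ (Num.sqrt kap)%:E); last first.
    by rewrite lte_fin -(gtr0_norm nL0) -sqrtr_sqr ltr_sqrt// (le_lt_trans kap0).
  have : (ereal_inf [set e | exists f f1 f2, H2 f f1 f2 /\
     (0 < iR (fun x => g * drhob rhob x * f x ^+ 2 - M ^+ 2 * f1 x ^+ 2))%R /\
     e = (M ^+ 2 * iR (fun x => f2 x ^+ 2)
          / iR (fun x => g * drhob rhob x * f x ^+ 2 - M ^+ 2 * f1 x ^+ 2))%:E]%R <= kap%:E)%E.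
    by apply: ereal_inf_lbound; exists F, F1, F2.
  rewrite /xi_vc; case: (ereal_inf _) => [x| |] //=.
  by rewrite !lee_fin; exact: ler_wsqrtr.
- have [D HD] := sm_P Sr.
  apply: (pairs_neg g_gt0 c0_gt0 k0 rho_bdd rho_der rho_test rho_pos HD HF).
  rewrite /energy xiE; set k := n%:R / L.
  rewrite (_ : (fun x => _) = (fun x => M ^+ 2 * k ^+ 2 * F1 x ^+ 2 + M ^+ 2 * F2 x ^+ 2
     - g * k ^+ 2 * (rho' x * F x ^+ 2))); last first.
    by apply/funext => x; rewrite /mVert /mHor /=; ring.
  rewrite iRB; [|by apply: intgD; exact: intgZ|exact: intgZ].
  rewrite iRD; [|exact: intgZ|exact: intgZ].
  rewrite !iRZ//.
  have : M ^+ 2 * iR (fun x => F2 x ^+ 2) < k ^+ 2 * d by rewrite -ltr_pdivrMr.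
  by rewrite dE; lra.
Qed.

End Existence.

(** * Choice of an almost optimal frequency *)

Section GrowthRate.
Variable R : realType.
Variables (L g nu : R) (rhob : R -> R) (c : Mcase) (M c0 x0 D : R).
Local Notation rho' := (derive1 rhob).
Hypotheses (L_gt0 : 0 < L) (g_gt0 : 0 < g) (nu_gt0 : 0 < nu) (c0_gt0 : 0 < c0).
Hypothesis rho_bdd : bdd rhob.
Hypothesis rho_der : forall x, derivable rhob x 1.
Hypothesis rho_test : test_fn rho'.
Hypothesis rho_pos : forall x, c0 <= rhob x.
Hypothesis rho_x0 : 0 < rho' x0.
Hypothesis rho'_le : forall x, `|rho' x| <= D.
Hypothesis hM : Mhyp g rhob c M.

Lemma lamP xi : (exists s, lam_spec g nu rhob c M xi s) ->
  lam_spec g nu rhob c M xi (lam g nu rhob c M xi).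
Proof. by move=> H; exact: (xgetPex 0 H). Qed.

(** [lam] takes the default value 0 when no growth rate exists, and genuine rates are positive; a
    nonzero value is therefore genuine. *)
Lemma lam_neq0P xi : lam g nu rhob c M xi != 0 -> lam_spec g nu rhob c M xi (lam g nu rhob c M xi).
Proof.
move=> h; apply: lamP; apply: contrapT => H; move/eqP: h; apply.
by rewrite /lam xgetPN// => s hs; apply: H; exists s.
Qed.

Lemma lam_le xi : Ag g rhob c M xi -> lam g nu rhob c M xi <= g * D / c0 + 1.
Proof.
move=> A; have [k0 _] := Ag_xnorm A.
have [->|/lam_neq0P Hs] := eqVneq (lam g nu rhob c M xi) 0.
  have D0 : 0 <= D by apply: le_trans (rho'_le 0).
  by apply: addr_ge0 => //; apply: divr_ge0; [apply: mulr_ge0 => //|]; exact: ltW.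
have neg := lam_spec_neg nu_gt0 Hs.
exact: (lam_spec_le g_gt0 nu_gt0 c0_gt0 k0 rho_bdd rho_der rho_test rho_pos rho'_le neg Hs).
Qed.

Lemma growth_rate : exists xi, [/\ lattice L xi, Ag g rhob c M xi,
  lam_spec g nu rhob c M xi (lam g nu rhob c M xi),
  ((2 / 3)%:E * Lam g nu rhob c M L < (lam g nu rhob c M xi)%:E)%E &
  ((lam g nu rhob c M xi)%:E <= Lam g nu rhob c M L)%E].
Proof.
have [xi [lx Ax px]] : exists xi, [/\ lattice L xi, Ag g rhob c M xi &
  exists p, pairs g nu rhob c M xi p /\ p.1 < 0].
  have [cE|cE] : c = Horizontal \/ c = Vertical by case: (c); [left|right].
    exact: (horizontal_mode nu M L_gt0 g_gt0 c0_gt0 rho_bdd rho_der rho_test rho_pos rho_x0).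
  exact: (vertical_mode nu L_gt0 g_gt0 c0_gt0 rho_bdd rho_der rho_test rho_pos rho_x0 hM).
have [k0 _] := Ag_xnorm Ax.
have [l0 _] := lamP (lam_spec_exists g_gt0 nu_gt0 c0_gt0 k0 rho_bdd rho_der rho_test rho_pos rho'_le px).
have ub y : Ag g rhob c M y -> lattice L y -> ((lam g nu rhob c M y)%:E <= Lam g nu rhob c M L)%E.
  by move=> Ay ly; apply: ereal_sup_ubound; exists y.
have le : (Lam g nu rhob c M L <= (g * D / c0 + 1)%:E)%E.
  by apply: ge_ereal_sup => _ [y [Ay [ly ->]]]; rewrite lee_fin; exact: lam_le.
(* The unstable frequency makes Lambda positive and the bound independent of xi makes it finite;
   only then is two thirds of it strictly smaller. *)
have : ((2 / 3)%:E * Lam g nu rhob c M L < Lam g nu rhob c M L)%E.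
  case: (Lam _ _ _ _ _ _) (ub _ Ax lx) le => [l| |] //=.
  by rewrite !lee_fin -EFinM lte_fin => h1 _; lra.
rewrite [X in (_ < X)%E]/Lam => /ereal_sup_gt [_ [y [Ay [ly ->]]] hy].
exists y; split; [exact: ly|exact: Ay| |exact: hy|exact: ub].
(* Exceeding a nonnegative number, the value at [y] is not the default 0. *)
have l1 : 0 < lam g nu rhob c M y.
  rewrite -lte_fin; apply: le_lt_trans hy; apply: mule_ge0.
    by rewrite lee_fin divr_ge0.
  by apply: le_trans (ub _ Ax lx); rewrite lee_fin ltW.
by apply: lam_neq0P; rewrite gt_eqF.
Qed.

End GrowthRate.

(** A constant that decays is 0. This carries nontriviality from psi to psi', the profile of the
    horizontal velocity and, for the vertical field, of N_3. *)
Lemma edec_der_neq0 (R : realType) (a : R) (f f1 : R -> R) : 0 < a -> isd f f1 -> edec a f ->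
  (exists x, f x != 0) -> exists x, f1 x != 0.
Proof.
move=> a0 df ef [x fx]; apply: contrapT => H.
have f1_0 y : f1 y = 0 by apply/eqP; apply: contrapT => h; apply: H; exists y; exact/negP.
have fE : f = fun=> f x.
  apply/funext => y; have [yx|/ltW xy] := leP y x.
    by rewrite (isd_cst df yx).
  by rewrite (isd_cst df xy).
have [h _] := edec_vanish a0 ef.
move/eqP: fx; apply; rewrite fE in h.
exact: cvg_unique (cvg_cst (f x)) h.
Qed.

Theorem theorem2p3 (R : realType) (L g mu : R) (rhob : R -> R) (c : Mcase) (M : R) :
  0 < L -> 0 < g -> 0 < mu ->
  (* rhob in L^infty(R) *)
  measurable_fun setT rhob -> (exists C : R, forall x, `|rhob x| <= C) ->
  (* rhob' in C_0^infty(R) *)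
  (forall x, derivable rhob x 1) -> test_fn (derive1 rhob) ->
  (* inf rhob > 0 *)
  (exists c0 : R, 0 < c0 /\ forall x, c0 <= rhob x) ->
  (exists x0 : R, 0 < derive1 rhob x0) ->
  Mhyp g rhob c M ->
  exists Ls : R,
    ((2 / 3)%:E * Lam g mu rhob c M L < Ls%:E)%E /\ (Ls%:E <= Lam g mu rhob c M L)%E /\
    exists (rho : fld R) (u N : vfld R) (q : fld R),
      (* smooth, real-valued, horizontally hperiodic solution *)
      smoothF rho /\ (forall i, (i < 3)%N -> smoothF (u i)) /\ (forall i, (i < 3)%N -> smoothF (N i)) /\ smoothF q /\
      hperiodic L rho /\ (forall i, (i < 3)%N -> hperiodic L (u i)) /\ (forall i, (i < 3)%N -> hperiodic L (N i)) /\
      hperiodic L q /\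
      lin_sol g mu rhob (Mvec c M) rho u N q /\
      vanish_at_infty rho /\ (forall i, (i < 3)%N -> vanish_at_infty (u i)) /\
      (forall i, (i < 3)%N -> vanish_at_infty (N i)) /\
      (* (1) *)
      (forall k : nat,
         (esqrt (Hk2 L k rho 0 + Hk2 L k (u 0%N) 0 + Hk2 L k (u 1%N) 0 + Hk2 L k (u 2%N) 0
                 + Hk2 L k (N 0%N) 0 + Hk2 L k (N 1%N) 0 + Hk2 L k (N 2%N) 0
                 + Hk2 L k q 0) < +oo)%E) /\
      (* (2) *)
      (forall (t : R) (k : nat), 0 < t ->
         (Hk2 L k rho t < +oo)%E /\ (forall i, (i < 3)%N -> (Hk2 L k (u i) t < +oo)%E) /\
         (forall i, (i < 3)%N -> (Hk2 L k (N i) t < +oo)%E) /\ (Hk2 L k q t < +oo)%E /\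
         esqrt (Hk2 L k rho t + Hk2 L k (N 0%N) t + Hk2 L k (N 1%N) t + Hk2 L k (N 2%N) t
                + Hk2 L k q t)
         = ((expR (Ls * t))%:E *
            esqrt (Hk2 L k rho 0 + Hk2 L k (N 0%N) 0 + Hk2 L k (N 1%N) 0 + Hk2 L k (N 2%N) 0
                   + Hk2 L k q 0))%E /\
         (forall i, (i < 3)%N -> Hk L k (u i) t = ((expR (Ls * t))%:E * Hk L k (u i) 0)%E)) /\
      (* (3) *)
      (forall x1 x2 x3, divF (u) 0 x1 x2 x3 = 0 /\ divF N 0 x1 x2 x3 = 0) /\
      (0 < esqrt (Hk2 L 0 (u 0%N) 0 + Hk2 L 0 (u 1%N) 0) * esqrt (Hk2 L 0 (u 2%N) 0))%E /\
      (* (4) *)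
      (c = Vertical -> (0 < Hk L 0 (N 2%N) 0)%E).
Proof.
move=> L0 g0 mu0 _ rho_bdd rho_der rho_test [c0 [c00 rho_pos]] [x0 rho_x0] hM.
have [D rho'_le] := sm_P (rho'_sm rho_bdd rho_der rho_test).
have [xi [lx Ax Hs Hlt Hle]] :=
  growth_rate L0 g0 mu0 c00 rho_bdd rho_der rho_test rho_pos rho_x0 rho'_le hM.
set s := lam _ _ _ _ _ _ in Hs Hlt Hle; exists s; split=> //; split=> //.
have s0 : 0 < s by case: Hs.
have [k0 xi0] := Ag_xnorm Ax.
have [_ [r0 Hr]] := rho_test.
(* The support condition of a test function is strict and its radius may be negative; the enlarged
   radius is positive and works with a weak inequality. *)
have r1 : 0 < `|r0| + 1 :> R by rewrite ltr_wpDl.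
have supp x : `|r0| + 1 <= `|x| -> derive1 rhob x = 0.
  by move=> h; apply: Hr; apply: le_lt_trans (ler_norm r0) _; lra.
have neg := lam_spec_neg mu0 Hs.
have [a [psi [w [a0 [Spsi Hpsi w_sol wE]]]]] := minimizer g0 mu0 c00 k0 rho_bdd rho_der rho_test
  rho_pos rho'_le neg r1 rho_x0 supp Hs.
rewrite {}wE in Spsi Hpsi.
have Um i := U_mode w_sol Spsi i.
have Nm i := N_mode w_sol Spsi i.
have Rm := RHO_mode xi s rho_bdd rho_der rho_test Spsi.
have Qm := Q_mode rho_bdd rho_der rho_test w_sol Spsi.
have gr k f : is_mode s a xi f -> grows s (Hk2 L k f) by exact: grows_Hk2.
have [d0 _ _ _] := w_sol.
have S1 : sm (edec a) (w 1%N) by rewrite -(isdE d0); exact: sm_der.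
have sq_gt0 F : sm (edec a) F -> (exists x, F x != 0) -> 0 < iR (fun x => F x ^+ 2).
  move=> SF [x Fx]; apply: (iR_sq_gt0 (sm_cont SF) _ Fx).
  by apply: (edec_L2 a0); [exact: cont_meas (sm_cont SF)|exact: sm_P SF].
have psi0 := sq_gt0 _ Spsi Hpsi.
have psi1 := sq_gt0 _ S1 (edec_der_neq0 a0 d0 (sm_P Spsi) Hpsi).
have I1 : intg (fun x => w 1%N x ^+ 2).
  by apply: L2_intg; apply: (edec_L2 a0); [exact: cont_meas (sm_cont S1)|exact: sm_P S1].
have cell0 : 0 < 2 * pi ^+ 2 * L ^+ 2 by rewrite !mulr_gt0// ?exprn_gt0// pi_gt0.
have iR_scal q : iR (fun x => (q * w 1%N x) ^+ 2) = q ^+ 2 * iR (fun x => w 1%N x ^+ 2).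
  by rewrite -iRZ//; congr iR; apply/funext => x; rewrite exprMn.
exists (RHOfield rhob xi s w), (Ufield xi s w), (Nfield c M xi s w), (Qfield mu rhob c M xi s w).
split; first exact: is_mode_smooth Rm.
split; first by move=> i _; exact: is_mode_smooth (Um i).
split; first by move=> i _; exact: is_mode_smooth (Nm i).
split; first exact: is_mode_smooth Qm.
split; first exact: (is_mode_periodic L0 lx Rm).
split; first by move=> i _; exact: (is_mode_periodic L0 lx (Um i)).
split; first by move=> i _; exact: (is_mode_periodic L0 lx (Nm i)).
split; first exact: (is_mode_periodic L0 lx Qm).
split; first exact: (modes_solve s0 mu0 xi0 rho_der w_sol Spsi).
split; first exact: (is_mode_vanish a0 Rm).
split; first by move=> i _; exact: (is_mode_vanish a0 (Um i)).
split; first by move=> i _; exact: (is_mode_vanish a0 (Nm i)).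
split.
  move=> k; have G := growsD (growsD (growsD (growsD (growsD (growsD (growsD (gr k _ Rm)
    (gr k _ (Um 0%N))) (gr k _ (Um 1%N))) (gr k _ (Um 2%N))) (gr k _ (Nm 0%N)))
    (gr k _ (Nm 1%N))) (gr k _ (Nm 2%N))) (gr k _ Qm).
  exact: (grows_sqrt_lt 0 G).
split.
  move=> t k t0.
  split; first exact: (grows_lt t (gr k _ Rm)).
  split; first by move=> i _; exact: (grows_lt t (gr k _ (Um i))).
  split; first by move=> i _; exact: (grows_lt t (gr k _ (Nm i))).
  split; first exact: (grows_lt t (gr k _ Qm)).
  split; last by move=> i _; exact: (grows_sqrt t (gr k _ (Um i))).
  have G := growsD (growsD (growsD (growsD (gr k _ Rm) (gr k _ (Nm 0%N))) (gr k _ (Nm 1%N)))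
    (gr k _ (Nm 2%N))) (gr k _ Qm).
  exact: (grows_sqrt t G).
split; first by move=> x1 x2 x3; split; [exact: (divU xi0 w_sol)|exact: (divN s0 xi0 w_sol)].
have H0 b F := @Hk2_0 _ s a L xi a0 L0 lx xi0 b F.
split.
  (* The squared coefficients of psi' in u_1 and u_2 add up to 1/|xi|^2, so the pair is nonzero even
     if one component of xi vanishes. *)
  rewrite /Ufield !H0//; [|exact: sm_edecZ|exact: sm_edecZ].
  rewrite !iR_scal -EFinD /= -EFinM lte_fin; apply: mulr_gt0; rewrite sqrtr_gt0; last exact: mulr_gt0.
  rewrite -mulrDr -mulrDl !sqrrN !exprMn -mulrDl; apply: mulr_gt0 => //; apply: mulr_gt0 => //.
  by apply: mulr_gt0; rewrite ?exprn_gt0 ?invr_gt0//; exact: K2_gt0.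
move=> cV; rewrite /Hk /Nfield cV H0; last exact: sm_edecZ.
have M0 : M != 0 by move: hM; rewrite cV => -[]; rewrite normr_gt0.
rewrite iR_scal /= lte_fin sqrtr_gt0; apply: mulr_gt0 => //; apply: mulr_gt0 => //.
by rewrite lt_neqAle sqr_ge0 andbT eq_sym expf_neq0// mulf_neq0// invr_eq0 gt_eqF.
Qed.
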